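(* Let $F$ satisfy the hypotheses of the context (those corresponding to $k=0$, together with the uniform strict convexity of $F''$). For all $\ell>0$ let $u_\ell$ be a minimizer of ${\cal P}_\ell$, and let $u_\infty$ be the minimizer of ${\cal P}_\infty$. Then for all $1\le r<n$ and all $\ell_0>0$, there exist constants $C$ and $\alpha>0$ independent of $\ell$ such that, for all $\ell\ge\ell_0$, $$\|\nabla(u_\ell-u_\infty)\|_{L^p(\Omega_{\ell_0})}\le Ce^{-\alpha\ell}.$$
   Context: Let $1\le r<n$ be integers, $p>1$, $\frac1p+\frac1{p'}=1$. Let $\omega'\subset\mathbb{R}^r$ be a bounded open set, $0\in\omega'$, starshaped with respect to $0$, whose gauge function $g(x')=\inf\{t>0;\ x'/t\in\omega'\}$ is Lipschitz on $\mathbb{R}^r$. Let $\omega''\subset\mathbb{R}^{n-r}$ be a bounded open set. For $\ell>0$ let $\omega'_\ell=\ell\omega'$ and $\Omega_\ell=\omega'_\ell\times\omega''$. Write $x=(x',x'')$, $\xi=(\xi',\xi'')\in\mathbb{R}^r\times\mathbb{R}^{n-r}$, $\nabla''=(\partial_{r+1},\dots,\partial_n)$. $|\cdot|$ is the Euclidean norm. A function of $x''$ only is also regarded as a function of $x$ independent of $x'$. Let $F:\mathbb{R}^n\to\mathbb{R}$ be convex, $F''(\xi'')=F(0,\xi'')$, $G(\xi)=F(\xi)-F''(\xi'')$. Assume there are constants $0<\lambda\le\Lambda$ such that for all $\xi\in\mathbb{R}^n$, $$\lambda|\xi|^p\le F(\xi)\le\Lambda(|\xi|^p+1),\qquad \lambda|\xi'|^p\le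 G(\xi)\le\Lambda|\xi'|^p.$$ Assume that $F''$ is uniformly strictly convex: there is $\beta>0$ such that for all $\xi'',\zeta''\in\mathbb{R}^{n-r}$ and all $\theta,\mu\in[0,1]$ with $\theta+\mu=1$, $$F''(\theta\xi''+\mu\zeta'')\le\theta F''(\xi'')+\mu F''(\zeta'')-\beta\theta\mu(\theta^{p-1}+\mu^{p-1})|\xi''-\zeta''|^p.$$ Let $f''\in L^{p'}(\omega'')$. Problem ${\cal P}_\ell$: minimize over $W^{1,p}_0(\Omega_\ell)$ the functional $J_\ell(v)=\int_{\Omega_\ell}[F(\nabla v(x))-f''(x'')v(x)]\,dx$. Problem ${\cal P}_\infty$: minimize over $W^{1,p}_0(\omega'')$ the functional $J_\infty(v)=\int_{\omega''}[F''(\nabla''v(x''))-f''(x'')v(x'')]\,dx''$. Both problems have at least one minimizer. *)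

(* Defs.v *)
From HB Require Import structures.
From mathcomp Require Import all_boot all_order all_algebra.
From mathcomp Require Import all_classical all_reals all_analysis.

Set Implicit Arguments.
Unset Strict Implicit.
Unset Printing Implicit Defensive.

Import Order.TTheory GRing.Theory Num.Theory.
Import numFieldNormedType.Exports.

Local Open Scope classical_set_scope.
Local Open Scope ring_scope.

(* R^d is 'rV[R]_d, whose library topology is the usual one.  The library     *)
(* provides neither a sigma-algebra nor a measure on it: below it gets the    *)
(* product (Borel) sigma-algebra, generated by the coordinates.               *)

Section measurable_rV.
Context (R : realType) (d : nat).

Let coord (i : 'I_d) (x : 'rV[R]_d) : R := x ord0 i.

Let rV_set0 : g_sigma_preimage coord set0.
Proof. exact: sigma_algebra0. Qed.

Let rV_setC A : g_sigma_preimage coord A -> g_sigma_preimage coord (~` A).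
Proof. exact: sigma_algebraC. Qed.

Let rV_bigcup (F : _^nat) : (forall i, g_sigma_preimage coord (F i)) ->
  g_sigma_preimage coord (\bigcup_i (F i)).
Proof. exact: sigma_algebra_bigcup. Qed.

HB.instance Definition _ := @isMeasurable.Build default_measure_display
  'rV[R]_d (g_sigma_preimage coord) rV_set0 rV_setC rV_bigcup.

End measurable_rV.

Section measurable_fun_rV.
Context (R : realType) (d : nat).

Lemma measurable_coord (i : 'I_d) :
  measurable_fun [set: 'rV[R]_d] (fun x => x ord0 i).
Proof.
move=> _ Y mY; rewrite setTI; apply: sub_sigma_algebra => /=.
rewrite -bigcup_seq/=; exists i => /=; first by rewrite mem_index_enum.
by exists Y => //; rewrite setTI.
Qed.

Lemma measurable_fun_rV d1 (T1 : measurableType d1) (f : T1 -> 'rV[R]_d) :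
  (forall i, measurable_fun [set: T1] (fun t => f t ord0 i)) ->
  measurable_fun [set: T1] f.
Proof.
move=> mf; suff : g_sigma_preimage (fun i t => f t ord0 i) `<=` measurable.
  rewrite (@g_sigma_preimage_comp _ R d _ (fun i (x : 'rV[R]_d) => x ord0 i)).
  by move=> prefS _ A mA; apply: prefS; exists A.
apply: smallest_sub; first exact: sigma_algebra_measurable.
rewrite -bigcup_seq; apply: bigcup_sub => i _ A [B mB <-].
exact: mf.
Qed.

End measurable_fun_rV.

(* Lebesgue measure on R^d, as an iterated product of Lebesgue measures on R: *)
(* R^(d+1) is identified with R * R^d by (t, y) |-> (t, y_1, ..., y_d).       *)

Section lebesgue_rV.
Context (R : realType).

Definition cons_rV (d : nat) (z : measurableTypeR R * 'rV[R]_d) : 'rV[R]_d.+1 :=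
  \row_i oapp (fun j => z.2 ord0 j) z.1 (unlift ord0 i).

Definition uncons_rV (d : nat) (x : 'rV[R]_d.+1) :
  measurableTypeR R * 'rV[R]_d :=
  (x ord0 ord0, \row_j x ord0 (lift ord0 j)).

Lemma cons_rVK d : cancel (@cons_rV d) (@uncons_rV d).
Proof.
move=> [t y]; rewrite /uncons_rV /cons_rV mxE unlift_none/=; congr pair.
by apply/rowP => j; rewrite !mxE liftK.
Qed.

Lemma measurable_cons_rV d : measurable_fun setT (@cons_rV d).
Proof.
apply: measurable_fun_rV => i; rewrite /cons_rV.
under eq_fun do rewrite mxE.
case: (unlift ord0 i) => [j|]/=; last exact: measurable_fst.
exact: (measurableT_comp (measurable_coord j) measurable_snd).
Qed.

Lemma measurable_uncons_rV d : measurable_fun setT (@uncons_rV d).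
Proof.
apply/measurable_fun_pair; first exact: measurable_coord.
apply: measurable_fun_rV => i; under eq_fun do rewrite mxE.
exact: measurable_coord.
Qed.

Section step.
Context (d : nat) (mu : {sigma_finite_measure set 'rV[R]_d -> \bar R}).

Definition lebesgue_step : set 'rV[R]_d.+1 -> \bar R :=
  pushforward (@lebesgue_measure R \x mu)%E (@cons_rV d).

Let step0 : lebesgue_step set0 = 0%E.
Proof. by rewrite /lebesgue_step /pushforward preimage_set0 measure0. Qed.

Let step_ge0 A : (0 <= lebesgue_step A)%E.
Proof. by rewrite /lebesgue_step /pushforward measure_ge0. Qed.

Let step_sigma_additive : semi_sigma_additive lebesgue_step.
Proof.
have mE A : measurable A -> measurable (@cons_rV d @^-1` A).
  by move=> mA; rewrite -[X in measurable X]setTI; exact: measurable_cons_rV.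
move=> F mF tF mUF; rewrite /lebesgue_step /pushforward preimage_bigcup.
apply: measure_semi_sigma_additive => [n||]; first exact: mE.
- apply/trivIsetP => i j _ _ ij; rewrite -preimage_setI.
  by move/trivIsetP : tF => /(_ _ _ I I ij) ->; rewrite preimage_set0.
- by rewrite -preimage_bigcup; exact: mE.
Qed.

HB.instance Definition _ := isMeasure.Build _ _ _ lebesgue_step
  step0 step_ge0 step_sigma_additive.

Let step_sigma_finite : sigma_finite setT lebesgue_step.
Proof.
have /sigma_finiteP[F [TF ndF Foo]] := sigma_finiteT (@lebesgue_measure R).
have /sigma_finiteP[G [TG ndG Goo]] := sigma_finiteT mu.
exists (fun n => @uncons_rV d @^-1` (F n `*` G n)).
  rewrite -preimage_bigcup (_ : \bigcup_n _ = setT) ?preimage_setT//.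
  apply/seteqP; split=> // -[x y] _.
  have [[k _ Fx] [l _ Gy]] : (\bigcup_n F n) x /\ (\bigcup_n G n) y.
    by rewrite -TF -TG.
  exists (maxn k l) => //; split=> /=.
    by move: x Fx; exact/subsetPset/ndF/leq_maxl.
  by move: y Gy; exact/subsetPset/ndG/leq_maxr.
move=> n; have [mF Fn] := Foo n; have [mG Gn] := Goo n; split.
  rewrite -[X in measurable X]setTI; apply: measurable_uncons_rV => //.
  exact: measurableX.
rewrite /lebesgue_step /pushforward -comp_preimage.
rewrite (_ : _ \o _ = id); last by apply/funext => z; exact: cons_rVK.
by rewrite preimage_id product_measure1E// lte_mul_pinfty// ge0_fin_numE.
Qed.

HB.instance Definition _ := Measure_isSigmaFinite.Build _ _ _ lebesgue_step
  step_sigma_finite.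

End step.

Fixpoint lebesgue_rV (d : nat) : {sigma_finite_measure set 'rV[R]_d -> \bar R} :=
  match d with
  | 0 => \d_(0 : 'rV[R]_0)
  | e.+1 => lebesgue_step (lebesgue_rV e)
  end.

Lemma lebesgue_rV_box (d : nat) (A : 'I_d -> set (measurableTypeR R)) :
  (forall i, measurable (A i)) ->
  lebesgue_rV d [set x | forall i, A i (x ord0 i)] =
  (\prod_(i < d) lebesgue_measure (A i))%E.
Proof.
elim: d A => [A _|d ih A mA].
  rewrite big_ord0 (_ : mkset _ = setT) /= ?diracT//.
  by apply/seteqP; split=> // x _ [].
have mB : measurable
    [set y : 'rV[R]_d | forall j, A (lift ord0 j) (y ord0 j)].
  rewrite (_ : mkset _ = \bigcap_(j in [set: 'I_d])
    (fun y : 'rV[R]_d => y ord0 j) @^-1` A (lift ord0 j)).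
    apply: fin_bigcap_measurable => // j _.
    rewrite -[X in measurable X]setTI; apply: (measurable_coord j) => //.
    exact: mA.
  by apply/seteqP; split=> [y Ay j _|y Ay j]; exact: Ay.
rewrite big_ord_recl -ih//= /lebesgue_step /pushforward.
rewrite -product_measure1E//; congr (_ _).
apply/seteqP; split=> [[t y] /= Ay|[t y] /= [At Ay] i].
  split=> [|j]; first by have := Ay ord0; rewrite mxE unlift_none.
  by have := Ay (lift ord0 j); rewrite mxE liftK.
by rewrite mxE; case: unliftP => [j|] ->//=.
Qed.

End lebesgue_rV.
Arguments lebesgue_rV : clear implicits.

Section sobolev.
Context (R : realType) (d : nat).
Implicit Types (Omega : set 'rV[R]_d) (f u v phi : 'rV[R]_d -> R).
Implicit Types (g : 'rV[R]_d -> 'rV[R]_d) (p : R).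
Local Notation mu := (lebesgue_rV R d).

(* The library norm `|x| on 'rV[R]_d is the sup norm. *)
Definition enorm (x : 'rV[R]_d) : R := Num.sqrt (\sum_i x ord0 i ^+ 2).

(* A function on Omega is represented by a function on R^d whose values       *)
(* outside Omega are ignored; f \_ Omega is its extension by 0.               *)
Definition inLp p Omega f : Prop := f \_ Omega \in Lfun mu p%:E.

Definition Lp_norm p Omega f : \bar R := 'N[mu]_p%:E[EFin \o (f \_ Omega)]%E.

Definition partial (i : 'I_d) f (x : 'rV[R]_d) : R :=
  'D_(delta_mx ord0 i) f x.

Definition iter_partial (s : seq 'I_d) f : 'rV[R]_d -> R := foldr partial f s.

Definition grad f (x : 'rV[R]_d) : 'rV[R]_d := \row_i partial i f x.

Definition smooth f : Prop := forall s : seq 'I_d,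
  continuous (iter_partial s f) /\
  forall (i : 'I_d) x, derivable (iter_partial s f) x (delta_mx ord0 i).

Definition test_function Omega phi : Prop :=
  [/\ smooth phi, compact (closure [set x | phi x != 0]) &
      closure [set x | phi x != 0] `<=` Omega].

Definition locally_integrable_on Omega f : Prop :=
  measurable_fun Omega f /\
  forall K, K `<=` Omega -> compact K -> mu.-integrable K (EFin \o f).

Definition weak_gradient Omega u g : Prop :=
  [/\ locally_integrable_on Omega u,
      forall i, locally_integrable_on Omega (fun x => g x ord0 i) &
      forall phi i, test_function Omega phi ->
        \int[mu]_(x in Omega) (u x * partial i phi x) =
        - \int[mu]_(x in Omega) (g x ord0 i * phi x)].

(* Weak gradients on an open set are unique up to a null set; wgrad picks one *)
(* of them, and is junk when u has none.                                      *)
Definition wgrad Omega u : 'rV[R]_d -> 'rV[R]_d := get (weak_gradient Omega u).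

(* W^{1,p}(Omega) *)
Definition sobolev p Omega u : Prop :=
  [/\ inLp p Omega u, weak_gradient Omega u (wgrad Omega u) &
      forall i, inLp p Omega (fun x => wgrad Omega u x ord0 i)].

(* W^{1,p}_0(Omega): the closure of the test functions in W^{1,p}(Omega) *)
Definition sobolev0 p Omega u : Prop :=
  sobolev p Omega u /\
  forall e : R, 0 < e -> exists2 phi, test_function Omega phi &
    (Lp_norm p Omega (fun x => u x - phi x)%R +
     Lp_norm p Omega (fun x => enorm (wgrad Omega u x - grad phi x)%R)
       < e%:E)%E.

Definition energy Omega (F : 'rV[R]_d -> R) f v : \bar R :=
  (\int[mu]_(x in Omega) (F (wgrad Omega v x) - f x * v x)%:E)%E.

Definition minimizer p Omega (F : 'rV[R]_d -> R) f u : Prop :=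
  sobolev0 p Omega u /\
  forall v, sobolev0 p Omega v ->
    (energy Omega F f u <= energy Omega F f v)%E.

Definition starshaped0 Omega : Prop :=
  forall x t, Omega x -> 0 <= t <= 1 -> Omega (t *: x).

Definition gauge Omega (x : 'rV[R]_d) : R :=
  inf [set t | 0 < t /\ Omega (t^-1 *: x)].

Definition dilate (l : R) Omega : set 'rV[R]_d := [set l *: x | x in Omega].

End sobolev.

Definition cylinder (R : realType) (r m : nat)
    (A : set 'rV[R]_r) (B : set 'rV[R]_m) : set 'rV[R]_(r + m) :=
  [set x | A (lsubmx x) /\ B (rsubmx x)].

(* Main.v *)
Require Import Defs.
From mathcomp Require Import all_boot all_order all_algebra.
From mathcomp Require Import all_classical all_reals all_analysis.
From mathcomp Require Import measurable_realfun ring lra.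
Set Implicit Arguments.
Unset Strict Implicit.
Unset Printing Implicit Defensive.
Import Order.TTheory GRing.Theory Num.Theory.
Import numFieldNormedType.Exports.
Local Open Scope classical_set_scope.
Local Open Scope ring_scope.

(** The difference of the two minimizers is controlled by a hole-filling argument
    in the unbounded directions.

    All comparisons are made between smooth functions. Minimizers are replaced
    by test functions [phi] on the cylinder and [psi] on its cross section that
    minimize up to an error [eps] ([near_minimizer]); [eps] is chosen at the very
    end, exponentially small. Let [w = phi - psi(x'')] and let [theta] be a
    cut-off function of [x'] alone that equals 1/2 on the cube of half-side [s]
    and vanishes off the cube of half-side [s + 1]. Then [v = phi - theta w]
    competes with [phi] and, for each fixed [x'], [psi + theta w(x', .)] competes
    with [psi]. When the second inequality is integrated in [x'] and added to the
    first, the terms in [f''] cancel, since [f''] does not depend on [x'], and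
    the integral of
      [F(grad phi) - F(grad v) + F''(grad psi)
         - F''((1 - theta) grad psi + theta grad'' phi)]
    is at most of order [eps].

    On the inner cube both competitors are midpoints: there the integrand is at
    least a multiple of [|grad w|^p], because uniform strict convexity of [F'']
    controls the [x'']-part and the lower bound on [G] the [x']-part
    ([energy_gain_midpoint]). On the annulus, convexity and the upper bound on
    [G] show that it is at least [- C (|grad w|^p + |w|^p)]
    ([energy_loss_bound]), and the Poincare inequality in [x''] absorbs [|w|^p].
    Hence, with [E s] the energy of [w] over the cube of half-side [s],
      [c E(s) <= k (E(s + 1) - E(s)) + error]
    ([hole_filling]), that is [E(s) <= q E(s + 1) + error] with [q < 1].

    A cylinder of length [l] leaves room for a number of steps proportional to
    [l], and its total energy grows at most like [l ^ r] by comparison with the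
    zero function ([energy_bound]); so the energy of [w] over a fixed cylinder
    decays exponentially ([local_energy_decay], [decay_rate]). The transfer to
    the weak gradients of the minimizers rests on their uniqueness almost
    everywhere ([fundamental_lemma], [wgrad_eq], [wgrad_difference_bound]). *)

(** * Topology and measurability of row vectors *)

Section rV_topology.
Context (R : realType) (d : nat).
Implicit Types (U A : set 'rV[R]_d) (x : 'rV[R]_d).

Lemma rV_nbhsP x (P : set 'rV[R]_d) : nbhs x P <->
  exists2 e : R, 0 < e & forall y : 'rV[R]_d, (forall i, `|x ord0 i - y ord0 i| < e) -> P y.
Proof.
split.
  move=> /nbhs_ballP[e e0 eP]; exists e => // y xy; apply: eP.
  by split => // i j; rewrite ord1; exact: xy.
move=> [e e0 eP]; apply/nbhs_ballP; exists e => // y [_ xy]; apply: eP => i.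
exact: xy.
Qed.

Lemma rV_norm_coord x i : `|x ord0 i| <= `|x|.
Proof.
rewrite [leRHS]/Num.norm /= mx_normrE; apply/bigmax_geP; right => /=.
by exists (ord0, i).
Qed.

Definition obox (a b : 'rV[R]_d) : set 'rV[R]_d :=
  [set x | forall i, a ord0 i < x ord0 i < b ord0 i].

Definition cbox (a b : 'rV[R]_d) : set 'rV[R]_d :=
  [set x | forall i, a ord0 i <= x ord0 i <= b ord0 i].

Lemma obox_cbox a b : obox a b `<=` cbox a b.
Proof. by move=> x xab i; have /andP[/ltW -> /ltW ->] := xab i. Qed.

Lemma measurable_box (I : 'I_d -> interval R) :
  measurable [set x : 'rV[R]_d | forall i, x ord0 i \in I i].
Proof.
rewrite (_ : mkset _ = \bigcap_(i in [set: 'I_d])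
    (fun x : 'rV[R]_d => x ord0 i) @^-1` [set` I i]); last first.
  by apply/seteqP; split=> [x xI i _|x xI i]; [exact: xI|exact: xI i Logic.I].
apply: fin_bigcap_measurable => // i _.
by rewrite -[X in measurable X]setTI; exact: measurable_coord.
Qed.

Lemma measurable_obox a b : measurable (obox a b).
Proof.
have := measurable_box (fun i => `]a ord0 i, b ord0 i[).
by congr measurable; apply/seteqP; split=> x xab i; have := xab i; rewrite /= in_itv.
Qed.

Lemma measurable_cbox a b : measurable (cbox a b).
Proof.
have := measurable_box (fun i => `[a ord0 i, b ord0 i]).
by congr measurable; apply/seteqP; split=> x xab i; have := xab i; rewrite /= in_itv.
Qed.

Lemma compact_cbox a b : compact (cbox a b).
Proof.
rewrite (_ : cbox a b = [set x : 'rV[R]_d | forall i,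
    (fun i => `[a ord0 i, b ord0 i]%classic) i (x ord0 i)]); last first.
  by apply/seteqP; split=> x xab i; have := xab i; rewrite /= in_itv.
apply: (@rV_compact _ _ (fun i => `[a ord0 i, b ord0 i]%classic)) => i.
exact: segment_compact.
Qed.

(** A countable family of boxes, given by a rational centre and an integer that
    measures the size, is enough to exhaust every open set. *)
Definition rat_lower (q : 'rV[rat]_d * nat) : 'rV[R]_d :=
  \row_i (ratr (q.1 ord0 i) - q.2.+1%:R^-1).

Definition rat_upper (q : 'rV[rat]_d * nat) : 'rV[R]_d :=
  \row_i (ratr (q.1 ord0 i) + q.2.+1%:R^-1).

Lemma open_bigcup_rat_box U : open U ->
  U = \bigcup_(q in [set q | cbox (rat_lower q) (rat_upper q) `<=` U])
        obox (rat_lower q) (rat_upper q).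
Proof.
move=> oU; apply/seteqP; split=> [x Ux|x [q /= qU]]; last by move=> /obox_cbox/qU.
have /rV_nbhsP[e e0 eU] : nbhs x U by exact: open_nbhs_nbhs.
pose n := Num.truncn (4 / e).
have ne : n.+1%:R^-1 <= e / 4.
  rewrite -[e / 4]invrK lef_pV2 ?posrE ?invr_gt0 ?divr_gt0//.
  by rewrite invf_div ltW// truncnS_gt.
have n0 : 0 < n.+1%:R^-1 :> R by rewrite invr_gt0.
have /choice[q qP] : forall i : 'I_d, exists q : rat,
    x ord0 i < ratr q < x ord0 i + n.+1%:R^-1.
  move=> i; have : x ord0 i < x ord0 i + n.+1%:R^-1 by rewrite ltrDl.
  by move=> /rat_in_itvoo[q]; rewrite in_itv/= => qi; exists q.
move: ne n0 qP; set r := _^-1 => ne n0 qP.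
exists (\row_i q i, n) => [y /= yq|i /=].
  apply: eU => i; have /andP[y1 y2] := yq i; have /andP[q1 q2] := qP i.
  rewrite !mxE -/r in y1 y2.
  by rewrite ltr_distl; apply/andP; split; move: q1 q2 y1 y2 ne n0 e0; lra.
have /andP[q1 q2] := qP i; rewrite !mxE -/r.
by apply/andP; split; move: q1 q2 n0; lra.
Qed.

Lemma measurable_rV_open U : open U -> measurable U.
Proof.
move=> oU; rewrite (open_bigcup_rat_box oU) bigcup_mkcond.
apply: countable_bigcupT_measurable => [|q]; first exact: countableP.
by case: ifP => // _; exact: measurable_obox.
Qed.

Lemma measurable_compact U : compact U -> measurable U.
Proof.
move=> cU; rewrite -[U]setCK; apply: measurableC; apply: measurable_rV_open.
by apply: closed_openC; apply: compact_closed => //; exact: norm_hausdorff.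
Qed.

Lemma measurable_rV_continuous (f : 'rV[R]_d -> R) :
  continuous f -> measurable_fun [set: 'rV[R]_d] f.
Proof.
move=> cf; apply: (measurability _ (RGenOpens.measurableE R)) => _ [_ [a [b ->] <-]].
rewrite setTI; apply: measurable_rV_open.
by apply: open_comp => [x _|]; [exact: cf|exact: interval_open].
Qed.

End rV_topology.

(** * Lebesgue measure on a product *)

Section lebesgue_product.
Context (R : realType).

Definition glue_rV (r m : nat) (z : 'rV[R]_r * 'rV[R]_m) : 'rV[R]_(r + m) :=
  row_mx z.1 z.2.

Lemma measurable_glue_rV r m : measurable_fun setT (@glue_rV r m).
Proof.
apply: measurable_fun_rV => i; rewrite /glue_rV.
case: (split_ordP i) => j ->.
  under eq_fun do rewrite row_mxEl.
  exact: (measurableT_comp (measurable_coord j) measurable_fst).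
under eq_fun do rewrite row_mxEr.
exact: (measurableT_comp (measurable_coord j) measurable_snd).
Qed.

Lemma measurable_lsubmx r m : measurable_fun setT (@lsubmx R 1 r m).
Proof.
apply: measurable_fun_rV => i; under eq_fun do rewrite mxE.
exact: measurable_coord.
Qed.

Lemma measurable_rsubmx r m : measurable_fun setT (@rsubmx R 1 r m).
Proof.
apply: measurable_fun_rV => i; under eq_fun do rewrite mxE.
exact: measurable_coord.
Qed.

Lemma measurable_cons_section d (t : R) :
  measurable_fun setT (fun y : 'rV[R]_d => cons_rV (t, y)).
Proof.
apply: measurable_fun_rV => i; under eq_fun do rewrite mxE.
by case: (unlift ord0 i) => [j|]/=; [exact: measurable_coord|exact: measurable_cst].
Qed.

Lemma cons_glue r m (t : R) (x : 'rV[R]_r) (y : 'rV[R]_m) :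
  row_mx (cons_rV (t, x)) y = cons_rV (t, row_mx x y) :> 'rV[R]_(r.+1 + m).
Proof.
apply/rowP => i; rewrite [RHS]mxE/=.
case: (split_ordP i) => j ->.
  rewrite row_mxEl mxE/=; case: (unliftP ord0 j) => [k ->|->]/=.
    have -> : lshift m (lift ord0 k) = lift ord0 (lshift m k) :> 'I_(r + m).+1.
      exact/val_inj.
    by rewrite liftK/= row_mxEl.
  have -> : lshift m ord0 = ord0 :> 'I_(r + m).+1 by exact/val_inj.
  by rewrite unlift_none.
have -> : rshift r.+1 j = lift ord0 (rshift r j) :> 'I_(r + m).+1.
  exact/val_inj.
rewrite liftK/= row_mxEr; rewrite (_ : lift ord0 _ = rshift r.+1 j) ?row_mxEr//.
exact/val_inj.
Qed.

Lemma ge0_integral_lebesgue_rVS d (h : 'rV[R]_d.+1 -> \bar R) :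
  measurable_fun setT h -> (forall x, 0 <= h x)%E ->
  (\int[lebesgue_rV R d.+1]_x h x =
   \int[@lebesgue_measure R]_t \int[lebesgue_rV R d]_x h (cons_rV (t, x)))%E.
Proof.
move=> mh h0; rewrite [LHS]ge0_integral_pushforward//; last exact: measurable_cons_rV.
rewrite preimage_setT fubini_tonelli1//.
exact: (measurableT_comp mh (@measurable_cons_rV R d)).
by move=> x; exact: h0.
Qed.

(** The measure on [R^(r+m)] is built by adding one coordinate at a time on the
    left, so induction on [r] identifies it with the product measure. *)
Lemma tonelli_rV_setT r m (h : 'rV[R]_(r + m) -> \bar R) :
  measurable_fun setT h -> (forall x, 0 <= h x)%E ->
  (\int[lebesgue_rV R (r + m)]_x h x =
   \int[lebesgue_rV R r]_x \int[lebesgue_rV R m]_y h (row_mx x y))%E.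
Proof.
elim: r h => [|r IH] h mh h0.
  rewrite [RHS]integral_dirac//=.
    rewrite diracT mul1e; apply: eq_integral => y _; congr h.
    apply/rowP => i; have := row_mxEr (0 : 'rV[R]_0) (y : 'rV[R]_m) ord0 i.
    by rewrite (_ : rshift 0 i = i)//; apply: val_inj.
  apply: (measurable_fun_fubini_tonelli_F (h \o @glue_rV 0 m)).
    exact: (measurableT_comp mh (@measurable_glue_rV 0 m)).
  by move=> x; exact: h0.
rewrite [LHS]ge0_integral_lebesgue_rVS// [RHS]ge0_integral_lebesgue_rVS//; first last.
- by move=> x; exact: integral_ge0.
- apply: (measurable_fun_fubini_tonelli_F (h \o @glue_rV r.+1 m)).
    exact: (measurableT_comp mh (@measurable_glue_rV r.+1 m)).
  by move=> x; exact: h0.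
apply: eq_integral => t _; rewrite IH//.
  apply: eq_integral => x _; apply: eq_integral => y _.
  by rewrite cons_glue.
apply: (measurableT_comp mh).
exact: measurable_cons_section.
Qed.

Lemma lebesgue_rV_glue r m (A : set 'rV[R]_(r + m)) : measurable A ->
  lebesgue_rV R (r + m) A =
  pushforward (lebesgue_rV R r \x lebesgue_rV R m)%E (@glue_rV r m) A.
Proof.
move=> mA; have mgA : measurable (@glue_rV r m @^-1` A).
  by rewrite -[X in measurable X]setTI; exact: measurable_glue_rV.
transitivity (\int[lebesgue_rV R (r + m)]_x (\1_A x)%:E)%E.
  by rewrite integral_indic// setIT.
rewrite tonelli_rV_setT; last by move=> x; rewrite lee_fin.
  2: by apply/measurable_EFinP; exact: measurable_indic.
transitivity
  (\int[lebesgue_rV R r \x lebesgue_rV R m]_z (\1_(@glue_rV r m @^-1` A) z)%:E)%E.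
  rewrite fubini_tonelli1//.
  by apply/measurable_EFinP; exact: measurable_indic.
by rewrite integral_indic// setIT.
Qed.

End lebesgue_product.

Section cylinder_integrals.
Context (R : realType) (r m : nat).
Implicit Types (A : set 'rV[R]_r) (B : set 'rV[R]_m).
Local Notation mu1 := (lebesgue_rV R r).
Local Notation mu2 := (lebesgue_rV R m).
Local Notation mu := (lebesgue_rV R (r + m)).

Lemma measurable_cylinder A B :
  measurable A -> measurable B -> measurable (cylinder A B).
Proof.
move=> mA mB; rewrite (_ : cylinder A B =
  (@lsubmx R 1 r m @^-1` A) `&` (@rsubmx R 1 r m @^-1` B))//.
by apply: measurableI; rewrite -[X in measurable X]setTI;
  [exact: measurable_lsubmx|exact: measurable_rsubmx].
Qed.

Lemma cylinder_row_mx A B x y : cylinder A B (row_mx x y) = (A x /\ B y).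
Proof. by rewrite /cylinder/= row_mxKl row_mxKr. Qed.

Lemma patch_cylinder A B (h : 'rV[R]_(r + m) -> \bar R) x y :
  ((h \_ (cylinder A B)) (row_mx x y) =
   ((fun x => ((fun y => h (row_mx x y)) \_ B) y) \_ A) x)%E.
Proof.
rewrite /patch; have [xA|xA] := boolP (x \in A); last first.
  by rewrite memNset// cylinder_row_mx => -[/mem_set]; rewrite (negbTE xA).
rewrite /patch; have [yB|yB] := boolP (y \in B).
  by rewrite mem_set// cylinder_row_mx; split; exact/set_mem.
by rewrite memNset// cylinder_row_mx => -[_ /mem_set]; rewrite (negbTE yB).
Qed.

Lemma integral_patch_cylinder A B (h : 'rV[R]_(r + m) -> \bar R) :
  (\int[mu1]_x \int[mu2]_y (h \_ (cylinder A B)) (row_mx x y) =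
   \int[mu1]_(x in A) \int[mu2]_(y in B) h (row_mx x y))%E.
Proof.
rewrite [RHS]integral_mkcond; apply: eq_integral => x _.
under eq_integral do rewrite patch_cylinder.
rewrite /patch; case: ifPn => xA; last by rewrite integral0_eq.
by rewrite [RHS]integral_mkcond.
Qed.

Lemma integral_patch_cylinder_swap A B (h : 'rV[R]_(r + m) -> \bar R) :
  (\int[mu2]_y \int[mu1]_x (h \_ (cylinder A B)) (row_mx x y) =
   \int[mu2]_(y in B) \int[mu1]_(x in A) h (row_mx x y))%E.
Proof.
rewrite [RHS]integral_mkcond; apply: eq_integral => y _.
under eq_integral do rewrite patch_cylinder.
rewrite /patch; case: ifPn => yB; first by rewrite [RHS]integral_mkcond.
by rewrite integral0_eq// => x _; case: ifP.
Qed.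

Lemma tonelli_cylinder A B (h : 'rV[R]_(r + m) -> \bar R) :
  measurable A -> measurable B -> measurable_fun (cylinder A B) h ->
  (forall x, cylinder A B x -> 0 <= h x)%E ->
  (\int[mu]_(x in cylinder A B) h x =
   \int[mu1]_(x in A) \int[mu2]_(y in B) h (row_mx x y))%E.
Proof.
move=> mA mB mh h0; have mC := measurable_cylinder mA mB.
rewrite integral_mkcond tonelli_rV_setT ?integral_patch_cylinder//.
  exact/(measurable_restrictT _ _).1.
exact: erestrict_ge0.
Qed.

Lemma integrable_glue A B (h : 'rV[R]_(r + m) -> \bar R) :
  measurable A -> measurable B -> mu.-integrable (cylinder A B) h ->
  (mu1 \x mu2)%E.-integrable setT ((h \_ (cylinder A B)) \o @glue_rV R r m).
Proof.
move=> mA mB; have mC := measurable_cylinder mA mB.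
move=> /integrable_mkcond-/(_ mC)/integrableP[mh hoo]; apply/integrableP; split.
  exact: (measurableT_comp mh (@measurable_glue_rV R r m)).
rewrite fubini_tonelli1; last by move=> z; exact: abse_ge0.
  2: by apply: measurableT_comp => //; exact: (measurableT_comp mh (@measurable_glue_rV R r m)).
by rewrite tonelli_rV_setT in hoo => //; exact: measurableT_comp.
Qed.

Lemma integral_glue A B (h : 'rV[R]_(r + m) -> \bar R) :
  measurable A -> measurable B -> mu.-integrable (cylinder A B) h ->
  (\int[mu]_(x in cylinder A B) h x =
   \int[mu1 \x mu2]_z ((h \_ (cylinder A B)) \o @glue_rV R r m) z)%E.
Proof.
move=> mA mB ih; have mC := measurable_cylinder mA mB.
have ihg := integrable_glue mA mB ih.
have /integrableP[mh _] := (integrable_mkcond _ mC).1 ih.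
rewrite integral_mkcond.
have mg := @measurable_glue_rV R r m.
have E := integral_pushforward mg mh (D := setT).
rewrite preimage_setT in E; rewrite -E//.
by apply: eq_measure_integral => A' mA' _; exact: lebesgue_rV_glue.
Qed.

Lemma fubini_cylinder A B (h : 'rV[R]_(r + m) -> \bar R) :
  measurable A -> measurable B -> mu.-integrable (cylinder A B) h ->
  (\int[mu]_(x in cylinder A B) h x =
   \int[mu1]_(x in A) \int[mu2]_(y in B) h (row_mx x y))%E.
Proof.
move=> mA mB ih; rewrite integral_glue// -integral12_prod_meas1; last first.
  exact: integrable_glue.
exact: integral_patch_cylinder.
Qed.

Lemma fubini_cylinder_swap A B (h : 'rV[R]_(r + m) -> \bar R) :
  measurable A -> measurable B -> mu.-integrable (cylinder A B) h ->
  (\int[mu]_(x in cylinder A B) h x =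
   \int[mu2]_(y in B) \int[mu1]_(x in A) h (row_mx x y))%E.
Proof.
move=> mA mB ih; rewrite integral_glue// -integral21_prod_meas1; last first.
  exact: integrable_glue.
exact: integral_patch_cylinder_swap.
Qed.

End cylinder_integrals.

Section cube.
Context (R : realType) (d : nat).

Definition cube (M : R) : set 'rV[R]_d := [set x | forall i, `|x ord0 i| <= M].

Lemma lebesgue_cube (M : R) : 0 <= M -> lebesgue_rV R d (cube M) = ((M *+ 2) ^+ d)%:E.
Proof.
move=> M0; pose I (_ : 'I_d) : set (measurableTypeR R) := `[- M, M]%classic.
have mI i : measurable (I i) by exact: measurable_itv.
rewrite (_ : cube M = [set x | forall i, I i (x ord0 i)]); last first.
  by apply/seteqP; split=> x Mx i; have := Mx i; rewrite /I/= in_itv/= ler_norml.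
rewrite (lebesgue_rV_box mI) (eq_bigr (fun=> (M *+ 2)%:E)); last first.
  move=> i _; rewrite /I lebesgue_measure_itv/= lte_fin; case: ifPn => [_|].
    by rewrite -EFinB opprK mulr2n.
  rewrite -leNgt => MM; congr EFin; rewrite mulr2n; lra.
by rewrite prodEFin prodr_const card_ord.
Qed.

Lemma cubeE M : cube M = cbox (const_mx (- M)) (const_mx M).
Proof. by apply/seteqP; split=> x Mx i; have := Mx i; rewrite ?mxE -ler_norml. Qed.

Lemma measurable_cube M : measurable (cube M).
Proof. by rewrite cubeE; exact: measurable_cbox. Qed.

Lemma bounded_sub_cube (A : set 'rV[R]_d) :
  bounded_set A -> exists2 M, 0 < M & A `<=` cube M.
Proof.
move=> [M [_ AM]]; exists (`|M| + 1) => [|x Ax i]; first by rewrite ltr_wpDl.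
rewrite (le_trans (rV_norm_coord _ _))//; apply: AM => //.
by rewrite (le_lt_trans (ler_norm M))// ltrDl.
Qed.

Lemma bounded_lebesgue_lty (A : set 'rV[R]_d) : measurable A ->
  bounded_set A -> (lebesgue_rV R d A < +oo)%E.
Proof.
move=> mA /bounded_sub_cube[M M0 AM].
rewrite (@le_lt_trans _ _ (lebesgue_rV R d (cube M)))//.
  by apply: le_measure; rewrite ?inE//; exact: measurable_cube.
by rewrite lebesgue_cube ?ltry// ltW.
Qed.

Lemma compact_cube M : compact (cube M).
Proof. by rewrite cubeE; exact: compact_cbox. Qed.

End cube.

(** * Smooth functions *)

Section derive_line.
Context (R : realType) (V W : normedModType R).

(** Two functions that agree along a line have the same difference quotients,
    so their directional derivatives can be compared without a chain rule. *)
Lemma quotient_line (f : V -> R) (g : W -> R) x v y w :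
  (forall h : R, f (h *: v + x) = g (h *: w + y)) ->
  (fun h => h^-1 *: ((f \o shift x) (h *: v) - f x)) =
  (fun h => h^-1 *: ((g \o shift y) (h *: w) - g y)).
Proof.
move=> fg; apply/funext => h /=; rewrite fg; congr (_ *: (_ - _)).
by have := fg 0; rewrite !scale0r !add0r.
Qed.

Lemma derive_line (f : V -> R) (g : W -> R) x v y w :
  (forall h : R, f (h *: v + x) = g (h *: w + y)) -> 'D_v f x = 'D_w g y.
Proof. by move=> /quotient_line fg; rewrite /derive fg. Qed.

Lemma derivable_line (f : V -> R) (g : W -> R) x v y w :
  (forall h : R, f (h *: v + x) = g (h *: w + y)) ->
  derivable g y w -> derivable f x v.
Proof. by move=> /quotient_line fg; rewrite /derivable fg. Qed.

End derive_line.

Section smooth_calculus.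
Context (R : realType) (d : nat).
Implicit Types (f g : 'rV[R]_d -> R) (x : 'rV[R]_d) (i : 'I_d).

Lemma smooth_continuous f : smooth f -> continuous f.
Proof. by move=> /(_ [::])[]. Qed.

Lemma smooth_derivable f i x : smooth f -> derivable f x (delta_mx ord0 i).
Proof. by move=> /(_ [::])[]. Qed.

Lemma smooth_partial f i : smooth f -> smooth (partial i f).
Proof.
move=> sf s; have := sf (rcons s i).
rewrite (_ : iter_partial (rcons s i) f = iter_partial s (partial i f)) //.
exact: foldr_rcons.
Qed.

(** A class of functions that is closed under partial derivatives consists of
    smooth functions; smoothness is always proved by exhibiting such a class. *)
Lemma smooth_coind (P : ('rV[R]_d -> R) -> Prop) :
  (forall f, P f -> [/\ continuous f,
     (forall i x, derivable f x (delta_mx ord0 i)) &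
     forall i, P (partial i f)]) ->
  forall f, P f -> smooth f.
Proof.
move=> PP f Pf s; suff : P (iter_partial s f) by move=> /PP[].
by elim: s => //= i s /PP[].
Qed.

Lemma partial_cst (c : R) i : partial i (fun=> c) = (fun=> 0).
Proof. by apply/funext => x; rewrite /partial derive_cst. Qed.

Lemma smooth_cst (c : R) : smooth (fun _ : 'rV[R]_d => c).
Proof.
apply: (@smooth_coind (fun f => exists c, f = fun=> c)); last by exists c.
move=> _ [{}c ->]; split=> [x|i x|i]; first exact: cst_continuous.
  exact: derivable_cst.
by exists 0; rewrite partial_cst.
Qed.

Lemma partialM f g i : smooth f -> smooth g ->
  partial i (fun x => f x * g x) =
  (fun x => f x * partial i g x + g x * partial i f x).
Proof.
by move=> sf sg; apply/funext => x; rewrite /partial deriveM//;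
  exact: smooth_derivable.
Qed.

(** The algebra generated by the smooth functions: it is stable under partial
    derivatives by the Leibniz rule, hence consists of smooth functions. *)
Inductive smooth_alg : ('rV[R]_d -> R) -> Prop :=
| alg_smooth f : smooth f -> smooth_alg f
| algD f g : smooth_alg f -> smooth_alg g -> smooth_alg (fun x => f x + g x)
| algM f g : smooth_alg f -> smooth_alg g -> smooth_alg (fun x => f x * g x).

Lemma smooth_algP f : smooth_alg f -> smooth f.
Proof.
apply: smooth_coind => {}f; elim=> {f} [f sf|f g af [cf df pf] ag [cg dg pg]|
    f g af [cf df pf] ag [cg dg pg]].
- split; [exact: smooth_continuous|by move=> i x; exact: smooth_derivable|].
  by move=> i; exact/alg_smooth/smooth_partial.
- split=> [x|i x|i]; [exact: cvgD (cf x) (cg x)|exact: derivableD|].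
  rewrite (_ : partial i _ = fun x => partial i f x + partial i g x).
    exact: algD.
  by apply/funext => x; rewrite /partial deriveD.
- split=> [x|i x|i]; [exact: cvgM (cf x) (cg x)|exact: derivableM|].
  rewrite (_ : partial i _ =
      fun x => f x * partial i g x + g x * partial i f x).
    by apply: algD; exact: algM.
  by apply/funext => x; rewrite /partial deriveM.
Qed.

Lemma smoothD f g : smooth f -> smooth g -> smooth (fun x => f x + g x).
Proof. by move=> sf sg; apply: smooth_algP; apply: algD; exact: alg_smooth. Qed.

Lemma smoothM f g : smooth f -> smooth g -> smooth (fun x => f x * g x).
Proof. by move=> sf sg; apply: smooth_algP; apply: algM; exact: alg_smooth. Qed.

Lemma smoothN f : smooth f -> smooth (fun x => - f x).
Proof.
move=> sf; rewrite (_ : (fun x => _) = fun x => - 1 * f x); last first.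
  by apply/funext => x; rewrite mulN1r.
exact: smoothM (smooth_cst _) sf.
Qed.

Lemma smoothB f g : smooth f -> smooth g -> smooth (fun x => f x - g x).
Proof. by move=> sf /smoothN; exact: smoothD. Qed.

Lemma partialB f g i : smooth f -> smooth g ->
  partial i (fun x => f x - g x) = (fun x => partial i f x - partial i g x).
Proof.
by move=> sf sg; apply/funext => x; rewrite /partial deriveB//;
  exact: smooth_derivable.
Qed.

Lemma smooth_prod (I : Type) (s : seq I) (F : I -> 'rV[R]_d -> R) :
  (forall k, smooth (F k)) -> smooth (fun x => \prod_(k <- s) F k x).
Proof.
move=> sF; elim: s => [|k s IH].
  by under eq_fun do rewrite big_nil; exact: smooth_cst.
by under eq_fun do rewrite big_cons; exact: smoothM.
Qed.

Lemma gradB f g x : smooth f -> smooth g ->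
  grad (fun x => f x - g x) x = grad f x - grad g x.
Proof. by move=> sf sg; apply/rowP => i; rewrite !mxE partialB. Qed.

Lemma gradM f g x : smooth f -> smooth g ->
  grad (fun x => f x * g x) x = f x *: grad g x + g x *: grad f x.
Proof. by move=> sf sg; apply/rowP => i; rewrite !mxE partialM. Qed.

Lemma gradZ (c : R) f x : smooth f ->
  grad (fun x => c * f x) x = c *: grad f x.
Proof.
move=> sf; rewrite gradM//; last exact: smooth_cst.
rewrite [X in _ + f x *: X](_ : _ = 0) ?scaler0 ?addr0//.
by apply/rowP => i; rewrite !mxE partial_cst.
Qed.

End smooth_calculus.

(** Block projections and slices are affine maps that send each basis direction
    to a basis direction or to zero; [s] records which. Composition with such a
    map only permutes or kills partial derivatives. *)
Section smooth_comp.
Context (R : realType) (a b : nat) (L : 'rV[R]_a -> 'rV[R]_b)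
  (s : 'I_a -> option 'I_b).
Hypothesis LE : forall (h : R) i x, L (h *: delta_mx ord0 i + x) =
  h *: oapp (fun j => delta_mx ord0 j) 0 (s i) + L x.
Hypothesis cL : continuous L.

Lemma partial_comp (f : 'rV[R]_b -> R) i : partial i (f \o L) =
  (if s i is Some j then partial j f else fun=> 0) \o L.
Proof.
apply/funext => x; rewrite /partial/=.
rewrite (derive_line (g := f) (y := L x)
  (w := oapp (fun j => delta_mx ord0 j) 0 (s i))); last first.
  by move=> h /=; rewrite LE.
case: (s i) => //=; rewrite /derive (_ : (fun h => _) = fun=> 0).
  by rewrite lim_cst.
by apply/funext => h; rewrite /= scaler0 add0r subrr scaler0.
Qed.

Lemma smooth_comp (f : 'rV[R]_b -> R) : smooth f -> smooth (f \o L).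
Proof.
move=> sf.
apply: (@smooth_coind _ _ (fun f => exists2 g, smooth g & f = g \o L)).
  move=> _ [g sg ->]; split=> [x|i x|i].
  - apply: continuous_comp; [exact: cL|exact: smooth_continuous].
  - apply: (derivable_line (g := g) (y := L x)
      (w := oapp (fun j => delta_mx ord0 j) 0 (s i))).
      by move=> h /=; rewrite LE.
    case: (s i) => [j|]/=; first exact: smooth_derivable.
    rewrite /derivable (_ : (fun h => _) = fun=> 0); first exact: is_cvg_cst.
    by apply/funext => h; rewrite /= scaler0 add0r subrr scaler0.
  - rewrite partial_comp; case: (s i) => [j|].
      by exists (partial j g) => //; exact: smooth_partial.
    by exists (fun=> 0) => //; exact: smooth_cst.
by exists f.
Qed.

End smooth_comp.

Section smooth_blocks.
Context (R : realType) (r m : nat).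

Lemma delta_lshift (i : 'I_r) :
  delta_mx ord0 (lshift m i) = row_mx (delta_mx ord0 i) 0 :> 'rV[R]_(r + m).
Proof.
apply/rowP => k; case: (split_ordP k) => j ->.
  by rewrite row_mxEl !mxE !eqxx/= (inj_eq (@lshift_inj _ _)).
by rewrite row_mxEr !mxE eqxx/= eq_rlshift.
Qed.

Lemma delta_rshift (i : 'I_m) :
  delta_mx ord0 (rshift r i) = row_mx 0 (delta_mx ord0 i) :> 'rV[R]_(r + m).
Proof.
apply/rowP => k; case: (split_ordP k) => j ->.
  by rewrite row_mxEl !mxE eqxx/= eq_lrshift.
by rewrite row_mxEr !mxE !eqxx/= (inj_eq (@rshift_inj _ _)).
Qed.

Let row_mx_lin (h : R) (x1 x2 : 'rV[R]_r) (y1 y2 : 'rV[R]_m) :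
  h *: row_mx x1 y1 + row_mx x2 y2 = row_mx (h *: x1 + x2) (h *: y1 + y2).
Proof. by rewrite scale_row_mx add_row_mx. Qed.

Lemma continuous_rV a b (L : 'rV[R]_a -> 'rV[R]_b) :
  (forall i, continuous (fun x => L x ord0 i)) -> continuous L.
Proof.
move=> cL x A /rV_nbhsP[e e0 eA].
suff : \forall t \near x, forall i, `|L x ord0 i - L t ord0 i| < e.
  by apply: (@filterS _ _ (nbhs_filter x)) => t; exact: eA.
apply: (@filter_forall _ _ _ _ (nbhs_filter x)) => i.
by have /cvgrPdist_lt/(_ _ e0) := cL i x.
Qed.

Lemma continuous_lsubmx : continuous (@lsubmx R 1 r m).
Proof.
apply: continuous_rV => i; under eq_fun do rewrite mxE.
exact: coord_continuous.
Qed.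

Lemma continuous_rsubmx : continuous (@rsubmx R 1 r m).
Proof.
apply: continuous_rV => i; under eq_fun do rewrite mxE.
exact: coord_continuous.
Qed.

Lemma continuous_row_mxr (x : 'rV[R]_r) :
  continuous (fun y : 'rV[R]_m => row_mx x y).
Proof.
apply: continuous_rV => i; case: (split_ordP i) => j ->.
  by under eq_fun do rewrite row_mxEl; exact: cst_continuous.
by under eq_fun do rewrite row_mxEr; exact: coord_continuous.
Qed.

Lemma continuous_row_mxl (y : 'rV[R]_m) :
  continuous (fun x : 'rV[R]_r => row_mx x y).
Proof.
apply: continuous_rV => i; case: (split_ordP i) => j ->.
  by under eq_fun do rewrite row_mxEl; exact: coord_continuous.
by under eq_fun do rewrite row_mxEr; exact: cst_continuous.
Qed.

Let slE (h : R) (i : 'I_(r + m)) (x : 'rV[R]_(r + m)) :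
  lsubmx (h *: delta_mx ord0 i + x) =
  h *: oapp (fun j => delta_mx ord0 j) 0
    (match fintype.split i with inl j => Some j | inr _ => None end) + lsubmx x.
Proof.
rewrite linearD linearZ/=; congr (_ *: _ + _).
case: (split_ordP i) => j ->; rewrite ?(unsplitK (inl j)) ?(unsplitK (inr j))/=.
  by rewrite delta_lshift row_mxKl.
by rewrite delta_rshift row_mxKl.
Qed.

Let srE (h : R) (i : 'I_(r + m)) (x : 'rV[R]_(r + m)) :
  rsubmx (h *: delta_mx ord0 i + x) =
  h *: oapp (fun j => delta_mx ord0 j) 0
    (match fintype.split i with inl _ => None | inr j => Some j end) + rsubmx x.
Proof.
rewrite linearD linearZ/=; congr (_ *: _ + _).
case: (split_ordP i) => j ->; rewrite ?(unsplitK (inl j)) ?(unsplitK (inr j))/=.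
  by rewrite delta_lshift row_mxKr.
by rewrite delta_rshift row_mxKr.
Qed.

Let crE (x0 : 'rV[R]_r) (h : R) (i : 'I_m) (y : 'rV[R]_m) :
  row_mx x0 (h *: delta_mx ord0 i + y) =
  h *: oapp (fun j => delta_mx ord0 j) 0 (Some (rshift r i)) + row_mx x0 y.
Proof. by rewrite /= delta_rshift row_mx_lin scaler0 add0r. Qed.

Let clE (y0 : 'rV[R]_m) (h : R) (i : 'I_r) (x : 'rV[R]_r) :
  row_mx (h *: delta_mx ord0 i + x) y0 =
  h *: oapp (fun j => delta_mx ord0 j) 0 (Some (lshift m i)) + row_mx x y0.
Proof. by rewrite /= delta_lshift row_mx_lin scaler0 add0r. Qed.

Lemma smooth_lsubmx (f : 'rV[R]_r -> R) : smooth f -> smooth (f \o @lsubmx R 1 r m).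
Proof. exact: (smooth_comp slE continuous_lsubmx). Qed.

Lemma smooth_rsubmx (f : 'rV[R]_m -> R) : smooth f -> smooth (f \o @rsubmx R 1 r m).
Proof. exact: (smooth_comp srE continuous_rsubmx). Qed.

Lemma smooth_row_mxr (f : 'rV[R]_(r + m) -> R) x :
  smooth f -> smooth (fun y => f (row_mx x y)).
Proof. exact: (smooth_comp (crE x) (@continuous_row_mxr x)). Qed.

Lemma smooth_row_mxl (f : 'rV[R]_(r + m) -> R) y :
  smooth f -> smooth (fun x => f (row_mx x y)).
Proof. exact: (smooth_comp (clE y) (@continuous_row_mxl y)). Qed.

Lemma partial_row_mxr (f : 'rV[R]_(r + m) -> R) x i :
  partial i (fun y => f (row_mx x y)) = (fun y => partial (rshift r i) f (row_mx x y)).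
Proof. exact: (partial_comp (crE x) f i). Qed.

Lemma partial_row_mxl (f : 'rV[R]_(r + m) -> R) y i :
  partial i (fun x => f (row_mx x y)) = (fun x => partial (lshift m i) f (row_mx x y)).
Proof. exact: (partial_comp (clE y) f i). Qed.

Lemma grad_lsubmx (f : 'rV[R]_r -> R) x :
  grad (f \o @lsubmx R 1 r m) x = row_mx (grad f (lsubmx x)) 0.
Proof.
apply/rowP => i; rewrite mxE (partial_comp slE)/=.
case: (split_ordP i) => j ->; rewrite ?(unsplitK (inl j)) ?(unsplitK (inr j))/=.
  by rewrite row_mxEl mxE.
by rewrite row_mxEr mxE.
Qed.

Lemma grad_rsubmx (f : 'rV[R]_m -> R) x :
  grad (f \o @rsubmx R 1 r m) x = row_mx 0 (grad f (rsubmx x)).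
Proof.
apply/rowP => i; rewrite mxE (partial_comp srE)/=.
case: (split_ordP i) => j ->; rewrite ?(unsplitK (inl j)) ?(unsplitK (inr j))/=.
  by rewrite row_mxEl mxE.
by rewrite row_mxEr mxE.
Qed.

Lemma grad_row_mxr (f : 'rV[R]_(r + m) -> R) x y :
  grad (fun y => f (row_mx x y)) y = rsubmx (grad f (row_mx x y)).
Proof. by apply/rowP => i; rewrite !mxE partial_row_mxr. Qed.

End smooth_blocks.

(** * Bumps and cut-off functions *)

Section smooth1.
Context (R : realType).
Implicit Types (f g : R -> R).

Definition smooth1 f : Prop := forall k x, derivable ((derive1n k f)) x 1.

Lemma smooth1_derivable f x : smooth1 f -> derivable f x 1.
Proof. by move=> /(_ 0%N). Qed.

Lemma smooth1_continuous f : smooth1 f -> continuous f.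
Proof.
move=> sf x; apply/differentiable_continuous/derivable1_diffP.
exact: smooth1_derivable.
Qed.

Lemma smooth1_derive f : smooth1 f -> smooth1 (derive1 f).
Proof. by move=> sf k x; have := sf k.+1 x; rewrite derive1Sn. Qed.

Lemma smooth1_coind (P : (R -> R) -> Prop) :
  (forall f, P f -> exists2 g, P g & forall x : R, is_derive x 1 f (g x)) ->
  forall f, P f -> smooth1 f.
Proof.
move=> PP f Pf k x; suff /PP[g _ /(_ x)[]//] : P (derive1n k f).
elim: k => // k /PP[g Pg fg]; rewrite derive1nS (_ : derive1 _ = g)//.
by apply/funext => y; rewrite derive1E; apply: derive_val.
Qed.

(** As for several variables, closure under derivation is clear on the syntax of
    the algebra, and gives smoothness of all its members at once. *)
Inductive smooth1_alg : (R -> R) -> Prop :=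
| alg1_smooth f : smooth1 f -> smooth1_alg f
| alg1_cst (c : R) : smooth1_alg (fun=> c)
| alg1D f g : smooth1_alg f -> smooth1_alg g -> smooth1_alg (fun x => f x + g x)
| alg1M f g : smooth1_alg f -> smooth1_alg g -> smooth1_alg (fun x => f x * g x)
| alg1V f : smooth1_alg f -> (forall x, f x != 0) -> smooth1_alg (fun x => (f x)^-1)
| alg1_affine f (a b : R) : smooth1_alg f -> smooth1_alg (fun x => f (a * x + b)).

Lemma smooth1_algP f : smooth1_alg f -> smooth1 f.
Proof.
apply: smooth1_coind => {}f; elim=> {f}.
- move=> f sf; exists (derive1 f); first exact/alg1_smooth/smooth1_derive.
  by move=> x; rewrite derive1E; apply/derivableP/smooth1_derivable.
- by move=> c; exists (fun=> 0) => [|x]; [exact: alg1_cst|exact: is_derive_cst].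
- move=> f g _ [f' sf df] _ [g' sg dg].
  by exists (fun x => f' x + g' x) => [|x]; [exact: alg1D|exact: is_deriveD].
- move=> f g sf0 [f' sf df] sg0 [g' sg dg].
  exists (fun x => f x * g' x + g x * f' x) => [|x]; last exact: is_deriveM.
  by apply: alg1D; exact: alg1M.
- move=> f sf0 [f' sf df] f0; exists (fun x => - (f x)^-1 * (f x)^-1 * f' x).
    rewrite (_ : (fun _ => _) =
      fun x => (-1 * (f x)^-1) * (f x)^-1 * f' x); last first.
      by apply/funext => x; rewrite mulN1r.
    apply: alg1M => //; apply: alg1M; last exact: alg1V.
    by apply: alg1M; [exact: alg1_cst|exact: alg1V].
  move=> x; have := is_deriveV (f0 x) (df x).
  by rewrite mulNr -expr2 exprVn.
- move=> f a b sf0 [f' sf df].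
  exists (fun x => a * f' (a * x + b)).
    by apply: alg1M; [exact: alg1_cst|exact: alg1_affine].
  move=> x; pose L x := a * x + b.
  have dL : is_derive x 1 L a.
    by rewrite -[X in is_derive _ _ _ X]addr0 -[X in X + _]mulr1;
      apply: is_deriveD.
  by rewrite mulrC; exact: (is_derive1_comp (df (L x)) dL).
Qed.

End smooth1.

Section flat_function.
Context (R : realType).
Implicit Types (p : {poly R}).

(** The functions [p(1/x) exp(-1/x)], extended by zero to [x <= 0]: a class
    that is stable under derivation. *)
Definition flat p (x : R) : R := if 0 < x then p.[x^-1] * expR (- x^-1) else 0.

Lemma pow_le_expR n (y : R) : 0 <= y -> y ^+ n <= n`!%:R * expR y.
Proof.
move=> y0; case: n => [|n].
  by rewrite expr0 mul1r (le_trans _ (expR_ge1Dx _))// lerDl.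
rewrite -ler_pdivrMl ?ltr0n ?fact_gt0// mulrC.
by rewrite (le_trans _ (expR_ge1Dxn n y0))// lerDr.
Qed.

Lemma flat_bound p : exists C : R, forall x, `|flat p x| <= C * x ^+ 2.
Proof.
suff [C C0 CP] : exists2 C : R, 0 <= C & forall y, 0 <= y ->
    `|p.[y]| * y ^+ 2 <= C * expR y.
  exists C => x; rewrite /flat; case: ifPn => x0; last first.
    by rewrite normr0 mulr_ge0// sqr_ge0.
  have y0 : 0 < x^-1 by rewrite invr_gt0.
  rewrite normrM [X in _ * X]ger0_norm ?expR_ge0// expRN ler_pdivrMr ?expR_gt0//.
  rewrite mulrAC -ler_pdivrMr ?exprn_gt0// -exprVn.
  exact/CP/ltW.
exists (\sum_(i < size p) `|p`_i| * (i + 2)`!%:R).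
  by apply: sumr_ge0 => i _; rewrite mulr_ge0.
move=> y y0; rewrite horner_coef mulr_suml.
apply: (@le_trans _ _ ((\sum_(i < size p) `|p`_i| * y ^+ i) * y ^+ 2)).
  rewrite ler_wpM2r ?sqr_ge0// (le_trans (ler_norm_sum _ _ _))//.
  by apply: ler_sum => i _; rewrite normrM [X in _ * X]ger0_norm// exprn_ge0.
rewrite mulr_suml; apply: ler_sum => i _.
by rewrite -!mulrA -exprD ler_wpM2l// pow_le_expR.
Qed.

(** The quadratic bound gives the derivative at the junction point 0. *)
Lemma is_derive_sqr_bound (f : R -> R) (C : R) :
  f 0 = 0 -> (forall x, `|f x| <= C * x ^+ 2) -> is_derive (0 : R) 1 f 0.
Proof.
move=> f0 fC.
suff H : (fun h : R => h^-1 *: ((f \o shift 0) (h *: 1) - f 0)) @ 0^' --> (0 : R).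
  by apply: DeriveDef; [apply/cvg_ex; exists 0|exact/cvg_lim].
apply/cvgr0Pnorm_lt => e e0; near=> h.
have h0 : h != 0 by near: h; exact: nbhs_dnbhs_neq.
rewrite /= f0 subr0 addr0 /GRing.scale/= mulr1 normrM normfV ltr_pdivrMl ?normr_gt0//.
rewrite (le_lt_trans (fC h))// -real_normK ?num_real// expr2 mulrA mulrC.
rewrite ltr_pM2l ?normr_gt0//.
have C1 : 0 < `|C| + 1 by rewrite ltr_wpDl.
apply: (@le_lt_trans _ _ ((`|C| + 1) * `|h|)).
  by rewrite ler_wpM2r// (le_trans (ler_norm C))// lerDl.
rewrite -ltr_pdivlMl//; near: h; apply: dnbhs0_lt.
by rewrite mulr_gt0// invr_gt0.
Unshelve. all: by end_near. Qed.

Lemma is_derive_flat p : exists q, forall x : R, is_derive x 1 (flat p) (flat q x).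
Proof.
exists ('X^2 * (p - deriv p)) => x; have [x0|x0|->] := ltgtP x 0.
- rewrite {2}/flat ltNge (ltW x0)/=.
  have : is_derive x 1 (cst 0 : R -> R) 0 by exact: is_derive_cst.
  apply: near_eq_is_derive; near=> y; rewrite /flat ifF//; apply/negbTE.
  by rewrite -leNgt ltW//; near: y; exact: lt_nbhsl.
- rewrite {2}/flat x0.
  have dV : is_derive x 1 (fun y : R => y^-1) (- x ^- 2).
    have := @is_deriveV _ id x 1 1 (lt0r_neq0 x0) (is_derive_id _ _).
    by rewrite /GRing.scale/= mulr1.
  have dp := is_derive1_comp (is_derive_poly p x^-1) dV.
  have dN : is_derive x 1 (fun y : R => - y^-1) (- - x ^- 2) := is_deriveN dV.
  have de := @is_derive1_comp _ expR (fun y : R => - y^-1) x _ _ (is_derive_expR (- x^-1)) dN.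
  have := is_deriveM dp de.
  rewrite (_ : _ + _ = ('X^2 * (p - deriv p)).[x^-1] * expR (- x^-1)); last first.
    rewrite /GRing.scale/= !hornerE/= -exprVn; ring.
  apply: near_eq_is_derive; near=> y; rewrite /flat ifT//.
  by near: y; exact: lt_nbhsr.
- rewrite {2}/flat ltxx; have [C pC] := flat_bound p.
  by apply: (@is_derive_sqr_bound _ C) => //; rewrite /flat ltxx.
Unshelve. all: by end_near. Qed.

Lemma smooth1_flat p : smooth1 (flat p).
Proof.
apply: (@smooth1_coind _ (fun f => exists p, f = flat p)); last by exists p.
by move=> _ [{}p ->]; have [q dq] := is_derive_flat p; exists (flat q) => //; exists q.
Qed.

Definition ramp : R -> R := flat 1.

Lemma ramp_gt0 x : 0 < x -> 0 < ramp x.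
Proof. by move=> x0; rewrite /ramp /flat x0 hornerC mul1r expR_gt0. Qed.

Lemma ramp_le0 x : x <= 0 -> ramp x = 0.
Proof. by move=> x0; rewrite /ramp /flat ltNge x0. Qed.

Lemma ramp_ge0 x : 0 <= ramp x.
Proof. by have [/ramp_le0 ->//|/ramp_gt0/ltW] := leP x 0. Qed.

Lemma ramp_le1 x : ramp x <= 1.
Proof.
have [/ramp_le0 -> //|x0] := leP x 0.
by rewrite /ramp /flat x0 hornerC mul1r expR_le1 oppr_le0 invr_ge0 ltW.
Qed.

Let den x : R := ramp x + ramp (-1 * x + 1).

Let den_gt0 x : 0 < den x.
Proof.
rewrite /den; have [x0|x0] := ltP 0 x.
  by rewrite ltr_pwDl ?ramp_gt0 ?ramp_ge0.
by rewrite ltr_pwDr ?ramp_ge0// ramp_gt0// mulN1r addrC subr_gt0 (le_lt_trans x0).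
Qed.

(** [den] never vanishes because [x] and [1 - x] are not both nonpositive. *)
Definition step (x : R) : R := ramp x * (den x)^-1.

Lemma smooth1_step : smooth1 step.
Proof.
have sr : smooth1_alg ramp by apply: alg1_smooth; exact: smooth1_flat.
apply: smooth1_algP; apply: alg1M => //; apply: alg1V => [|x].
  by apply: alg1D => //; exact: alg1_affine.
by rewrite gt_eqF// den_gt0.
Qed.

Lemma step_ge0 x : 0 <= step x.
Proof. by rewrite mulr_ge0 ?ramp_ge0// invr_ge0 ltW// den_gt0. Qed.

Lemma step_le1 x : step x <= 1.
Proof. by rewrite /step ler_pdivrMr ?den_gt0// mul1r lerDl ramp_ge0. Qed.

Lemma step_le0 x : x <= 0 -> step x = 0.
Proof. by move=> x0; rewrite /step ramp_le0// mul0r. Qed.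

Lemma step_ge1 x : 1 <= x -> step x = 1.
Proof.
move=> x1; have := gt_eqF (den_gt0 x).
rewrite /step /den (@ramp_le0 (_ + _)) ?addr0; last by rewrite mulN1r addrC subr_le0.
by move=> /negbT x0; rewrite mulfV.
Qed.

Lemma derive_step_bound : exists2 K : R, 0 < K & forall x, `|'D_1 step x| <= K.
Proof.
have cd : continuous (derive1 step).
  exact/smooth1_continuous/smooth1_derive/smooth1_step.
have : compact (derive1 step @` `[0, 1]).
  by apply: continuous_compact; [exact: continuous_subspaceT|exact: segment_compact].
move=> /compact_bounded[M [_ MP]].
exists (`|M| + 1) => [|x]; first by rewrite ltr_wpDl.
have M1 : 0 <= `|M| + 1 by rewrite addr_ge0.
have [x0|x0] := ltP x 0.
  rewrite (near_eq_derive (g := cst (0 : R))) ?derive_cst ?normr0//.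
  by near=> y; apply: step_le0; rewrite ltW//; near: y; exact: lt_nbhsl.
have [x1|x1] := ltP 1 x.
  rewrite (near_eq_derive (g := cst (1 : R))) ?derive_cst ?normr0//.
  by near=> y; apply: step_ge1; rewrite ltW//; near: y; exact: lt_nbhsr.
apply: (MP (`|M| + 1)); first by rewrite (le_lt_trans (ler_norm M))// ltrDl.
by exists x; rewrite ?derive1E//= in_itv/= x0 x1.
Unshelve. all: by end_near. Qed.

(** The margin of 1/2 around [[-s, s]], where the value is already 1, makes the
    derivative vanish on all of [[-s, s]]; the slopes do not depend on [s]. *)
Definition plateau (s x : R) : R :=
  step (- 2 * x + (2 * s + 2)) * step (2 * x + (2 * s + 2)).

Lemma smooth1_plateau s : smooth1 (plateau s).
Proof.
by apply: smooth1_algP; apply: alg1M; apply: alg1_affine; apply: alg1_smooth;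
  exact: smooth1_step.
Qed.

Lemma plateau_ge0 s x : 0 <= plateau s x.
Proof. by rewrite mulr_ge0 ?step_ge0. Qed.

Lemma plateau_le1 s x : plateau s x <= 1.
Proof. by rewrite mulr_ile1 ?step_ge0 ?step_le1. Qed.

Lemma plateau1 s x : `|x| <= s + 2^-1 -> plateau s x = 1.
Proof.
by rewrite ler_norml => /andP[x1 x2]; rewrite /plateau !step_ge1 ?mulr1//; lra.
Qed.

Lemma plateau0 s x : s + 1 <= `|x| -> plateau s x = 0.
Proof.
rewrite /plateau ler_normr => /orP[?|?].
  by rewrite step_le0 ?mul0r//; lra.
by rewrite mulrC step_le0 ?mul0r//; lra.
Qed.

Lemma derive_plateau_bound :
  exists2 K : R, 0 < K & forall s (x : R), `|'D_1 (plateau s) x| <= K.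
Proof.
have [K K0 KP] := derive_step_bound; exists (K * 2 + K * 2) => [|s x].
  by rewrite addr_gt0// mulr_gt0.
have dl (a b : R) : is_derive x 1 (fun y => a * y + b) a.
  rewrite -[X in is_derive _ _ _ X]addr0 -[X in X + _]mulr1.
  by apply: is_deriveD.
have ds (a b : R) : is_derive x 1 (fun y => step (a * y + b)) ('D_1 step (a * x + b) * a).
  have dS := derivableP (@smooth1_derivable R step (a * x + b) smooth1_step).
  exact: (@is_derive1_comp _ step (fun y => a * y + b) x _ _ dS (dl a b)).
have /@derive_val -> := is_deriveM (ds (- 2) (2 * s + 2)) (ds 2 (2 * s + 2)).
have aux (a D c : R) : 0 <= a <= 1 -> `|D| <= K -> `|c| = 2 -> `|a * (D * c)| <= K * 2.
  move=> /andP[a0 a1] DK c1; rewrite !normrM c1 ger0_norm//.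
  by rewrite -[leRHS]mul1r ler_pM// ?mulr_ge0// ler_wpM2r.
rewrite (le_trans (ler_normD _ _))// lerD// /GRing.scale/= aux//.
- by rewrite step_ge0 step_le1.
- by rewrite ger0_norm.
- by rewrite step_ge0 step_le1.
- by rewrite normrN ger0_norm.
Qed.

(** The factor [n.+1] pushes both ramps to 1 at each point of [(a, b)], so these
    functions increase to the indicator of the interval. *)
Definition itv_bump n (a b x : R) : R :=
  ramp (n.+1%:R * x + - n.+1%:R * a) * ramp (- n.+1%:R * x + n.+1%:R * b).

Lemma smooth1_itv_bump n a b : smooth1 (itv_bump n a b).
Proof.
by apply: smooth1_algP; apply: alg1M; apply: alg1_affine; apply: alg1_smooth;
  exact: smooth1_flat.
Qed.

Lemma itv_bump_ge0 n a b x : 0 <= itv_bump n a b x.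
Proof. by rewrite mulr_ge0 ?ramp_ge0. Qed.

Lemma itv_bump_le1 n a b x : itv_bump n a b x <= 1.
Proof. by rewrite mulr_ile1 ?ramp_ge0 ?ramp_le1. Qed.

Lemma itv_bump_out n a b x : ~ (a < x < b) -> itv_bump n a b x = 0.
Proof.
move=> /negP; rewrite negb_and -!leNgt /itv_bump => /orP[xa|bx].
  by rewrite ramp_le0 ?mul0r// mulNr -mulrBr mulr_ge0_le0 ?subr_le0.
by rewrite mulrC ramp_le0 ?mul0r// mulNr addrC -mulrBr mulr_ge0_le0 ?subr_le0.
Qed.

Lemma cvg_ramp (c : R) : 0 < c -> ramp (n.+1%:R * c) @[n --> \oo] --> (1 : R).
Proof.
move=> c0; rewrite (_ : (fun _ => _) = (fun n : nat => expR (- (n.+1%:R^-1 * c^-1)))).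
  rewrite -[X in _ --> X](expR0 R) -[X in expR X]oppr0 -[X in - X](mul0r c^-1).
  apply: continuous_cvg; first exact: continuous_expR.
  by apply: cvgN; apply: cvgMl; exact: cvg_harmonic.
by apply/funext => n; rewrite /ramp /flat mulr_gt0// hornerC mul1r invfM.
Qed.

Lemma cvg_itv_bump a b x : a < x < b -> itv_bump n a b x @[n --> \oo] --> (1 : R).
Proof.
move=> /andP[ax xb]; rewrite -[X in _ --> X](mulr1 (1 : R)).
rewrite (_ : (fun _ => _) =
    (fun n : nat => ramp (n.+1%:R * (x - a)) * ramp (n.+1%:R * (b - x)))).
  by apply: cvgM; apply: cvg_ramp; rewrite subr_gt0.
apply/funext => n; rewrite /itv_bump !mulrBr mulNr; congr (_ * ramp _).
by rewrite mulNr addrC.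
Qed.

End flat_function.

Section coordinate_functions.
Context (R : realType) (d : nat).
Implicit Types (x : 'rV[R]_d) (i j : 'I_d).

Let coord_line (f : R -> R) i j x (h : R) :
  f ((h *: delta_mx ord0 j + x) ord0 i) =
  f (h *: (if i == j then 1 else 0 : R) + x ord0 i).
Proof. by rewrite !mxE/=; case: ifP. Qed.

Lemma partial_coord (f : R -> R) i j :
  partial j (fun x => f (x ord0 i)) =
  fun x => if i == j then 'D_1 f (x ord0 i) else 0.
Proof.
apply/funext => x; rewrite /partial (derive_line (coord_line f i j x)).
case: ifP => // _; rewrite /derive (_ : (fun h => _) = fun=> 0).
  by rewrite lim_cst.
by apply/funext => h; rewrite /= scaler0 add0r subrr scaler0.
Qed.

Lemma smooth_coord (f : R -> R) i : smooth1 f -> smooth (fun x => f (x ord0 i)).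
Proof.
move=> sf; apply: (@smooth_coind _ _
  (fun F => exists2 g, smooth1 g & F = fun x => g (x ord0 i))); last by exists f.
move=> _ [g sg ->]; split=> [x|j x|j].
- apply: (@continuous_comp _ _ _ (fun y : 'rV[R]_d => y ord0 i) g).
    exact: coord_continuous.
  exact: smooth1_continuous.
- apply: (derivable_line (coord_line g i j x)); case: ifP => _.
    exact: smooth1_derivable.
  rewrite /derivable (_ : (fun h => _) = fun=> 0); first exact: is_cvg_cst.
  by apply/funext => h; rewrite /= scaler0 add0r subrr scaler0.
- rewrite (partial_coord g i j); case: (i == j).
    exists (derive1 g); first exact: smooth1_derive.
    by apply/funext => x; rewrite derive1E.
  by exists (fun=> 0) => //; apply: smooth1_algP; exact: alg1_cst.
Qed.

Definition cutoff (s : R) x : R := \prod_(i < d) plateau s (x ord0 i).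

Lemma smooth_cutoff s : smooth (cutoff s).
Proof. by apply: smooth_prod => i; apply: smooth_coord; exact: smooth1_plateau. Qed.

Lemma cutoff_ge0 s x : 0 <= cutoff s x.
Proof. by apply: prodr_ge0 => i _; exact: plateau_ge0. Qed.

Lemma cutoff_le1 s x : cutoff s x <= 1.
Proof.
by apply: prodr_ile1 => i _; rewrite plateau_ge0 plateau_le1.
Qed.

Lemma cutoff1 s x : (forall i, `|x ord0 i| <= s + 2^-1) -> cutoff s x = 1.
Proof. by move=> xs; rewrite /cutoff big1// => i _; exact: plateau1. Qed.

Lemma cutoff0 s x i : s + 1 <= `|x ord0 i| -> cutoff s x = 0.
Proof. by move=> xs; rewrite /cutoff (bigD1 i)//= plateau0// mul0r. Qed.

Lemma grad_cutoff1 s x : cube s x -> grad (cutoff s) x = 0.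
Proof.
move=> xs; apply/rowP => i; rewrite !mxE /partial.
rewrite (near_eq_derive (g := cst (1 : R))) ?derive_cst//.
apply/rV_nbhsP; exists 2^-1; first by rewrite invr_gt0.
move=> y yx; apply: cutoff1 => j.
by have := ler_distD (x ord0 j) 0 (y ord0 j); rewrite !sub0r !normrN; have := yx j; have := xs j; lra.
Qed.

Lemma grad_cutoff0 s x : ~ cube (s + 1) x -> grad (cutoff s) x = 0.
Proof.
move=> /existsNP[j /negP]; rewrite -ltNge => xs; apply/rowP => i; rewrite !mxE /partial.
rewrite (near_eq_derive (g := cst (0 : R))) ?derive_cst//.
apply/rV_nbhsP; exists (`|x ord0 j| - (s + 1)); first by rewrite subr_gt0.
move=> y yx; apply: (@cutoff0 _ _ j).
by have := ler_distD (y ord0 j) 0 (x ord0 j); rewrite !sub0r !normrN distrC; have := yx j; lra.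
Qed.

End coordinate_functions.

(** The bound is uniform in [s], which is what keeps the constants of the
    hole-filling inequality independent of the length of the cylinder. *)
Lemma partial_cutoff_bound (R : realType) : exists2 K : R, 0 < K &
  forall d s (x : 'rV[R]_d) j, `|partial j (cutoff s) x| <= K.
Proof.
have [K K0 KP] := derive_plateau_bound R; exists K => // d s x j.
have sP (i : 'I_d) : smooth (fun x : 'rV[R]_d => plateau s (x ord0 i)).
  by apply: smooth_coord; exact: smooth1_plateau.
pose P (y : 'rV[R]_d) := \prod_(i < d | i != j) plateau s (y ord0 i).
have sP' : smooth P.
  rewrite /P; under eq_fun do rewrite -big_filter.
  exact: smooth_prod.
have -> : cutoff s = fun y => plateau s (y ord0 j) * P y.
  by apply/funext => y; rewrite /cutoff (bigD1 j).
rewrite partialM//.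
have -> : partial j P x = 0.
  rewrite /partial (derive_line (g := cst (P x)) (y := 0 : R) (w := 1)) ?derive_cst//.
  move=> h; apply: eq_bigr => i ij.
  by rewrite !mxE/= (negbTE ij) mulr0 add0r.
rewrite mulr0 add0r partial_coord eqxx normrM -[K]mul1r ler_pM// ?KP//.
rewrite ger0_norm; first by apply: prodr_ile1 => i _; rewrite plateau_ge0 plateau_le1.
by apply: prodr_ge0 => i _; exact: plateau_ge0.
Qed.

(** Testing against these bumps and passing to the limit by dominated convergence
    amounts to testing against the indicator of an open box. *)
Section box_bump.
Context (R : realType) (d : nat).

Definition box_bump n (a b x : 'rV[R]_d) : R :=
  \prod_(i < d) itv_bump n (a ord0 i) (b ord0 i) (x ord0 i).

Lemma smooth_box_bump n a b : smooth (box_bump n a b).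
Proof. by apply: smooth_prod => i; apply: smooth_coord; exact: smooth1_itv_bump. Qed.

Lemma box_bump_bound n a b x : `|box_bump n a b x| <= 1.
Proof.
rewrite ger0_norm; first by apply: prodr_ile1 => i _; rewrite itv_bump_ge0 itv_bump_le1.
by apply: prodr_ge0 => i _; exact: itv_bump_ge0.
Qed.

Lemma box_bump_out n a b x : ~ obox a b x -> box_bump n a b x = 0.
Proof.
move=> /existsNP[i xi]; rewrite /box_bump (bigD1 i)//= itv_bump_out ?mul0r//.
Qed.

Lemma cvg_prod (I : Type) (s : seq I) (u : I -> nat -> R) (l : I -> R) :
  (forall i, u i n @[n --> \oo] --> l i) ->
  \prod_(i <- s) u i n @[n --> \oo] --> \prod_(i <- s) l i.
Proof.
move=> ul; elim: s => [|i s IH].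
  rewrite big_nil; under eq_fun do rewrite big_nil; exact: cvg_cst.
by rewrite big_cons; under eq_fun do rewrite big_cons; exact: cvgM.
Qed.

Lemma cvg_box_bump a b x :
  box_bump n a b x @[n --> \oo] --> (\1_(obox a b) x : R).
Proof.
rewrite indicE; have [/set_mem xab|xab] := boolP (x \in obox a b).
  rewrite (_ : true%:R = \prod_(i < d) 1); last by rewrite big1.
  by apply: cvg_prod => i; exact: cvg_itv_bump.
rewrite (_ : (fun n => _) = fun=> 0); first exact: cvg_cst.
by apply/funext => n; apply: box_bump_out => /mem_set; rewrite (negbTE xab).
Qed.

End box_bump.

Section test_functions.
Context (R : realType) (d : nat).
Implicit Types (Omega K : set 'rV[R]_d) (f g phi : 'rV[R]_d -> R).

Lemma test_function_in_compact Omega phi K : smooth phi -> compact K ->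
  K `<=` Omega -> (forall x, ~ K x -> phi x = 0) -> test_function Omega phi.
Proof.
move=> sphi cK KO phi0.
have clK : closed K by apply: compact_closed => //; exact: norm_hausdorff.
have sK : closure [set x | phi x != 0] `<=` K.
  rewrite [X in _ `<=` X]((closure_id K).1 clK).
  apply: closure_subset => x /= /eqP.
  by apply: contra_notP => /phi0.
split => //; last exact: subset_trans KO.
apply: subclosed_compact sK => //; exact: closed_closure.
Qed.

Lemma test_function_support Omega phi : test_function Omega phi ->
  exists K, [/\ compact K, K `<=` Omega & forall x, ~ K x -> phi x = 0].
Proof.
move=> [_ cK KO]; eexists; split; [exact: cK|exact: KO|].
by move=> x; apply: contra_notP => /eqP xphi; exact: subset_closure.
Qed.

Lemma test_function_smooth Omega phi : test_function Omega phi -> smooth phi.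
Proof. by case. Qed.

Lemma test_function_out Omega phi x : test_function Omega phi -> ~ Omega x -> phi x = 0.
Proof.
by move=> /test_function_support[K [_ KO phi0]] Ox; apply: phi0 => /KO.
Qed.

Lemma partial_eq0 f K i : closed K -> (forall x, ~ K x -> f x = 0) ->
  forall x, ~ K x -> partial i f x = 0.
Proof.
move=> cK f0 x Kx; rewrite /partial (near_eq_derive (g := cst (0 : R))) ?derive_cst//.
near=> y; apply: f0; near: y.
by apply: open_nbhs_nbhs; split => //; exact: closed_openC.
Unshelve. all: by end_near. Qed.

Lemma test_function_partial Omega phi i :
  test_function Omega phi -> test_function Omega (partial i phi).
Proof.
move=> tphi; have [K [cK KO phi0]] := test_function_support tphi.
apply: (test_function_in_compact _ cK KO).
  exact/smooth_partial/(test_function_smooth tphi).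
apply: partial_eq0 => //; apply: compact_closed => //; exact: norm_hausdorff.
Qed.

Lemma test_function0 Omega : test_function Omega (fun=> 0).
Proof.
by apply: (@test_function_in_compact _ _ set0) => //; [exact: smooth_cst|exact: compact0].
Qed.

Lemma test_functionB Omega f g : test_function Omega f -> test_function Omega g ->
  test_function Omega (fun x => f x - g x).
Proof.
move=> tf tg; have [K [cK KO f0]] := test_function_support tf.
have [L [cL LO g0]] := test_function_support tg.
apply: (@test_function_in_compact _ _ (K `|` L)).
- by apply: smoothB; [exact: test_function_smooth tf|exact: test_function_smooth tg].
- exact: compactU.
- by rewrite subUset.
- by move=> x /not_orP[Kx Lx]; rewrite f0// g0// subr0.
Qed.

Lemma test_functionMl Omega f g : smooth f -> test_function Omega g ->
  test_function Omega (fun x => f x * g x).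
Proof.
move=> sf tg; have [L [cL LO g0]] := test_function_support tg.
apply: (test_function_in_compact _ cL LO) => [|x /g0 ->]; last by rewrite mulr0.
by apply: smoothM => //; exact: test_function_smooth tg.
Qed.

Lemma test_functionS Omega Omega' f : Omega `<=` Omega' -> test_function Omega f ->
  test_function Omega' f.
Proof. by move=> OO' [sf cf fO]; split => //; exact: subset_trans OO'. Qed.

Lemma test_function_bounded Omega phi : test_function Omega phi ->
  exists2 M : R, 0 < M & forall x, `|phi x| <= M.
Proof.
move=> tphi; have [K [cK KO phi0]] := test_function_support tphi.
have : compact (phi @` K).
  apply: continuous_compact => //; apply: continuous_subspaceT.
  exact/smooth_continuous/(test_function_smooth tphi).
move=> /compact_bounded[M [_ MP]]; exists (`|M| + 1) => [|x].
  by rewrite ltr_wpDl.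
have [Kx|/phi0 ->] := pselect (K x); last by rewrite normr0 addr_ge0.
by apply: (MP (`|M| + 1)); [rewrite (le_lt_trans (ler_norm M))// ltrDl|exists x].
Qed.

Lemma test_function_support_cube Omega phi : test_function Omega phi ->
  exists2 M : R, 0 < M & forall x, ~ cube M x -> phi x = 0.
Proof.
move=> tphi; have [K [cK KO phi0]] := test_function_support tphi.
have /bounded_sub_cube[M M0 KM] := compact_bounded cK.
by exists M => // x Mx; apply: phi0 => /KM.
Qed.

End test_functions.

(** * Integration by parts and the Poincare inequality *)

Section poincare_line.
Context (R : realType).
Local Notation mu := (@lebesgue_measure R).
Variables (psi dpsi : R -> R).
Hypothesis dE : forall t : R, is_derive t 1 psi (dpsi t).
Hypothesis cd : continuous dpsi.

Lemma integral_derive (a b : R) : a < b ->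
  (\int[mu]_(t in `[a, b]) (dpsi t)%:E = (psi b)%:E - (psi a)%:E)%E.
Proof.
move=> ab.
have cpsi : continuous psi.
  by move=> t; apply/differentiable_continuous/derivable1_diffP; case: (dE t).
apply: continuous_FTC2 => //; first exact: continuous_subspaceT.
- split=> [t _||]; first by case: (dE t).
    by apply: cvg_at_right_filter; exact: cpsi.
  by apply: cvg_at_left_filter; exact: cpsi.
- by move=> t _; rewrite derive1E; case: (dE t).
Qed.

Variables (M : R).
Hypothesis M0 : 0 < M.
Hypothesis psi0 : forall t, M <= `|t| -> psi t = 0.

Let D : set R := `[- M, M]%classic.

Let mD : measurable D. Proof. exact: measurable_itv. Qed.

Let NMM : - M < M. Proof. by rewrite (lt_trans _ M0)// oppr_lt0. Qed.

Let muD : mu D = (M *+ 2)%:E.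
Proof.
have := @lebesgue_measure_itv R `[- M, M].
by rewrite /= lte_fin NMM -EFinB opprK -mulr2n.
Qed.

Let psi_endl : psi (- M) = 0. Proof. by rewrite psi0// normrN ger0_norm// ltW. Qed.

Let psi_endr : psi M = 0. Proof. by rewrite psi0// ger0_norm// ltW. Qed.

Let dpsi0 t : M < `|t| -> dpsi t = 0.
Proof.
move=> tM; case: (dE t) => _ <-.
rewrite (near_eq_derive (g := cst (0 : R))) ?derive_cst//.
near=> s; apply: psi0; apply: ltW; near: s.
have : `|s| @[s --> t] --> `|t| by exact: norm_continuous.
by move=> /cvgr_gt/(_ _ tM).
Unshelve. all: by end_near. Qed.

Let mdpsi : measurable_fun setT dpsi. Proof. exact: continuous_measurable_fun. Qed.

Let restrict_dpsi : dpsi \_ D = dpsi.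
Proof.
apply/funext => t; rewrite patchE; case: ifPn => //; rewrite notin_setE /D/= in_itv/=.
by rewrite -ler_norml => /negP; rewrite -ltNge => /dpsi0 ->.
Qed.

Lemma integral_derive0 : (\int[mu]_t (dpsi t)%:E = 0)%E.
Proof.
transitivity (\int[mu]_(t in D) (dpsi t)%:E)%E.
  rewrite [RHS]integral_mkcond; apply: eq_integral => t _.
  by rewrite -[in LHS]restrict_dpsi -[LHS]/((EFin \o _) t) -restrict_EFin.
by rewrite /D integral_derive// psi_endl psi_endr subee.
Qed.

Variable p : R.
Hypothesis p1 : 1 < p.

(** [psi] vanishes at the left end, so it is the integral of its derivative;
    Hoelder's inequality then brings in the exponent. *)
Let le_primitive t :
  (`|psi t|%:E <= \int[mu]_(s in D) `|dpsi s|%:E)%E.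
Proof.
have [tM|/ltW tM] := leP M `|t|; first by rewrite psi0// normr0 integral_ge0.
move: (tM); rewrite ler_norml => /andP[+ t2]; rewrite le_eqVlt => /predU1P[<-|t1].
  by rewrite psi_endl normr0 integral_ge0.
have -> : (`|psi t|%:E = `|\int[mu]_(s in `[(- M)%R, t]) (dpsi s)%:E|)%E.
  by rewrite integral_derive// psi_endl sube0.
apply: le_trans; first apply: le_abse_integral => //.
  by apply/measurable_EFinP; exact: measurable_funTS.
apply: ge0_subset_integral => //=.
  apply/measurable_EFinP/measurableT_comp => //; exact: measurable_funTS.
by apply: subset_itvl; rewrite bnd_simp.
Qed.

Let jensen : ((\int[mu]_(s in D) `|dpsi s|%:E) `^ p <=
  ((M *+ 2) `^ (p - 1))%:E * \int[mu]_s (`|dpsi s| `^ p)%:E)%E.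
Proof.
have p0 : 0 < p by rewrite (lt_trans _ p1).
pose q := p / (p - 1).
have q0 : 0 < q by rewrite divr_gt0// subr_gt0.
have pq : p^-1 + q^-1 = 1 by rewrite /q; field; move: p1; lra.
have mi : measurable_fun setT (\1_D : R -> R) by exact: measurable_indic.
set I := (\int[_]_(s in _) _)%E.
have Ip : (I <= 'N[mu]_p%:E[EFin \o dpsi] * 'N[mu]_q%:E[EFin \o \1_D])%E.
  apply: le_trans (hoelder mu mdpsi mi p0 q0 pq).
  rewrite Lnorm1 /I [leLHS]integral_mkcond le_eqVlt; apply/orP; left; apply/eqP.
  apply: eq_integral => t _ /=; rewrite patchE indicE.
  by case: ifPn => tM; rewrite ?mulr1// mulr0 normr0.
apply: (@le_trans _ _
   (('N[mu]_p%:E[EFin \o dpsi] * 'N[mu]_q%:E[EFin \o \1_D]) `^ p))%E.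
  apply: gt0_ler_poweR => //; rewrite ?in_itv/= ?andbT ?leey ?integral_ge0//.
    exact: ltW.
  by rewrite mule_ge0// Lnorm_ge0.
rewrite poweRM ?Lnorm_ge0// poweR_Lnorm ?gt_eqF// muleC.
apply: lee_pmul => //.
- exact: poweR_ge0.
- by apply: integral_ge0 => t _; exact: poweR_ge0.
rewrite unlock/= -poweRrM.
have -> : (\int[mu]_x `|(EFin \o \1_D) x| `^ q = (M *+ 2)%:E)%E.
  transitivity (\int[mu]_x (\1_D x)%:E)%E.
    apply: eq_integral => t _ /=; rewrite indicE.
    case: (_ \in _) => /=; first by rewrite normr1 powR1.
    by rewrite normr0 powR0// gt_eqF.
  rewrite integral_indic// ?setIT ?setTI; exact: muD.
rewrite poweR_EFin lee_fin (_ : q^-1 * p = p - 1)//.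
by rewrite /q; field; move: p1; lra.
Qed.

Lemma poincare_line : (\int[mu]_t (`|psi t| `^ p)%:E <=
  ((M *+ 2) `^ p)%:E * \int[mu]_t (`|dpsi t| `^ p)%:E)%E.
Proof.
have p0 : 0 < p by rewrite (lt_trans _ p1).
have M20 : 0 < M *+ 2 by rewrite pmulrn_lgt0.
pose I := (\int[mu]_(s in D) `|dpsi s|%:E)%E.
apply: (@le_trans _ _ (\int[mu]_(t in D) (cst (I `^ p) t))%E).
  rewrite (_ : (\int[mu]_t _ = \int[mu]_(t in D) (`|psi t| `^ p)%:E)%E).
    apply: ge0_le_integral => //=.
    - apply/measurable_EFinP; apply: (measurableT_comp (measurable_powR p)).
      apply: measurableT_comp => //; apply: measurable_funTS.
      apply: continuous_measurable_fun => t.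
      by apply/differentiable_continuous/derivable1_diffP; case: (dE t).
    - move=> t _; rewrite -poweR_EFin; apply: gt0_ler_poweR.
      - exact: ltW.
      - by rewrite in_itv/= leey lee_fin normr_ge0.
      - by rewrite in_itv/= leey integral_ge0.
      - exact: le_primitive.
  rewrite [RHS]integral_mkcond; apply: eq_integral => t _; rewrite patchE.
  case: ifPn => //; rewrite notin_setE /D/= in_itv/= -ler_norml => /negP.
  by rewrite -ltNge => /ltW/psi0 ->; rewrite normr0 powR0// gt_eqF.
rewrite integral_cst// (_ : _ D = (M *+ 2)%:E); last exact: muD.
rewrite muleC (le_trans (lee_wpmul2l _ jensen))//; first by rewrite lee_fin ltW.
by rewrite muleA -EFinM mulr_powRB1// ltW.
Qed.

End poincare_line.

Section integral_rV.
Context (R : realType).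

Let const1 : R -> 'rV[R]_1 := fun t => const_mx t.

Let const1_line (h t : R) :
  const1 (h *: 1 + t) = h *: delta_mx ord0 ord0 + const1 t.
Proof.
by apply/rowP => i; rewrite /const1 !mxE (ord1 i) eqxx.
Qed.

Let ge0_integral_rV1 (h : 'rV[R]_1 -> \bar R) :
  measurable_fun setT h -> (forall x, 0 <= h x)%E ->
  (\int[lebesgue_rV R 1]_x h x = \int[@lebesgue_measure R]_t h (const1 t))%E.
Proof.
move=> mh h0; rewrite ge0_integral_lebesgue_rVS//; apply: eq_integral => t _.
rewrite integral_dirac//.
  rewrite diracT mul1e; congr h; apply/rowP => i.
  by rewrite /const1 /cons_rV !mxE (ord1 i) unlift_none.
exact: (measurableT_comp mh (@measurable_cons_section R 0 t)).
Qed.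

Lemma integral_rV1 (h : 'rV[R]_1 -> \bar R) : measurable_fun setT h ->
  (\int[lebesgue_rV R 1]_x h x = \int[@lebesgue_measure R]_t h (const_mx t))%E.
Proof.
move=> mh; rewrite integralE [RHS]integralE.
rewrite !ge0_integral_rV1//; last 2 first.
- exact: measurable_funeneg.
- exact: measurable_funepos.
by congr (_ - _)%E; apply: eq_integral => t _; rewrite ?funeposE ?funenegE.
Qed.

Lemma measurable_smooth d (f : 'rV[R]_d -> R) : smooth f -> measurable_fun setT f.
Proof. by move=> sf; apply: measurable_rV_continuous; exact: smooth_continuous. Qed.

Lemma integrable_bounded_support d (f : 'rV[R]_d -> R) (M N : R) :
  measurable_fun setT f -> (forall x, `|f x| <= M) ->
  (forall x, ~ cube N x -> f x = 0) -> (lebesgue_rV R d).-integrable setT (EFin \o f).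
Proof.
move=> mf fM f0; have mC := @measurable_cube R d N.
rewrite (_ : EFin \o f = (EFin \o f) \_ (cube N)); last first.
  apply/funext => x; rewrite patchE; case: ifPn => //.
  by rewrite notin_setE => /f0 /= ->.
apply/(integrable_mkcond _ mC); apply: measurable_bounded_integrable => //.
- apply: bounded_lebesgue_lty => //.
  by apply: compact_bounded; exact: compact_cube.
- exact: measurable_funTS.
- exists M; split; first exact: num_real.
  by move=> y My x _ /=; rewrite (le_trans (fM x))// ltW.
Qed.

Lemma test_function_integrable d (Omega D : set 'rV[R]_d) (f : 'rV[R]_d -> R) :
  measurable D -> test_function Omega f -> (lebesgue_rV R d).-integrable D (EFin \o f).
Proof.
move=> mD tf; apply: (@integrableS _ _ _ _ setT) => //.
have [M _ fM] := test_function_bounded tf.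
have [N _ fN] := test_function_support_cube tf.
apply: integrable_bounded_support fM fN.
by apply: measurable_smooth; exact: test_function_smooth tf.
Qed.

Section slices.
Context (r m : nat) (A : set 'rV[R]_r) (B : set 'rV[R]_m).

Lemma test_function_row_mxr (f : 'rV[R]_(r + m) -> R) x :
  test_function (cylinder A B) f -> test_function B (fun y => f (row_mx x y)).
Proof.
move=> tf; have [K [cK KO f0]] := test_function_support tf.
apply: (@test_function_in_compact _ _ _ _ (@rsubmx R 1 r m @` K)).
- exact/smooth_row_mxr/(test_function_smooth tf).
- apply: continuous_compact => //; apply: continuous_subspaceT.
  exact: continuous_rsubmx.
- by move=> _ [z /KO[_ Bz] <-].
- by move=> y Ky; apply: f0 => Kxy; apply: Ky; exists (row_mx x y); rewrite ?row_mxKr.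
Qed.

Lemma test_function_row_mxl (f : 'rV[R]_(r + m) -> R) y :
  test_function (cylinder A B) f -> test_function A (fun x => f (row_mx x y)).
Proof.
move=> tf; have [K [cK KO f0]] := test_function_support tf.
apply: (@test_function_in_compact _ _ _ _ (@lsubmx R 1 r m @` K)).
- exact/smooth_row_mxl/(test_function_smooth tf).
- apply: continuous_compact => //; apply: continuous_subspaceT.
  exact: continuous_lsubmx.
- by move=> _ [z /KO[Az _] <-].
- by move=> x Kx; apply: f0 => Kxy; apply: Kx; exists (row_mx x y); rewrite ?row_mxKl.
Qed.

End slices.

Lemma cylinderT r m : cylinder setT setT = [set: 'rV[R]_(r + m)].
Proof. by apply/seteqP; split. Qed.

Lemma is_derive_const_mx (f : 'rV[R]_1 -> R) (t : R) : smooth f ->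
  is_derive t 1 (fun t => f (const_mx t)) (partial ord0 f (const_mx t)).
Proof.
move=> sf; have fl (h : R) : f (const1 (h *: 1 + t)) = f (h *: delta_mx ord0 ord0 + const1 t).
  by rewrite const1_line.
apply: DeriveDef; first by apply: (derivable_line fl); exact: smooth_derivable.
exact: (derive_line fl).
Qed.

Lemma continuous_const_mx : continuous (fun t : R => const_mx t : 'rV[R]_1).
Proof.
move=> t A /rV_nbhsP[e e0 eA]; apply/nbhs_ballP; exists e => // s ts.
by apply: eA => i; rewrite !mxE.
Qed.

(** Fubini in the block that contains the direction reduces this to one variable,
    where the integral of the derivative of a compactly supported function is 0;
    a direction beyond the first one is reached by induction on the dimension. *)
Lemma integral_partial d (f : 'rV[R]_d -> R) i : test_function setT f ->
  (\int[lebesgue_rV R d]_x (partial i f x)%:E = 0)%E.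
Proof.
elim: d f i => [|d IH] f i; first by case: i.
rewrite -[d.+1]/(1 + d)%N in f i * => tf.
have tf' : test_function (cylinder [set: 'rV[R]_1] [set: 'rV[R]_d]) f.
  by rewrite cylinderT.
have int : (lebesgue_rV R (1 + d)).-integrable (cylinder [set: 'rV[R]_1] [set: 'rV[R]_d])
    (EFin \o partial i f).
  by rewrite cylinderT; apply: test_function_integrable (test_function_partial i tf).
rewrite -cylinderT; case: (split_ordP i) => j ij.
  rewrite fubini_cylinder_swap//; apply: integral0_eq => y _.
  have tfy := test_function_row_mxl y tf'; have sfy := test_function_smooth tfy.
  rewrite (eq_integral (fun x => (partial j (fun x => f (row_mx x y)) x)%:E)); last first.
    by move=> x _; rewrite partial_row_mxl ij.
  rewrite integral_rV1; last first.
    by apply/measurable_EFinP; apply: measurable_smooth; exact: smooth_partial.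
  have [N N0 fN] := test_function_support_cube tfy.
  rewrite (ord1 j).
  apply: (@integral_derive0 _ (fun t => f (row_mx (const1 t) y)) _ _ _ (N + 1)).
  - by move=> t; exact: (is_derive_const_mx t sfy).
  - move=> t; apply: continuous_comp; first exact: continuous_const_mx.
    by apply: smooth_continuous; exact: smooth_partial.
  - by rewrite addr_gt0.
  - move=> t Nt; apply: fN => /(_ ord0); rewrite mxE; apply/negP; rewrite -ltNge.
    by rewrite (lt_le_trans _ Nt)// ltrDl.
rewrite fubini_cylinder//; apply: integral0_eq => x _.
rewrite (eq_integral (fun y => (partial j (fun y => f (row_mx x y)) y)%:E)); last first.
  by move=> y _; rewrite partial_row_mxr ij.
exact/IH/(test_function_row_mxr x tf').
Qed.

End integral_rV.

Section enorm_theory.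
Context (R : realType).
Implicit Types (d r m : nat) (p : R).

Lemma enorm_ge0 d (x : 'rV[R]_d) : 0 <= enorm x.
Proof. exact: sqrtr_ge0. Qed.

Lemma enorm_sqr d (x : 'rV[R]_d) : enorm x ^+ 2 = \sum_i x ord0 i ^+ 2.
Proof. by rewrite sqr_sqrtr// sumr_ge0// => i _; rewrite sqr_ge0. Qed.

Lemma enorm_le d (x : 'rV[R]_d) (c : R) :
  0 <= c -> \sum_i x ord0 i ^+ 2 <= c ^+ 2 -> enorm x <= c.
Proof. by move=> c0 xc; rewrite -(ler_pXn2r (ltn0Sn 1)) ?nnegrE ?enorm_ge0// enorm_sqr. Qed.

Lemma enorm0 d : enorm (0 : 'rV[R]_d) = 0.
Proof. by rewrite /enorm big1 ?sqrtr0// => i _; rewrite mxE expr0n. Qed.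

Lemma coord_le_enorm d (x : 'rV[R]_d) i : `|x ord0 i| <= enorm x.
Proof.
rewrite -(ler_pXn2r (ltn0Sn 1)) ?nnegrE ?enorm_ge0// enorm_sqr real_normK ?num_real//.
by rewrite (bigD1 i)//= lerDl sumr_ge0// => j _; rewrite sqr_ge0.
Qed.

Lemma enorm_le_coord d (x : 'rV[R]_d) (K : R) : 0 <= K ->
  (forall i, `|x ord0 i| <= K) -> enorm x <= d%:R * K.
Proof.
move=> K0 xK; apply: enorm_le; first by rewrite mulr_ge0.
apply: (@le_trans _ _ (\sum_(i < d) K ^+ 2)).
  apply: ler_sum => i _; rewrite -real_normK ?num_real//.
  by rewrite ler_pXn2r// nnegrE.
rewrite sumr_const card_ord -[leLHS]mulr_natl exprMn.
apply: ler_wpM2r; rewrite ?sqr_ge0// -natrX ler_nat.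
by case: d {x xK} => // d; rewrite leq_pmulr.
Qed.

Lemma enormZ d (t : R) (x : 'rV[R]_d) : enorm (t *: x) = `|t| * enorm x.
Proof.
rewrite /enorm (eq_bigr (fun i => t ^+ 2 * x ord0 i ^+ 2)); last first.
  by move=> i _; rewrite mxE exprMn.
by rewrite -mulr_sumr sqrtrM ?sqr_ge0// sqrtr_sqr.
Qed.

Lemma enormN d (x : 'rV[R]_d) : enorm (- x) = enorm x.
Proof. by rewrite -scaleN1r enormZ normrN1 mul1r. Qed.

Lemma enormD d (x y : 'rV[R]_d) :
  enorm (x + y) <= 2 * Num.max (enorm x) (enorm y).
Proof.
set M := Num.max _ _.
have M0 : 0 <= M by rewrite le_max enorm_ge0.
apply: enorm_le; first by rewrite mulr_ge0.
have xM : enorm x ^+ 2 <= M ^+ 2 by rewrite ler_pXn2r ?nnegrE ?enorm_ge0// le_max lexx.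
have yM : enorm y ^+ 2 <= M ^+ 2.
  by rewrite ler_pXn2r ?nnegrE ?enorm_ge0// le_max lexx orbT.
apply: (@le_trans _ _ (2 * enorm x ^+ 2 + 2 * enorm y ^+ 2)).
  rewrite !enorm_sqr !mulr_sumr -big_split/=; apply: ler_sum => i _.
  by rewrite mxE; have := sqr_ge0 (x ord0 i - y ord0 i); nra.
by rewrite exprMn; move: xM yM; lra.
Qed.

Lemma enorm_row_mx0 r m (x : 'rV[R]_r) : enorm (row_mx x (0 : 'rV[R]_m)) = enorm x.
Proof.
rewrite /enorm big_split_ord/= [X in _ + X]big1 ?addr0.
  by congr Num.sqrt; apply: eq_bigr => i _; rewrite row_mxEl.
by move=> i _; rewrite row_mxEr mxE expr0n.
Qed.

Lemma enorm_row_0mx r m (x : 'rV[R]_m) : enorm (row_mx (0 : 'rV[R]_r) x) = enorm x.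
Proof.
rewrite /enorm big_split_ord/= [X in X + _]big1 ?add0r.
  by congr Num.sqrt; apply: eq_bigr => i _; rewrite row_mxEr.
by move=> i _; rewrite row_mxEl mxE expr0n.
Qed.

Lemma enorm_lsubmx r m (x : 'rV[R]_(r + m)) : enorm (lsubmx x) <= enorm x.
Proof.
apply: enorm_le; rewrite ?enorm_ge0// enorm_sqr big_split_ord/=.
rewrite (eq_bigr (fun i => x ord0 (lshift m i) ^+ 2)); last by move=> i _; rewrite mxE.
by rewrite lerDl sumr_ge0// => i _; rewrite sqr_ge0.
Qed.

Lemma enorm_rsubmx r m (x : 'rV[R]_(r + m)) : enorm (rsubmx x) <= enorm x.
Proof.
apply: enorm_le; rewrite ?enorm_ge0// enorm_sqr big_split_ord/=.
rewrite [leLHS](eq_bigr (fun i => x ord0 (rshift r i) ^+ 2)); last by move=> i _; rewrite mxE.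
by rewrite lerDr sumr_ge0// => i _; rewrite sqr_ge0.
Qed.

Lemma measurable_enorm d : measurable_fun setT (@enorm R d).
Proof.
apply: (measurableT_comp (continuous_measurable_fun (@sqrt_continuous R))).
apply: measurable_sum => i; apply: measurable_funX; exact: measurable_coord.
Qed.

Lemma measurable_enorm_powR d (disp : measure_display) (T : measurableType disp) (D : set T) (g : T -> 'rV[R]_d) p :
  measurable_fun D g -> measurable_fun D (fun t => enorm (g t) `^ p).
Proof.
move=> mg; apply: (measurableT_comp (measurable_powR p)).
exact: (measurableT_comp (@measurable_enorm d) mg).
Qed.

(** The crude convexity inequality that replaces the triangle inequality
    whenever constants do not matter. *)
Lemma powR_addb (c a b p : R) : 0 <= p -> 0 <= a -> 0 <= b ->
  0 <= c -> c <= 2 * Num.max a b -> c `^ p <= 2 `^ p * (a `^ p + b `^ p).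
Proof.
move=> p0 a0 b0 c0 cab; apply: (@le_trans _ _ ((2 * Num.max a b) `^ p)).
  by rewrite ge0_ler_powR ?nnegrE// (le_trans c0).
rewrite powRM//; last by rewrite le_max a0.
rewrite ler_wpM2l ?powR_ge0//; case: (leP a b) => _.
  by rewrite lerDr powR_ge0.
by rewrite lerDl powR_ge0.
Qed.

Lemma enormD_powR d (x y : 'rV[R]_d) p : 0 <= p ->
  enorm (x + y) `^ p <= 2 `^ p * (enorm x `^ p + enorm y `^ p).
Proof. by move=> p0; apply: powR_addb; rewrite ?enorm_ge0// enormD. Qed.

Lemma enorm_blocks_powR r m (x : 'rV[R]_(r + m)) p : 0 <= p ->
  enorm x `^ p <= 2 `^ p * (enorm (lsubmx x) `^ p + enorm (rsubmx x) `^ p).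
Proof.
move=> p0; have := enormD_powR (row_mx (lsubmx x) 0) (row_mx 0 (rsubmx x)) p0.
by rewrite add_row_mx addr0 add0r hsubmxK enorm_row_mx0 enorm_row_0mx.
Qed.

End enorm_theory.

Section poincare.
Context (R : realType).

Lemma measurable_grad d (f : 'rV[R]_d -> R) : smooth f -> measurable_fun setT (grad f).
Proof.
move=> sf; apply: measurable_fun_rV => i; under eq_fun do rewrite mxE.
by apply: measurable_smooth; exact: smooth_partial.
Qed.

Lemma tonelli_rV_swap r m (h : 'rV[R]_(r + m) -> \bar R) :
  measurable_fun setT h -> (forall x, 0 <= h x)%E ->
  (\int[lebesgue_rV R (r + m)]_x h x =
   \int[lebesgue_rV R m]_y \int[lebesgue_rV R r]_x h (row_mx x y))%E.
Proof.
move=> mh h0; rewrite tonelli_rV_setT//.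
have mhg := measurableT_comp mh (@measurable_glue_rV R r m).
have hg0 z : (0 <= (h \o @glue_rV R r m) z)%E by exact: h0.
exact: (fubini_tonelli (m1 := lebesgue_rV R r) (m2 := lebesgue_rV R m) _ mhg hg0).
Qed.

(** The one-dimensional inequality along the first coordinate, integrated over the
    others: the support of [phi] lies in a slab of width at most [2 (N + 1)]. *)
Lemma poincare m (B : set 'rV[R]_m) (p : R) :
  (0 < m)%N -> measurable B -> bounded_set B -> 1 < p ->
  exists2 C : R, 0 < C & forall phi, test_function B phi ->
    (\int[lebesgue_rV R m]_(x in B) (`|phi x| `^ p)%:E <=
     C%:E * \int[lebesgue_rV R m]_(x in B) (enorm (grad phi x) `^ p)%:E)%E.
Proof.
case: m B => // m B _ mB /bounded_sub_cube[N N0 BN] p1.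
have p0 : 0 < p by rewrite (lt_trans _ p1).
have N1 : 0 < N + 1 by rewrite addr_gt0.
exists (((N + 1) *+ 2) `^ p) => [|phi tphi]; first by rewrite powR_gt0// pmulrn_lgt0.
set C := (_ `^ p).
rewrite -[m.+1]/(1 + m)%N in B mB BN phi tphi *.
have sphi := test_function_smooth tphi.
pose i0 : 'I_(1 + m) := lshift m ord0.
have phiB x : ~ B x -> phi x = 0 by exact: test_function_out tphi.
have mpow (h : 'rV[R]_(1 + m) -> R) : smooth h ->
    measurable_fun setT (fun x => (`|h x| `^ p)%:E).
  move=> sh; apply/measurable_EFinP; apply: (measurableT_comp (measurable_powR p)).
  by apply: measurableT_comp => //; exact: measurable_smooth.
have -> : (\int[lebesgue_rV R (1 + m)]_(x in B) (`|phi x| `^ p)%:E =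
    \int[lebesgue_rV R (1 + m)]_x (`|phi x| `^ p)%:E)%E.
  rewrite integral_mkcond; apply: eq_integral => x _; rewrite patchE.
  by case: ifPn => //; rewrite notin_setE => /phiB ->; rewrite normr0 powR0// gt_eqF.
apply: (@le_trans _ _ (C%:E * \int[lebesgue_rV R (1 + m)]_x (`|partial i0 phi x| `^ p)%:E)%E).
  rewrite (tonelli_rV_swap (mpow _ sphi)); last by move=> x; rewrite lee_fin powR_ge0.
  rewrite (tonelli_rV_swap (mpow _ (smooth_partial i0 sphi))); last first.
    by move=> x; rewrite lee_fin powR_ge0.
  have mG (h : 'rV[R]_(1 + m) -> R) : smooth h -> measurable_fun setT
      (fun y => \int[lebesgue_rV R 1]_x (`|h (row_mx x y)| `^ p)%:E)%E.
    move=> sh; have mh := measurableT_comp (mpow _ sh) (@measurable_glue_rV R 1 m).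
    apply: (measurable_fun_fubini_tonelli_G (m1 := lebesgue_rV R 1) _ mh) => z.
    by rewrite /= lee_fin powR_ge0.
  rewrite -ge0_integralZl//; last 3 first.
  - by apply: mG; exact: smooth_partial.
  - by move=> y _; apply: integral_ge0 => x _; rewrite lee_fin powR_ge0.
  - by rewrite lee_fin powR_ge0.
  apply: ge0_le_integral => //.
  - by move=> y _; apply: integral_ge0 => x _; rewrite lee_fin powR_ge0.
  - exact: mG.
  - by apply: measurable_funeM; apply: mG; exact: smooth_partial.
  move=> y _.
  have sy : smooth (fun x : 'rV[R]_1 => phi (row_mx x y)) by exact: smooth_row_mxl.
  have mrow : measurable_fun setT (fun x : 'rV[R]_1 => row_mx x y : 'rV[R]_(1 + m)).
    apply: measurable_fun_rV => i; case: (split_ordP i) => j ->.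
      by under eq_fun do rewrite row_mxEl; exact: measurable_coord.
    by under eq_fun do rewrite row_mxEr; exact: measurable_cst.
  rewrite (integral_rV1 (measurableT_comp (mpow _ sphi) mrow)).
  rewrite (integral_rV1 (measurableT_comp (mpow _ (smooth_partial i0 sphi)) mrow)).
  apply: (@poincare_line _ (fun t => phi (row_mx (const_mx t) y))) => //.
  - move=> t; have := is_derive_const_mx t sy.
    by rewrite partial_row_mxl.
  - move=> t; apply: (@continuous_comp _ _ _ (fun t : R => const_mx t : 'rV[R]_1)
      (fun x => partial i0 phi (row_mx x y))); first exact: continuous_const_mx.
    by apply: smooth_continuous; apply: smooth_row_mxl; exact: smooth_partial.
  - move=> t Nt; apply: phiB => /BN/(_ i0); rewrite row_mxEl mxE; apply/negP.
    by rewrite -ltNge (lt_le_trans _ Nt)// ltrDl.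
apply: lee_wpmul2l; first by rewrite lee_fin powR_ge0.
rewrite [leRHS]integral_mkcond; apply: ge0_le_integral => //.
- exact: (mpow _ (smooth_partial i0 sphi)).
- apply: ((measurable_restrictT (fun x => (enorm (grad phi x) `^ p)%:E) mB).1 _).
  apply: measurable_funTS.
  apply/measurable_EFinP; apply: (measurableT_comp (measurable_powR p)).
  exact: (measurableT_comp (@measurable_enorm R _) (measurable_grad sphi)).
- move=> x _; rewrite patchE; case: ifPn => [_|].
    rewrite lee_fin; apply: ge0_ler_powR; rewrite ?nnegrE ?enorm_ge0 ?(ltW p0)//.
    by have := coord_le_enorm (grad phi x) i0; rewrite mxE.
  rewrite notin_setE => /(test_function_out (test_function_partial i0 tphi)) ->.
  by rewrite normr0 powR0// gt_eqF.
Qed.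

End poincare.

(** * Uniqueness of weak gradients *)

Section quadrants.
Context (R : realType) (d : nat).

(** A generating class that is closed under intersection and whose members cut a
    box into a box: the form in which Dynkin's lemma is applied below. *)
Definition quadrants : set (set 'rV[R]_d) :=
  [set A | exists c : 'rV[R]_d, A = [set x : 'rV[R]_d | forall i, c ord0 i < x ord0 i]].

Lemma measurable_quadrant (c : 'rV[R]_d) :
  measurable [set x : 'rV[R]_d | forall i, c ord0 i < x ord0 i].
Proof.
have := @measurable_box R d (fun i => `]c ord0 i, +oo[).
by congr measurable; apply/seteqP; split=> x xc i; have := xc i; rewrite /= in_itv/= andbT.
Qed.

Lemma quadrants_generate : @measurable _ 'rV[R]_d = <<s quadrants >>.
Proof.
apply/seteqP; split; last first.
  apply: smallest_sub; first exact: sigma_algebra_measurable.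
  by move=> _ [c ->]; exact: measurable_quadrant.
have sq : sigma_algebra setT <<s quadrants >> by exact: smallest_sigma_algebra.
apply: smallest_sub => //.
rewrite -bigcup_seq; apply: bigcup_sub => i _ _ [Y mY <-]; rewrite setTI.
pose P := [set Y : set R | <<s quadrants >> ((fun x : 'rV[R]_d => x ord0 i) @^-1` Y)].
suff : measurable `<=` P by exact.
rewrite [X in X `<=` _](RGenOInfty.measurableE R).
case: sq => sq0 sqC sqU.
apply: smallest_sub.
  split=> [|A PA|F PF].
  - by rewrite /P/= preimage_set0.
  - by rewrite /P/= setTD preimage_setC -setTD; exact: sqC.
  - by rewrite /P/= preimage_bigcup; exact: sqU.
move=> _ [c ->]; rewrite /P/=.
pose v (n : nat) : 'rV[R]_d := \row_j (if j == i then c else - n%:R).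
rewrite (_ : _ @^-1` _ = \bigcup_n [set x : 'rV[R]_d | forall j, v n ord0 j < x ord0 j]).
  by apply: sqU => n; apply: sub_sigma_algebra; exists (v n).
apply/seteqP; split=> [x /=|x [n _] /= /(_ i)]; rewrite in_itv/= andbT; last first.
  by rewrite mxE eqxx.
move=> cx; exists (Num.truncn `|x|).+1 => //= j; rewrite mxE; case: eqP => [->//|_].
rewrite ltrNl (le_lt_trans _ (truncnS_gt _))// (le_trans _ (rV_norm_coord x j))//.
by rewrite -normrN ler_norm.
Qed.

Lemma quadrants_setI : setI_closed quadrants.
Proof.
move=> _ _ [c ->] [e ->]; exists (\row_i Num.max (c ord0 i) (e ord0 i)).
apply/seteqP; split=> [x /= [xc xe] i|x /= xce].
  by rewrite mxE gt_max xc xe.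
by split=> i; have := xce i; rewrite mxE gt_max => /andP[].
Qed.

End quadrants.

Section fundamental_lemma.
Context (R : realType) (d : nat).
Local Notation mu := (lebesgue_rV R d).
Implicit Types (Omega : set 'rV[R]_d) (g phi : 'rV[R]_d -> R).

Lemma locally_integrable_test Omega g phi : measurable Omega ->
  locally_integrable_on Omega g -> test_function Omega phi ->
  mu.-integrable Omega (EFin \o (fun x => g x * phi x)).
Proof.
move=> mO [mg ig] tphi; have [K [cK KO phi0]] := test_function_support tphi.
have mK : measurable K by exact: measurable_compact.
have [M M0 phiM] := test_function_bounded tphi.
have iM : mu.-integrable Omega ((fun x => (M * `|g x|)%:E) \_ K).
  rewrite -integrable_restrict// setIidr//.
  under eq_fun do rewrite EFinM.
  by apply: integrableZl => //; apply: (integrable_norm (ig _ KO cK)).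
apply: le_integrable iM => //.
  apply/measurable_EFinP/measurable_funM => //; apply: measurable_funTS.
  by apply: measurable_smooth; exact: test_function_smooth tphi.
move=> x Ox /=; rewrite patchE; case: ifPn => xK.
  rewrite lee_fin normrM mulrC [leRHS]ger0_norm; last by rewrite mulr_ge0// ltW.
  by rewrite ler_wpM2r.
move: xK; rewrite notin_setE => /phi0 ->.
by rewrite mulr0 normr0 abse0.
Qed.

Variables (Omega : set 'rV[R]_d) (g : 'rV[R]_d -> R).
Hypothesis oO : open Omega.
Hypothesis ig : locally_integrable_on Omega g.
Hypothesis g_test : forall phi, test_function Omega phi ->
  \int[mu]_(x in Omega) (g x * phi x) = 0.

Let mO : measurable Omega. Proof. exact: measurable_rV_open. Qed.

(** The bumps of the box are test functions of [Omega] that converge to the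
    indicator of the box, dominated on the closed box by [g]. *)
Lemma integral_obox_eq0 (a b : 'rV[R]_d) : cbox a b `<=` Omega ->
  (\int[mu]_(x in obox a b) (g x)%:E = 0)%E.
Proof.
move=> abO; have mK := measurable_cbox a b; have mU := measurable_obox a b.
have igK : mu.-integrable (cbox a b) (EFin \o g).
  by case: ig => _; apply => //; exact: compact_cbox.
have mgK : measurable_fun (cbox a b) g by apply/measurable_EFinP; case/integrableP: igK.
have tb n : test_function Omega (box_bump n a b).
  apply: (test_function_in_compact (@smooth_box_bump R d n a b) (@compact_cbox R d a b)) => //.
  by move=> x xab; apply: box_bump_out; apply: contra_not xab; exact: obox_cbox.
have int0 n : (\int[mu]_(x in cbox a b) (g x * box_bump n a b x)%:E = 0)%E.
  have iO := locally_integrable_test mO ig (tb n).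
  have := g_test (tb n); rewrite /Rintegral => I0.
  rewrite (_ : (\int[mu]_(x in cbox a b) _ =
      \int[mu]_(x in Omega) (g x * box_bump n a b x)%:E)%E); last first.
    rewrite [LHS]integral_mkcond [RHS]integral_mkcond; apply: eq_integral => x _.
    rewrite !patchE; case: ifPn => [xK|]; first by rewrite mem_set//; exact/abO/set_mem.
    rewrite notin_setE => xK; case: ifP => // _; rewrite box_bump_out ?mulr0//.
    by apply: contra_not xK; exact: obox_cbox.
  by rewrite -[LHS]fineK ?I0//; exact: integrable_fin_num.
pose f_ n x := (g x * box_bump n a b x)%:E.
pose f x := (g x * \1_(obox a b) x)%:E.
have mf_ n : measurable_fun (cbox a b) (f_ n).
  apply/measurable_EFinP/measurable_funM => //; apply: measurable_funTS.
  by apply: measurable_smooth; exact: smooth_box_bump.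
have mf : measurable_fun (cbox a b) f.
  by apply/measurable_EFinP/measurable_funM => //; exact: measurable_indic.
have f_f : {ae mu, forall x, cbox a b x -> f_ ^~ x @ \oo --> f x}.
  apply: aeW => x _; apply: cvg_EFin; first exact: nearW.
  by apply: cvgMr; exact: cvg_box_bump.
have f_g : {ae mu, forall x n, cbox a b x -> (`|f_ n x| <= `|(g x)%:E|)%E}.
  apply: aeW => x n _; rewrite /= lee_fin normrM -[leRHS]mulr1.
  by rewrite ler_wpM2l// box_bump_bound.
have [_ _] := dominated_convergence mK mf_ mf f_f (integrable_norm igK) f_g.
rewrite (_ : [sequence _]_n = fun=> 0%E); last by apply/funext => n; exact: int0.
move=> /cvg_lim fE.
transitivity (\int[mu]_(x in cbox a b) f x)%E; last by rewrite -fE// lim_cst.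
rewrite [LHS]integral_mkcond [RHS]integral_mkcond; apply: eq_integral => x _.
rewrite !patchE /f indicE; case: ifPn => [/set_mem xU|xU].
  by rewrite mem_set ?mulr1//; exact: obox_cbox.
by case: ifP => // _; rewrite mulr0.
Qed.

Let obox_quadrant (a b c : 'rV[R]_d) :
  obox a b `&` [set x : 'rV[R]_d | forall i, c ord0 i < x ord0 i] =
  obox (\row_i Num.max (a ord0 i) (c ord0 i)) b.
Proof.
apply/seteqP; split=> [x /= [xab xc] i|x /= xabc].
  by have /andP[xa xb] := xab i; rewrite mxE gt_max xa xc.
split=> i; have := xabc i; rewrite mxE gt_max => /andP[/andP[xa xc] xb] //.
by rewrite xa.
Qed.

(** By Dynkin's lemma the integral of [g] vanishes on every measurable part of the
    box, so [g] vanishes almost everywhere there. *)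
Lemma ae_eq0_obox (a b : 'rV[R]_d) : cbox a b `<=` Omega ->
  {ae mu, forall x, obox a b x -> g x = 0}.
Proof.
move=> abO; set U := obox a b; have mU : measurable U by exact: measurable_obox.
have igU : mu.-integrable U (EFin \o g).
  apply: (@integrableS _ _ _ _ (cbox a b)) => //; first exact: measurable_cbox.
    exact: obox_cbox.
  by case: ig => _; apply => //; exact: compact_cbox.
have igUS S : measurable S -> mu.-integrable (U `&` S) (EFin \o g).
  by move=> mS; apply: integrableS igU => //; exact: measurableI.
have P0 S : measurable S -> (\int[mu]_(x in U `&` S) (g x)%:E = 0)%E.
  move=> mS; suff : forall S, <<s @quadrants R d >> S ->
      (\int[mu]_(x in U `&` S) (g x)%:E = 0)%E.
    by apply; rewrite -quadrants_generate.
  apply: (@dynkin_induction _ 'rV[R]_d (@quadrants R d)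
    [set S | \int[mu]_(x in U `&` S) (g x)%:E = 0]%E).
  - exact: quadrants_generate.
  - exact: quadrants_setI.
  - by rewrite /= setIT integral_obox_eq0.
  - move=> _ [c ->] /=; rewrite obox_quadrant; apply: integral_obox_eq0.
    apply: subset_trans abO => x xcb i; have := xcb i; rewrite mxE ge_max.
    by move=> /andP[/andP[-> _] ->].
  - move=> {mS}S mS /= IS; have := integral_obox_eq0 abO.
    rewrite -/U -[X in integral _ X]setIT -(setUv S) setIUr.
    rewrite integral_setU//.
    + by rewrite IS add0e.
    + exact: measurableI.
    + by apply: measurableI => //; exact: measurableC.
    + rewrite -setIUr setUv setIT; exact: (measurable_int mu).
    + by apply/disj_setPS => x [[_ ?] [_]].
  - move=> F mF tF IF /=; rewrite setI_bigcupr integral_bigcup.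
    + by rewrite eseries0// => n _ _; exact: IF.
    + apply/trivIsetP => i j _ _ ij; rewrite setIACA setIid.
      by move/trivIsetP : tF => -> //; rewrite setI0.
    + by move=> k; exact: measurableI.
    + by rewrite -setI_bigcupr; apply: igUS; exact: bigcup_measurable.
have := @integral_ae_eq _ _ _ mu U mU (cst 0%E) (EFin \o g) igU.
move=> /(_ (measurable_cst _)) H.
have : ae_eq mu U (EFin \o g) (cst 0%E).
  apply: H => E EU mE; rewrite integral0.
  by rewrite -(setIidr EU) P0.
by apply: filterS => x xU /xU[].
Qed.

(** Countably many boxes cover [Omega], so the exceptional sets stay negligible. *)
Lemma fundamental_lemma : {ae mu, forall x, Omega x -> g x = 0}.
Proof.
pose Q := [set q | cbox (rat_lower R q) (rat_upper R q) `<=` Omega].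
have : forall n, {ae mu, forall x, forall q, unpickle n = Some q -> Q q ->
    obox (rat_lower R q) (rat_upper R q) x -> g x = 0}.
  move=> n; case: unpickle => [q|]; last by apply: aeW.
  have [Qq|Qq] := pselect (Q q); last by apply: aeW => x _ [<-].
  by apply: filterS (ae_eq0_obox Qq) => x xg _ [<-] _; exact: xg.
move=> /ae_foralln; apply: filterS => x xg; rewrite (open_bigcup_rat_box oO).
by move=> [q Qq xq]; apply: (xg (pickle q) q) => //; rewrite pickleK.
Qed.

End fundamental_lemma.

Section weak_gradient_theory.
Context (R : realType) (d : nat).
Local Notation mu := (lebesgue_rV R d).
Implicit Types (Omega : set 'rV[R]_d) (u f phi : 'rV[R]_d -> R)
  (g : 'rV[R]_d -> 'rV[R]_d).

Lemma locally_integrable_onB Omega f h : measurable Omega ->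
  locally_integrable_on Omega f -> locally_integrable_on Omega h ->
  locally_integrable_on Omega (fun x => f x - h x).
Proof.
move=> mO [mf fi] [mh hi]; split; first exact: measurable_funB.
move=> K KO cK; have mK := measurable_compact cK.
rewrite (_ : _ \o _ = (EFin \o f) \- (EFin \o h))%E//.
by apply: integrableB => //; [exact: fi|exact: hi].
Qed.

Lemma weak_gradient_unique Omega u g1 g2 : open Omega ->
  weak_gradient Omega u g1 -> weak_gradient Omega u g2 ->
  {ae mu, forall x, Omega x -> g1 x = g2 x}.
Proof.
move=> oO [_ i1 w1] [_ i2 w2]; have mO := measurable_rV_open oO.
have : forall i, {ae mu, forall x, Omega x -> g1 x ord0 i - g2 x ord0 i = 0}.
  move=> i; apply: fundamental_lemma => //.
    exact: locally_integrable_onB.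
  move=> phi tphi; under eq_Rintegral do rewrite mulrBl.
  rewrite RintegralB//; [|exact: locally_integrable_test (i1 i) tphi
    |exact: locally_integrable_test (i2 i) tphi].
  have := w1 phi i tphi; have := w2 phi i tphi; lra.
move=> g12; have : {ae mu, forall x, forall i, Omega x -> g1 x ord0 i - g2 x ord0 i = 0}.
  exact: filter_forall.
apply: filterS => x xg Ox; apply/rowP => i; apply/eqP; rewrite -subr_eq0.
by rewrite xg.
Qed.

Lemma wgradP Omega u g : weak_gradient Omega u g -> weak_gradient Omega u (wgrad Omega u).
Proof. by move=> ug; exact: (getI ug). Qed.

(** The chosen weak gradient may therefore be replaced under integrals by any
    explicit one. *)
Lemma wgrad_eq Omega u g : open Omega -> weak_gradient Omega u g ->
  {ae mu, forall x, Omega x -> wgrad Omega u x = g x}.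
Proof. by move=> oO ug; exact: weak_gradient_unique (wgradP ug) ug. Qed.

Lemma locally_integrable_smooth Omega f : measurable Omega -> smooth f ->
  locally_integrable_on Omega f.
Proof.
move=> mO sf; have mf := measurable_smooth sf; split; first exact: measurable_funTS.
move=> K KO cK; have mK := measurable_compact cK.
apply: measurable_bounded_integrable => //.
- by apply: bounded_lebesgue_lty => //; exact: compact_bounded.
- exact: measurable_funTS.
- have : compact (f @` K).
    apply: continuous_compact => //; apply: continuous_subspaceT.
    exact: smooth_continuous.
  move=> /compact_bounded[M [Mr MP]]; exists M; split => // y My x Kx /=.
  by apply: (MP _ My); exists x.
Qed.

(** The product with a test function is a test function of the whole space, and
    the integral of its partial derivatives vanishes. *)
Lemma weak_gradient_smooth Omega f : measurable Omega -> smooth f ->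
  weak_gradient Omega f (grad f).
Proof.
move=> mO sf; split=> [|i|phi i tphi].
- exact: locally_integrable_smooth.
- under eq_fun do rewrite mxE.
  by apply: locally_integrable_smooth => //; exact: smooth_partial.
have tfp := test_functionMl sf tphi.
have sphi := test_function_smooth tphi.
have tfdp := test_functionMl sf (test_function_partial i tphi).
have tdfp := test_functionMl (smooth_partial i sf) tphi.
have := integral_partial i (test_functionS (@subsetT _ _) tfp).
rewrite partialM//.
have -> : (\int[mu]_x (f x * partial i phi x + phi x * partial i f x)%:E =
    \int[mu]_(x in Omega) (f x * partial i phi x + partial i f x * phi x)%:E)%E.
  rewrite [RHS]integral_mkcond; apply: eq_integral => x _; rewrite patchE.
  case: ifPn => [_|]; first by rewrite [X in _ + X]mulrC.
  rewrite notin_setE => Ox; rewrite (test_function_out tphi Ox).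
  by rewrite (test_function_out (test_function_partial i tphi) Ox) mul0r mulr0 addr0.
move=> /(congr1 fine); rewrite -/(Rintegral _ _ _) RintegralD//; last 2 first.
  exact: test_function_integrable tfdp.
  exact: test_function_integrable tdfp.
rewrite /= => /eqP; rewrite addr_eq0 => /eqP ->; congr (- _).
by apply: eq_Rintegral => x _; rewrite mxE.
Qed.

End weak_gradient_theory.

Section weak_gradient_operations.
Context (R : realType).

Lemma locally_integrable_onS d (Omega Omega' : set 'rV[R]_d) f :
  measurable Omega -> measurable Omega' -> Omega' `<=` Omega ->
  locally_integrable_on Omega f -> locally_integrable_on Omega' f.
Proof.
move=> mO mO' OO' [mf fi]; split; first exact: measurable_funS mf.
by move=> K KO' cK; apply: fi => //; exact: subset_trans OO'.
Qed.

Lemma weak_gradientS d (Omega Omega' : set 'rV[R]_d) u g :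
  measurable Omega -> measurable Omega' -> Omega' `<=` Omega ->
  weak_gradient Omega u g -> weak_gradient Omega' u g.
Proof.
move=> mO mO' OO' [ui gi ug]; split=> [|i|phi i tphi].
- exact: locally_integrable_onS ui.
- exact: locally_integrable_onS (gi i).
have E h (psi : 'rV[R]_d -> R) : test_function Omega' psi ->
    \int[lebesgue_rV R d]_(x in Omega') (h x * psi x) =
    \int[lebesgue_rV R d]_(x in Omega) (h x * psi x).
  move=> tpsi; rewrite Rintegral_mkcond [RHS]Rintegral_mkcond.
  apply: eq_Rintegral => x _; rewrite !patchE; case: ifPn => [/set_mem/OO' Ox|].
    by rewrite mem_set.
  rewrite notin_setE => /(test_function_out tpsi) ->.
  by rewrite mulr0; case: ifP.
rewrite !E//; last exact: test_function_partial.
exact/ug/(test_functionS OO').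
Qed.

Lemma weak_gradientB d (Omega : set 'rV[R]_d) u1 u2 g1 g2 : measurable Omega ->
  weak_gradient Omega u1 g1 -> weak_gradient Omega u2 g2 ->
  weak_gradient Omega (fun x => u1 x - u2 x) (fun x => g1 x - g2 x).
Proof.
move=> mO [ui1 gi1 ug1] [ui2 gi2 ug2]; split=> [|i|phi i tphi].
- exact: (locally_integrable_onB mO ui1 ui2).
- under eq_fun do rewrite !mxE.
  exact: (locally_integrable_onB mO (gi1 i) (gi2 i)).
have tdphi := test_function_partial i tphi.
under eq_Rintegral do rewrite mulrBl.
under [in RHS]eq_Rintegral do rewrite !mxE mulrBl.
rewrite !RintegralB//; do ?exact: locally_integrable_test.
by rewrite ug1// ug2// opprB opprK addrC.
Qed.

Context (r m : nat) (A : set 'rV[R]_r) (B : set 'rV[R]_m).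
Hypotheses (mA : measurable A) (mB : measurable B).
Local Notation mu := (lebesgue_rV R (r + m)).
Local Notation mu1 := (lebesgue_rV R r).
Local Notation mu2 := (lebesgue_rV R m).

Lemma measurable_fun_rsubmx (h : 'rV[R]_m -> R) : measurable_fun B h ->
  measurable_fun (cylinder A B) (h \o @rsubmx R 1 r m).
Proof.
move=> mh; apply: (measurable_comp mB) => //.
  by move=> _ [x [_ Bx] <-].
by apply: measurable_funTS; exact: measurable_rsubmx.
Qed.

Lemma integral_rsubmx (h : 'rV[R]_m -> \bar R) : measurable_fun B h ->
  (forall y, B y -> 0 <= h y)%E ->
  (\int[mu]_(x in cylinder A B) h (rsubmx x) = mu1 A * \int[mu2]_(y in B) h y)%E.
Proof.
move=> mh h0; rewrite tonelli_cylinder//; last 2 first.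
- apply: (measurable_comp mB) mh _; first by move=> _ [x [_ Bx] <-].
  by apply: measurable_funTS; exact: measurable_rsubmx.
- by move=> x [_ Bx]; exact: h0.
under eq_integral => x _ do under eq_integral do rewrite row_mxKr.
by rewrite integral_cst// muleC.
Qed.

End weak_gradient_operations.

(** Functions of [x''] alone: Fubini reduces both halves of the weak formula
    on a cylinder to one-sided statements on its slices. *)
Section weak_gradient_cylinder.
Context (R : realType) (r m : nat).
Implicit Types (A : set 'rV[R]_r) (B : set 'rV[R]_m).
Local Notation mu := (lebesgue_rV R (r + m)).
Local Notation mu1 := (lebesgue_rV R r).
Local Notation mu2 := (lebesgue_rV R m).

Lemma locally_integrable_rsubmx A B (h : 'rV[R]_m -> R) :
  measurable A -> measurable B ->
  locally_integrable_on B h -> locally_integrable_on (cylinder A B) (h \o @rsubmx R 1 r m).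
Proof.
move=> mA mB [mh hi]; split; first exact: measurable_fun_rsubmx.
move=> K KAB cK.
pose K1 := @lsubmx R 1 r m @` K; pose K2 := @rsubmx R 1 r m @` K.
have cK1 : compact K1.
  apply: continuous_compact => //; apply: continuous_subspaceT.
  exact: continuous_lsubmx.
have cK2 : compact K2.
  apply: continuous_compact => //; apply: continuous_subspaceT.
  exact: continuous_rsubmx.
have mK1 := measurable_compact cK1; have mK2 := measurable_compact cK2.
have K2B : K2 `<=` B by move=> _ [x /KAB[_ Bx] <-].
have KK : K `<=` cylinder K1 K2 by move=> x Kx; split; exists x.
apply: (@integrableS _ _ _ _ (cylinder K1 K2)) => //.
- exact: measurable_cylinder.
- exact: measurable_compact.
have mh2 : measurable_fun K2 h by exact: measurable_funS mh.
apply/integrableP; split; first by apply/measurable_EFinP; exact: measurable_fun_rsubmx.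
have /integrableP[_ hoo] := hi _ K2B cK2.
rewrite (integral_rsubmx mK1 mK2 (h := fun y => `|(h y)%:E|%E))//; last first.
  by apply/measurable_EFinP; apply: measurableT_comp.
apply: lte_mul_pinfty => //.
by rewrite ge0_fin_numE// bounded_lebesgue_lty//; exact: compact_bounded.
Qed.

Lemma weak_gradient_rsubmx A B u g : measurable A -> measurable B ->
  weak_gradient B u g ->
  weak_gradient (cylinder A B) (u \o @rsubmx R 1 r m)
    (fun x => row_mx 0 (g (rsubmx x))).
Proof.
move=> mA mB [ui gi ug]; have mAB := measurable_cylinder mA mB.
have lu := locally_integrable_rsubmx mA mB ui.
have lg (i : 'I_(r + m)) : locally_integrable_on (cylinder A B)
    (fun x => (row_mx 0 (g (rsubmx x)) : 'rV[R]_(r + m)) ord0 i).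
  case: (split_ordP i) => j ->.
    under eq_fun do rewrite row_mxEl mxE.
    by apply: locally_integrable_smooth => //; exact: smooth_cst.
  under eq_fun do rewrite row_mxEr.
  exact: (locally_integrable_rsubmx mA mB (gi j)).
split => // phi i tphi; have tdphi := test_function_partial i tphi.
have iu := locally_integrable_test mAB lu tdphi.
have ig := locally_integrable_test mAB (lg i) tphi.
apply/eqP; rewrite -addr_eq0 -RintegralD//; apply/eqP.
have isum : mu.-integrable (cylinder A B) (EFin \o (fun x => (u \o rsubmx) x * partial i phi x +
    (row_mx 0 (g (rsubmx x)) : 'rV[R]_(r + m)) ord0 i * phi x)).
  exact: (integrableD mAB iu ig).
rewrite /Rintegral; case: (split_ordP i) => j ij.
  rewrite fubini_cylinder_swap//= integral0_eq// => y _.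
  rewrite ij; under eq_integral do rewrite row_mxEl mxE mul0r addr0 row_mxKr EFinM.
  have tphiy := test_function_row_mxl y tphi.
  have tdphiy := test_function_partial j tphiy.
  rewrite (eq_integral (fun x => (u y)%:E * (partial j (fun x => phi (row_mx x y)) x)%:E)%E); last first.
    by move=> x _; rewrite partial_row_mxl.
  rewrite integralZl//; last exact: test_function_integrable tdphiy.
  rewrite (_ : (\int[_]_(x in A) _ = \int[mu1]_x (partial j (fun x => phi (row_mx x y)) x)%:E)%E).
    by rewrite integral_partial ?mule0//; exact: test_functionS tphiy.
  rewrite [LHS]integral_mkcond; apply: eq_integral => x _; rewrite patchE.
  by case: ifPn => //; rewrite notin_setE => /(test_function_out tdphiy) ->.
rewrite fubini_cylinder//= integral0_eq// => x _.
rewrite ij; under eq_integral do rewrite row_mxEr row_mxKr.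
have tphix := test_function_row_mxr x tphi.
have tdphix := test_function_partial j tphix.
have iux := locally_integrable_test mB ui tdphix.
have igx := locally_integrable_test mB (gi j) tphix.
rewrite (eq_integral (fun y => (u y * partial j (fun y => phi (row_mx x y)) y +
  g y ord0 j * phi (row_mx x y))%:E)); last first.
  by move=> y _; rewrite partial_row_mxr.
have := ug _ j tphix => /eqP; rewrite -addr_eq0 -RintegralD// => /eqP.
rewrite /Rintegral => I0; rewrite -[LHS]fineK ?I0//.
apply: integrable_fin_num => //.
exact: (integrableD mB iux igx).
Qed.

End weak_gradient_cylinder.

(** * Lebesgue spaces *)

Section integrable_real.
Context d (T : measurableType d) (R : realType) (mu : {measure set T -> \bar R}).
Variables (D : set T) (mD : measurable D).
Implicit Types f g : T -> R.

Lemma integrable_addR f g : mu.-integrable D (EFin \o f) -> mu.-integrable D (EFin \o g) ->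
  mu.-integrable D (EFin \o (fun x => f x + g x)).
Proof. by move=> fi gi; exact: (integrableD mD fi gi). Qed.

Lemma integrable_subR f g : mu.-integrable D (EFin \o f) -> mu.-integrable D (EFin \o g) ->
  mu.-integrable D (EFin \o (fun x => f x - g x)).
Proof. by move=> fi gi; exact: (integrableB mD fi gi). Qed.

Lemma integrable_scaleR (c : R) f : mu.-integrable D (EFin \o f) ->
  mu.-integrable D (EFin \o (fun x => c * f x)).
Proof. by move=> fi; exact: (integrableZl mD c fi). Qed.

Lemma ge0_integrable_lty f : measurable_fun D f -> (forall x, D x -> 0 <= f x) ->
  (\int[mu]_(x in D) (f x)%:E < +oo)%E -> mu.-integrable D (EFin \o f).
Proof.
move=> mf f0 foo; apply/integrableP; split; first exact/measurable_EFinP.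
rewrite (eq_integral (EFin \o f))// => x /set_mem Dx /=.
by rewrite ger0_norm// f0.
Qed.

Lemma dominated_integrableR f g : measurable_fun D f -> mu.-integrable D (EFin \o g) ->
  (forall x, D x -> `|f x| <= g x) -> mu.-integrable D (EFin \o f).
Proof.
move=> mf gi fg; apply: le_integrable gi => //; first exact/measurable_EFinP.
by move=> x Dx /=; rewrite lee_fin (le_trans (fg x Dx))// ler_norm.
Qed.

Lemma EFin_Rintegral f : mu.-integrable D (EFin \o f) ->
  (\int[mu]_(x in D) f x)%:E = (\int[mu]_(x in D) (f x)%:E)%E.
Proof. by move=> fi; rewrite /Rintegral fineK//; exact: integrable_fin_num. Qed.

End integrable_real.

Section Lp.
Context (R : realType) (d : nat) (p : R) (Omega : set 'rV[R]_d).
Hypotheses (p0 : 0 < p) (mO : measurable Omega).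
Local Notation mu := (lebesgue_rV R d).
Implicit Types f : 'rV[R]_d -> R.

Lemma Lp_normE f :
  Lp_norm p Omega f = ((\int[mu]_(x in Omega) (`|f x| `^ p)%:E) `^ p^-1)%E.
Proof.
rewrite /Lp_norm unlock; congr (_ `^ _)%E.
rewrite [RHS]integral_mkcond; apply: eq_integral => x _; rewrite /= !patchE.
by case: ifP => //; rewrite normr0 powR0// gt_eqF.
Qed.

Lemma Lp_norm_lt f (e : R) : 0 < e -> (Lp_norm p Omega f < e%:E)%E ->
  (\int[mu]_(x in Omega) (`|f x| `^ p)%:E <= (e `^ p)%:E)%E.
Proof.
move=> e0; rewrite Lp_normE => fe.
set I := (\int[_]_(x in _) _)%E in fe *.
have I0 : (0 <= I)%E by apply: integral_ge0 => x _; rewrite lee_fin powR_ge0.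
rewrite -[I]poweRe1// -(mulVf (lt0r_neq0 p0)) poweRrM -poweR_EFin.
apply: gt0_ler_poweR; rewrite ?in_itv/= ?leey ?poweR_ge0 ?lee_fin ?ltW//.
Qed.

Lemma Lp_norm_le f (c : R) : 0 <= c ->
  (\int[mu]_(x in Omega) (`|f x| `^ p)%:E <= (c `^ p)%:E)%E ->
  (Lp_norm p Omega f <= c%:E)%E.
Proof.
move=> c0 fc; rewrite Lp_normE -[c]powRr1// -(mulfV (lt0r_neq0 p0)) powRrM -poweR_EFin.
apply: gt0_ler_poweR => //; first by rewrite invr_ge0 ltW.
- rewrite in_itv/= leey integral_ge0// => x _; rewrite lee_fin powR_ge0//.
- by rewrite in_itv/= leey lee_fin powR_ge0.
Qed.

Lemma measurable_norm_powR f : measurable_fun Omega f ->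
  measurable_fun Omega (fun x => `|f x| `^ p).
Proof.
by move=> mf; apply: (measurableT_comp (measurable_powR p)); exact: measurableT_comp.
Qed.

Lemma inLpP f : inLp p Omega f <-> measurable_fun Omega f /\
  mu.-integrable Omega (EFin \o (fun x => `|f x| `^ p)).
Proof.
have E : (Lp_norm p Omega f < +oo)%E <-> (\int[mu]_(x in Omega) (`|f x| `^ p)%:E < +oo)%E.
  rewrite Lp_normE; split=> [|foo]; last exact: poweR_lty.
  by apply: lty_poweRy; rewrite invr_neq0// gt_eqF.
split.
  move=> /andP[fm ff].
  have mf : measurable_fun setT (f \_ Omega) := set_mem fm.
  have foo : (Lp_norm p Omega f < +oo)%E := set_mem ff.
  have {}mf : measurable_fun Omega f by apply/(measurable_restrictT _ mO).
  split => //; apply: ge0_integrable_lty => //; first exact: measurable_norm_powR.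
  exact: E.1 foo.
move=> [mf fi]; apply/andP; split; apply: mem_set.
  by apply: ((measurable_restrictT f mO).1 _).
apply: (E.2 _); have /integrableP[_] := fi; apply: le_lt_trans.
apply: ge0_le_integral => //.
- by apply/measurable_EFinP; exact: measurable_norm_powR.
- by apply: measurableT_comp => //; apply/measurable_EFinP; exact: measurable_norm_powR.
- by move=> x _ /=; rewrite lee_fin ler_norm.
Qed.

End Lp.

Section convex_integrand.
Context (R : realType) (d : nat) (p Lam : R) (F : 'rV[R]_d -> R).
Hypotheses (p0 : 0 < p)
  (Fconv : forall (x y : 'rV[R]_d) (t : R), 0 <= t <= 1 -> F (t *: x + (1 - t) *: y) <= t * F x + (1 - t) * F y)
  (F0 : forall x, 0 <= F x)
  (Flam : forall x, F x <= Lam * (enorm x `^ p + 1)).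

Let Lam0 : 0 <= Lam.
Proof.
by have := le_trans (F0 0) (Flam 0); rewrite enorm0 powR0 ?gt_eqF// add0r mulr1.
Qed.

(** Writing [b] as a convex combination of [a] and of the far away point
    [a + (b - a) / t] makes [F] upper semicontinuous with a remainder that is
    controlled by the growth of [F] alone. *)
Lemma convex_growth_upper a b t : 0 < t <= 1 ->
  F b <= F a + t * Lam * (1 + 2 `^ p * (enorm a `^ p + t^-1 `^ p * enorm (b - a) `^ p)).
Proof.
move=> /andP[t0 t1]; pose c := a + t^-1 *: (b - a).
have bE : b = t *: c + (1 - t) *: a.
  rewrite /c scalerDr scalerA divff ?gt_eqF// scale1r scalerBl scale1r.
  by rewrite [X in _ + X]addrC addrACA subrr add0r subrK.
rewrite [in leLHS]bE; apply: le_trans (Fconv _ _ _) _; first by rewrite ltW.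
rewrite addrC; apply: lerD; first by rewrite ler_piMl// gerBl ltW.
rewrite -mulrA ler_wpM2l ?(ltW t0)//; apply: (le_trans (Flam _)).
rewrite ler_wpM2l// addrC lerD2l /c (le_trans (enormD_powR _ _ (ltW p0)))//.
by rewrite enormZ powRM ?enorm_ge0// ger0_norm// invr_ge0 ltW.
Qed.

Lemma enorm_le_norm (x : 'rV[R]_d) : enorm x <= d%:R * `|x|.
Proof. by apply: enorm_le_coord => // i; exact: rV_norm_coord. Qed.

(** The upper bound, used once from each of the two points with the step [t] equal
    to the bound on their distance, gives continuity. *)
Lemma convex_growth_continuous : continuous F.
Proof.
move=> a; apply/(@cvgrPdist_lt _ _ _ _ (nbhs_filter a)) => e e0.
have one_p : 1 `^ p = 1 :> R by rewrite powR1.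
pose K := 1 + 2 `^ p * (2 `^ p * (enorm a `^ p + 1) + 1).
have K0 : 0 < K.
  by rewrite ltr_pwDl// mulr_ge0 ?powR_ge0// addr_ge0// mulr_ge0 ?addr_ge0 ?powR_ge0.
pose t := Num.min 1 (e / ((Lam + 1) * K) / 2).
have LK0 : 0 < (Lam + 1) * K by rewrite mulr_gt0// ltr_wpDl.
have t0 : 0 < t by rewrite lt_min ltr01/= !divr_gt0.
have t1 : t <= 1 by rewrite ge_min lexx.
have te : t * Lam * K < e.
  have tl : t <= e / ((Lam + 1) * K) / 2 by rewrite ge_min lexx orbT.
  apply: (@le_lt_trans _ _ (t * ((Lam + 1) * K))).
    by rewrite mulrA ler_wpM2r ?(ltW K0)// ler_wpM2l ?(ltW t0)// lerDl.
  rewrite -ltr_pdivlMr// (le_lt_trans tl)// ltr_pdivrMr// mulr_natr mulr2n.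
  by rewrite ltrDl divr_gt0.
have near1 (b x : 'rV[R]_d) : enorm (b - a) <= t -> (x = a \/ x = b) ->
    1 + 2 `^ p * (enorm x `^ p + t^-1 `^ p * enorm (b - a) `^ p) <= K.
  move=> bt xab.
  have tb : t^-1 `^ p * enorm (b - a) `^ p <= 1.
    rewrite -powRM ?enorm_ge0// ?invr_ge0 ?(ltW t0)//.
    rewrite -[leRHS]one_p; apply: ge0_ler_powR; rewrite ?nnegrE ?(ltW p0)//.
      by rewrite mulr_ge0 ?enorm_ge0// invr_ge0 ltW.
    by rewrite mulrC ler_pdivrMr// mul1r.
  have bp : enorm (b - a) `^ p <= 1.
    rewrite -[leRHS]one_p; apply: ge0_ler_powR; rewrite ?nnegrE ?enorm_ge0 ?(ltW p0)//.
    exact: le_trans bt t1.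
  have xa : enorm x `^ p <= 2 `^ p * (enorm a `^ p + 1).
    have p2 : 1 <= 2 `^ p :> R.
      by rewrite -[leLHS](powRr0 2) ler_powR ?ler1n// ltW.
    case: xab => ->.
      rewrite (@le_trans _ _ (enorm a `^ p + 1))// ?lerDl//.
      by rewrite ler_peMl// addr_ge0// powR_ge0.
    rewrite -[b](subrK a) addrC (le_trans (enormD_powR _ _ (ltW p0)))//.
    by rewrite ler_wpM2l ?powR_ge0// lerD2l.
  by rewrite lerD2l ler_wpM2l ?powR_ge0// lerD.
have : \forall b \near a, `|a - b| < t / (d%:R + 1).
  apply/nbhs_ballP; exists (t / (d%:R + 1)) => /=; first by rewrite divr_gt0// ltr_wpDl.
  by move=> b; rewrite -ball_normE.
apply: (@filterS _ _ (nbhs_filter a)) => b ab.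
have bt : enorm (b - a) <= t.
  rewrite (le_trans (enorm_le_norm _))// distrC.
  rewrite (@le_trans _ _ ((d%:R + 1) * (t / (d%:R + 1))))//.
    by apply: ler_pM => //; [rewrite lerDl|exact: ltW].
  by rewrite mulrCA divff ?mulr1// gt_eqF// ltr_wpDl.
have t01 : 0 < t <= 1 by rewrite t0 t1.
have Fba := convex_growth_upper a b t01.
have Fab := convex_growth_upper b a t01.
have Ka := near1 b a bt (or_introl erefl).
have Kb := near1 b b bt (or_intror erefl).
rewrite -[enorm (a - b)]enormN opprB in Fab.
have tL : 0 <= t * Lam by rewrite mulr_ge0// ltW.
have Ka' := ler_wpM2l tL Ka; have Kb' := ler_wpM2l tL Kb.
rewrite ltr_distl; apply/andP; split; lra.
Qed.

End convex_integrand.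

Section measurable_rV_valued.
Context (R : realType) (d : nat).

Lemma measurable_fun_rV_on d' (T : measurableType d') (D : set T) (g : T -> 'rV[R]_d) :
  measurable D -> (forall i, measurable_fun D (fun t => g t ord0 i)) ->
  measurable_fun D g.
Proof.
move=> mD mg; pose h t : 'rV[R]_d := \row_i ((fun t => g t ord0 i) \_ D) t.
apply: (@eq_measurable_fun _ _ _ _ D h).
  by move=> t tD; apply/rowP => i; rewrite mxE patchE tD.
apply: measurable_funTS; apply: measurable_fun_rV => i; rewrite /h.
under eq_fun do rewrite mxE.
by apply: ((measurable_restrictT (fun t => g t ord0 i) mD).1 _).
Qed.

Lemma measurable_wgrad (Omega : set 'rV[R]_d) u g : measurable Omega ->
  weak_gradient Omega u g -> measurable_fun Omega g.
Proof.
by move=> mO [_ gi _]; apply: measurable_fun_rV_on => // i; case: (gi i).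
Qed.

Lemma enorm_powR_le_sum (x : 'rV[R]_d) (p : R) : 0 < p ->
  enorm x `^ p <= d%:R `^ p * \sum_i `|x ord0 i| `^ p.
Proof.
move=> p0; apply: (@le_trans _ _ ((d%:R * `|x|) `^ p)).
  by apply: ge0_ler_powR; rewrite ?nnegrE ?enorm_ge0 ?mulr_ge0 ?(ltW p0)// enorm_le_norm.
rewrite powRM// ler_wpM2l ?powR_ge0//.
have [->|x0] := eqVneq `|x| 0.
  by rewrite powR0 ?gt_eqF// sumr_ge0// => i _; rewrite powR_ge0.
have [[j i] /= xE] := mx_norm_neq0 x0; rewrite (ord1 j) in xE.
have -> : `|x| = `|x ord0 i| by exact: xE.
rewrite (bigD1 i)//= lerDl.
by rewrite sumr_ge0// => k _; rewrite powR_ge0.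
Qed.

End measurable_rV_valued.

Lemma conjugate_exponent_gt0 (R : realFieldType) (p p' : R) :
  1 < p -> p^-1 + p'^-1 = 1 -> 0 < p'.
Proof.
move=> p1 pp'; have : p^-1 < 1 by rewrite invf_lt1// (lt_trans _ p1).
by rewrite -invr_gt0; move: pp'; lra.
Qed.

(** Rescaling [a * b = (s * a) * (b / s)] with [s `^ p' = eta] before applying
    Young's inequality makes the first coefficient as small as desired. *)
Lemma young_small (R : realType) (p p' eta : R) : 1 < p -> p^-1 + p'^-1 = 1 -> 0 < eta ->
  exists2 C : R, 0 < C & forall a b : R, `|a * b| <= eta * `|a| `^ p' + C * `|b| `^ p.
Proof.
move=> p1 pp' eta0; have p0 : 0 < p by rewrite (lt_trans _ p1).
have p'1 : p'^-1 < 1 by rewrite -pp' ltrDr invr_gt0.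
have p'V0 : 0 < p'^-1.
  by rewrite invr_gt0; exact: conjugate_exponent_gt0 p1 pp'.
have p'0 := conjugate_exponent_gt0 p1 pp'.
pose s := eta `^ p'^-1; have s0 : 0 < s by rewrite powR_gt0.
exists (s^-1 `^ p) => [|a b]; first by rewrite powR_gt0// invr_gt0.
have -> : `|a * b| = (s * `|a|) * (s^-1 * `|b|).
  by rewrite normrM mulrACA divff ?mul1r// gt_eqF.
have p'p : p'^-1 + p^-1 = 1 by rewrite addrC.
apply: le_trans (conjugate_powR _ _ p'0 p0 p'p) _; rewrite ?mulr_ge0// ?invr_ge0 ?(ltW s0)//.
rewrite !powRM ?invr_ge0 ?(ltW s0)//.
have -> : s `^ p' = eta by rewrite /s -powRrM mulVf ?gt_eqF// powRr1// ltW.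
apply: lerD; first by rewrite ler_piMr ?mulr_ge0 ?powR_ge0 ?(ltW eta0)// ltW.
by rewrite ler_piMr ?mulr_ge0 ?powR_ge0// invf_le1// ltW.
Qed.

(** * Integrability on bounded domains *)

Section bounded_domains.
Context (R : realType).

Lemma sub_bounded_set d (U V : set 'rV[R]_d) : U `<=` V -> bounded_set V -> bounded_set U.
Proof. by move=> UV [M [Mr MP]]; exists M; split => // x Mx y /UV; exact: MP. Qed.

Lemma bounded_cube d (M : R) : bounded_set (cube M : set 'rV[R]_d).
Proof. by apply: compact_bounded; exact: compact_cube. Qed.

Lemma open_cylinder r m (A : set 'rV[R]_r) (B : set 'rV[R]_m) :
  open A -> open B -> open (cylinder A B).
Proof.
move=> oA oB; rewrite (_ : cylinder A B =
  (@lsubmx R 1 r m @^-1` A) `&` (@rsubmx R 1 r m @^-1` B))//.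
by apply: openI; apply: open_comp => // x _; [exact: continuous_lsubmx|exact: continuous_rsubmx].
Qed.

Lemma bounded_cylinder r m (A : set 'rV[R]_r) (B : set 'rV[R]_m) :
  bounded_set A -> bounded_set B -> bounded_set (cylinder A B).
Proof.
move=> /bounded_sub_cube[M M0 AM] /bounded_sub_cube[N N0 BN].
apply: (sub_bounded_set _ (@bounded_cube (r + m) (M + N))) => x [/AM xM /BN xN] i.
case: (split_ordP i) => j ->.
  by have := xM j; rewrite mxE => /le_trans; apply; rewrite lerDl ltW.
by have := xN j; rewrite mxE => /le_trans; apply; rewrite lerDr ltW.
Qed.

Section continuous_integrable.
Context (d : nat) (U : set 'rV[R]_d).
Hypotheses (mU : measurable U) (bU : bounded_set U).

Lemma continuous_bounded_on (h : 'rV[R]_d -> R) : continuous h ->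
  exists2 M : R, 0 < M & forall x, U x -> `|h x| <= M.
Proof.
move=> ch; have [N _ UN] := bounded_sub_cube bU.
have : compact (h @` cube N).
  by apply: continuous_compact; [exact: continuous_subspaceT|exact: compact_cube].
move=> /compact_bounded[M [_ MP]]; exists (`|M| + 1) => [|x Ux]; first by rewrite ltr_wpDl.
apply: (MP (`|M| + 1)); first by rewrite (le_lt_trans (ler_norm M))// ltrDl.
by exists x => //; exact: UN.
Qed.

Lemma bounded_on_integrable (h : 'rV[R]_d -> R) (M : R) : measurable_fun U h ->
  (forall x, U x -> `|h x| <= M) -> (lebesgue_rV R d).-integrable U (EFin \o h).
Proof.
move=> mh hM; apply: measurable_bounded_integrable => //.
  exact: bounded_lebesgue_lty.
exists M; split=> [|y My x Ux /=]; first exact: num_real.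
by rewrite (le_trans (hM x Ux))// ltW.
Qed.

Lemma continuous_integrable (h : 'rV[R]_d -> R) : continuous h ->
  (lebesgue_rV R d).-integrable U (EFin \o h).
Proof.
move=> ch; have [M _ hM] := continuous_bounded_on ch.
apply: bounded_on_integrable hM; apply: measurable_funTS.
exact: measurable_rV_continuous.
Qed.

Lemma continuous_powR_integrable (h : 'rV[R]_d -> R) (p : R) : 0 <= p -> continuous h ->
  (lebesgue_rV R d).-integrable U (EFin \o (fun x => `|h x| `^ p)).
Proof.
move=> p0 ch; have [M M0 hM] := continuous_bounded_on ch.
apply: (@bounded_on_integrable _ (M `^ p)) => [|x Ux].
  by apply: measurable_norm_powR; apply: measurable_funTS; exact: measurable_rV_continuous.
rewrite ger0_norm ?powR_ge0//; apply: ge0_ler_powR; rewrite ?nnegrE ?(ltW M0)//.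
exact: hM.
Qed.

Lemma grad_powR_integrable (h : 'rV[R]_d -> R) (p : R) : 0 < p -> smooth h ->
  (lebesgue_rV R d).-integrable U (EFin \o (fun x => enorm (grad h x) `^ p)).
Proof.
move=> p0 sh.
have mg : measurable_fun U (fun x => enorm (grad h x) `^ p).
  by apply: measurable_enorm_powR; apply: measurable_funTS; exact: measurable_grad.
apply: (@dominated_integrableR _ _ _ _ _ mU _
  (fun x => d%:R `^ p * \sum_i `|partial i h x| `^ p)) => // [|x _].
  apply: integrable_scaleR => //.
  rewrite (_ : _ \o _ = fun x => (\sum_i (`|partial i h x| `^ p)%:E)%E); last first.
    by apply/funext => x; rewrite sumEFin.
  apply: integrable_sum => // i _; apply: continuous_powR_integrable; first exact: ltW.
  by apply: smooth_continuous; exact: smooth_partial.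
rewrite ger0_norm ?powR_ge0// (le_trans (enorm_powR_le_sum _ p0))//.
by rewrite ler_wpM2l ?powR_ge0//; apply: ler_sum => i _; rewrite mxE.
Qed.

End continuous_integrable.

End bounded_domains.

(** * Sobolev functions and test functions *)

Section sobolev0_theory.
Context (R : realType) (d : nat) (p : R) (Omega : set 'rV[R]_d).
Hypotheses (p0 : 0 < p) (oO : open Omega).
Local Notation mu := (lebesgue_rV R d).

Let mO : measurable Omega. Proof. exact: measurable_rV_open. Qed.

Lemma sobolev_integrable u : sobolev p Omega u ->
  [/\ measurable_fun Omega u, mu.-integrable Omega (EFin \o (fun x => `|u x| `^ p)),
      measurable_fun Omega (wgrad Omega u) &
      mu.-integrable Omega (EFin \o (fun x => enorm (wgrad Omega u x) `^ p))].
Proof.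
move=> [/(inLpP p0 mO)[mu1 ui] wu wi]; have mw := measurable_wgrad mO wu; split => //.
apply: (@dominated_integrableR _ _ _ _ _ mO _
  (fun x => d%:R `^ p * \sum_i `|wgrad Omega u x ord0 i| `^ p)).
- exact: measurable_enorm_powR.
- apply: integrable_scaleR => //.
  rewrite (_ : _ \o _ = fun x => (\sum_i (`|wgrad Omega u x ord0 i| `^ p)%:E)%E); last first.
    by apply/funext => x; rewrite sumEFin.
  by apply: integrable_sum => // i _; have /(inLpP p0 mO)[] := wi i.
- by move=> x _; rewrite ger0_norm ?powR_ge0// enorm_powR_le_sum.
Qed.

Lemma sobolev0_approx u e : sobolev0 p Omega u -> 0 < e ->
  exists phi, [/\ test_function Omega phi,
    (\int[mu]_(x in Omega) (`|u x - phi x| `^ p)%:E <= e%:E)%E &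
    (\int[mu]_(x in Omega) (enorm (wgrad Omega u x - grad phi x) `^ p)%:E <= e%:E)%E].
Proof.
move=> [_ ua] e0; pose e' := e `^ p^-1; have e'0 : 0 < e' by rewrite powR_gt0.
have e'e : e' `^ p = e by rewrite /e' -powRrM mulVf ?gt_eqF// powRr1// ltW.
have [phi tphi b] := ua _ e'0; exists phi; rewrite -e'e; split=> //.
  apply: Lp_norm_lt => //; apply: le_lt_trans b; rewrite leeDl//; exact: Lnorm_ge0.
have : (Lp_norm p Omega (fun x => enorm (wgrad Omega u x - grad phi x)) < e'%:E)%E.
  apply: le_lt_trans b; rewrite leeDr//; exact: Lnorm_ge0.
move=> /(Lp_norm_lt p0 e'0); apply: le_trans.
rewrite le_eqVlt; apply/orP; left; apply/eqP; apply: eq_integral => x _.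
by rewrite ger0_norm// enorm_ge0.
Qed.

Hypothesis bO : bounded_set Omega.

Let finO : (mu Omega < +oo)%E. Proof. exact: bounded_lebesgue_lty. Qed.

Lemma test_function_pow_integrable phi : test_function Omega phi ->
  [/\ measurable_fun Omega phi, mu.-integrable Omega (EFin \o (fun x => `|phi x| `^ p)),
      measurable_fun Omega (grad phi) &
      mu.-integrable Omega (EFin \o (fun x => enorm (grad phi x) `^ p))].
Proof.
move=> tphi; have sphi := test_function_smooth tphi.
have mphi : measurable_fun Omega phi by apply: measurable_funTS; exact: measurable_smooth.
have mg : measurable_fun Omega (grad phi) by apply: measurable_funTS; exact: measurable_grad.
split => //; last exact: grad_powR_integrable.
by apply: continuous_powR_integrable => //; [exact: ltW|exact: smooth_continuous].
Qed.

Lemma wgrad_test_function phi : test_function Omega phi ->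
  {ae mu, forall x, Omega x -> wgrad Omega phi x = grad phi x}.
Proof.
move=> tphi; apply: wgrad_eq => //; apply: weak_gradient_smooth => //.
exact: test_function_smooth tphi.
Qed.

(** Test functions are admissible competitors; their weak gradient is the
    classical one up to a null set. *)
Lemma test_function_sobolev0 phi : test_function Omega phi -> sobolev0 p Omega phi.
Proof.
move=> tphi; have sphi := test_function_smooth tphi.
have wphi : weak_gradient Omega phi (grad phi) by exact: weak_gradient_smooth.
have wP := wgradP wphi; have ae := wgrad_test_function tphi.
have [mphi iphi mg ig] := test_function_pow_integrable tphi.
have mw := measurable_wgrad mO wP.
split; first split=> //.
- exact/(inLpP p0 mO).
- move=> i; apply/(inLpP p0 mO).
  have mwi : measurable_fun Omega (fun x => wgrad Omega phi x ord0 i).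
    by case: wP => _ /(_ i)[].
  have igi : mu.-integrable Omega (EFin \o (fun x => `|grad phi x ord0 i| `^ p)).
    apply: (dominated_integrableR mO _ ig) => [|x _].
      by apply: measurable_norm_powR; exact: (measurableT_comp (measurable_coord i)).
    rewrite ger0_norm ?powR_ge0//.
    by apply: ge0_ler_powR; rewrite ?nnegrE ?enorm_ge0 ?(ltW p0)// coord_le_enorm.
  split => //; apply: ge0_integrable_lty => //; first exact: measurable_norm_powR.
  rewrite (ae_eq_integral (EFin \o (fun x => `|grad phi x ord0 i| `^ p)))//.
  + exact: integrable_lty.
  + by apply/measurable_EFinP; exact: measurable_norm_powR.
  + by case/integrableP : igi.
  + by apply: filterS ae => x xg Ox /=; rewrite xg.
- move=> e e0; exists phi => //.
  rewrite (_ : Lp_norm _ _ _ = 0)%E; last first.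
    rewrite Lp_normE// integral0_eq ?poweR0r ?invr_neq0 ?gt_eqF// => x _.
    by rewrite subrr normr0 powR0// gt_eqF.
  rewrite add0e (_ : Lp_norm _ _ _ = 0)%E// Lp_normE//.
  rewrite (ae_eq_integral (cst 0%E))//.
  + by rewrite integral0 poweR0r// invr_neq0// gt_eqF.
  + apply/measurable_EFinP; apply: measurable_norm_powR.
    apply: (measurableT_comp (@measurable_enorm R d)).
    apply: measurable_fun_rV_on => // i; under eq_fun do rewrite 3!mxE.
    apply: measurable_funB; first by case: wP => _ /(_ i)[].
    by apply: measurable_funTS; apply: measurable_smooth; exact: smooth_partial.
  + by apply: filterS ae => x xg Ox /=; rewrite xg// subrr enorm0 normr0 powR0// gt_eqF.
Qed.

End sobolev0_theory.

(** * Energies of test functions *)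

Section test_function_energy.
Context (R : realType) (d : nat) (p p' Lam : R) (Omega : set 'rV[R]_d)
  (F : 'rV[R]_d -> R) (f : 'rV[R]_d -> R).
Hypotheses (p1 : 1 < p) (pp' : p^-1 + p'^-1 = 1)
  (oO : open Omega) (bO : bounded_set Omega)
  (Fconv : forall (x y : 'rV[R]_d) (t : R), 0 <= t <= 1 ->
     F (t *: x + (1 - t) *: y) <= t * F x + (1 - t) * F y)
  (F0 : forall x, 0 <= F x)
  (Flam : forall x, F x <= Lam * (enorm x `^ p + 1))
  (fL : inLp p' Omega f).
Local Notation mu := (lebesgue_rV R d).

Let p0 : 0 < p. Proof. by rewrite (lt_trans _ p1). Qed.

Let p'0 : 0 < p'. Proof. exact: conjugate_exponent_gt0 p1 pp'. Qed.

Let mO : measurable Omega. Proof. exact: measurable_rV_open. Qed.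

Let finO : (mu Omega < +oo)%E. Proof. exact: bounded_lebesgue_lty. Qed.

Let mF : measurable_fun setT F.
Proof. by apply: measurable_rV_continuous; exact: convex_growth_continuous p0 Fconv F0 Flam. Qed.

Let mf : measurable_fun Omega f. Proof. by have /(inLpP p'0 mO)[] := fL. Qed.

Let fi : mu.-integrable Omega (EFin \o (fun x => `|f x| `^ p')).
Proof. by have /(inLpP p'0 mO)[] := fL. Qed.

Let integrable_one (c : R) : mu.-integrable Omega (EFin \o (fun=> c)).
Proof. by apply: continuous_integrable => // x; exact: cst_continuous. Qed.

Lemma integrableF (g : 'rV[R]_d -> 'rV[R]_d) : measurable_fun Omega g ->
  mu.-integrable Omega (EFin \o (fun x => enorm (g x) `^ p)) ->
  mu.-integrable Omega (EFin \o (fun x => F (g x))).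
Proof.
move=> mg gi; apply: (dominated_integrableR mO (g := fun x => Lam * (enorm (g x) `^ p + 1))).
- exact: (measurableT_comp mF).
- by apply: integrable_scaleR => //; apply: integrable_addR.
- by move=> x _; rewrite ger0_norm.
Qed.

Lemma integrable_load (v : 'rV[R]_d -> R) : measurable_fun Omega v ->
  mu.-integrable Omega (EFin \o (fun x => `|v x| `^ p)) ->
  mu.-integrable Omega (EFin \o (fun x => f x * v x)).
Proof.
move=> mv vi; have [C C0 CP] := young_small p1 pp' (@ltr01 R).
apply: (dominated_integrableR mO (g := fun x => 1 * `|f x| `^ p' + C * `|v x| `^ p)).
- exact: measurable_funM.
- by apply: integrable_addR => //; apply: integrable_scaleR.
- by move=> x _.
Qed.

Lemma integrable_energy (g : 'rV[R]_d -> 'rV[R]_d) (v : 'rV[R]_d -> R) : measurable_fun Omega g ->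
  mu.-integrable Omega (EFin \o (fun x => enorm (g x) `^ p)) ->
  measurable_fun Omega v ->
  mu.-integrable Omega (EFin \o (fun x => `|v x| `^ p)) ->
  mu.-integrable Omega (EFin \o (fun x => F (g x) - f x * v x)).
Proof.
by move=> mg gi mv vi; apply: integrable_subR => //; [exact: integrableF|exact: integrable_load].
Qed.

Lemma energy_test_function v : test_function Omega v ->
  energy Omega F f v = (\int[mu]_(x in Omega) (F (grad v x) - f x * v x))%:E.
Proof.
move=> tv; have [mv vi mg gi] := test_function_pow_integrable p0 oO bO tv.
have sv := test_function_sobolev0 p0 oO bO tv.
have [mv' vi' mg' gi'] := sobolev_integrable p0 oO sv.1.
rewrite EFin_Rintegral//; last exact: integrable_energy.
apply: ae_eq_integral => //.
- by case/integrableP: (integrable_energy mg' gi' mv vi).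
- by case/integrableP: (integrable_energy mg gi mv vi).
- by apply: filterS (wgrad_test_function oO tv) => x xg Ox /=; rewrite xg.
Qed.

(** A minimizer is the limit of test functions, and the energy is upper
    semicontinuous along this approximation by [convex_growth_upper]: the step
    [t] is fixed first, then the distance of the approximation. Comparing smooth
    functions only makes products, slices and restrictions elementary. *)
Lemma near_minimizer (u : 'rV[R]_d -> R) (e : R) : minimizer p Omega F f u -> 0 < e ->
  exists phi, [/\ test_function Omega phi,
    (\int[mu]_(x in Omega) (`|u x - phi x| `^ p)%:E <= e%:E)%E,
    (\int[mu]_(x in Omega) (enorm (wgrad Omega u x - grad phi x) `^ p)%:E <= e%:E)%E &
    forall v, test_function Omega v ->
      \int[mu]_(x in Omega) (F (grad phi x) - f x * phi x) <=
      \int[mu]_(x in Omega) (F (grad v x) - f x * v x) + e].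
Proof.
move=> [su umin] e0.
have [mu_ ui mg gi] := sobolev_integrable p0 oO su.1.
set g := wgrad Omega u in mg gi *.
have iE := integrable_energy mg gi mu_ ui.
pose V := \int[mu]_(x in Omega) (1 : R).
pose X := \int[mu]_(x in Omega) (enorm (g x) `^ p).
pose Y := \int[mu]_(x in Omega) (`|f x| `^ p').
have V0 : 0 <= V by apply: Rintegral_ge0.
have X0 : 0 <= X by apply: Rintegral_ge0 => x _; exact: powR_ge0.
have Y0 : 0 <= Y by apply: Rintegral_ge0 => x _; exact: powR_ge0.
have Lam0 : 0 <= Lam.
  by have := le_trans (F0 0) (Flam 0); rewrite enorm0 powR0 ?gt_eqF// add0r mulr1.
(* the error is t Lam (V + 2^p (X + t^-p D)) + eta Y + C D, where D is the
   distance to the test function, chosen last *)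
pose a := Lam * (V + 2 `^ p * X).
have a0 : 0 <= a by rewrite mulr_ge0// addr_ge0// mulr_ge0// powR_ge0.
pose t := Num.min 1 (e / 4 / (a + 1)).
have t0 : 0 < t by rewrite lt_min ltr01/= !divr_gt0// ltr_wpDl.
have t01 : 0 < t <= 1 by rewrite t0 ge_min lexx.
have ta : t * a <= e / 4.
  apply: (@le_trans _ _ (t * (a + 1))); first by rewrite ler_wpM2l ?(ltW t0)// lerDl.
  by rewrite -ler_pdivlMr ?ltr_wpDl// ge_min lexx orbT.
pose eta := e / 4 / (Y + 1).
have eta0 : 0 < eta by rewrite !divr_gt0// ltr_wpDl.
have etaY : eta * Y <= e / 4.
  rewrite /eta -mulrA ler_piMr ?divr_ge0 ?(ltW e0)//.
  by rewrite mulrC ler_pdivrMr ?ltr_wpDl// mul1r lerDl.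
have [C C0 CP] := young_small p1 pp' eta0.
pose b := t * Lam * (2 `^ p * t^-1 `^ p).
have b0 : 0 <= b by rewrite !mulr_ge0// ?powR_ge0// ltW.
pose de := Num.min e (e / 4 / (b + C)).
have de0 : 0 < de by rewrite lt_min e0/= !divr_gt0// ltr_wpDl.
have bde : b * de <= e / 4.
  apply: (@le_trans _ _ ((b + C) * de)); first by rewrite ler_wpM2r ?(ltW de0)// lerDl ltW.
  by rewrite mulrC -ler_pdivlMr ?ltr_wpDl// ge_min lexx orbT.
have Cde : C * de <= e / 4.
  apply: (@le_trans _ _ ((b + C) * de)); first by rewrite ler_wpM2r ?(ltW de0)// lerDr.
  by rewrite mulrC -ler_pdivlMr ?ltr_wpDl// ge_min lexx orbT.
have dee : (de%:E <= e%:E)%E by rewrite lee_fin ge_min lexx.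
have [phi [tphi uphi gphi]] := sobolev0_approx p0 su de0.
exists phi; split => //; [exact: le_trans dee|exact: le_trans dee|].
move=> v tv.
have [mphi phii mgphi gphii] := test_function_pow_integrable p0 oO bO tphi.
have iEphi := integrable_energy mgphi gphii mphi phii.
have mdiff : measurable_fun Omega (fun x => g x - grad phi x).
  apply: measurable_fun_rV_on => // i; under eq_fun do rewrite 2!mxE.
  by apply: measurable_funB; apply: (measurableT_comp (measurable_coord i)).
have iD : mu.-integrable Omega (EFin \o (fun x => enorm (g x - grad phi x) `^ p)).
  apply: ge0_integrable_lty; last exact: le_lt_trans gphi (ltry _).
    exact: measurable_enorm_powR.
  by move=> x _; exact: powR_ge0.
have iZ : mu.-integrable Omega (EFin \o (fun x => `|u x - phi x| `^ p)).
  apply: ge0_integrable_lty => //; last exact: le_lt_trans uphi (ltry _).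
  by apply: measurable_norm_powR; exact: measurable_funB.
have De : \int[mu]_(x in Omega) (enorm (g x - grad phi x) `^ p) <= de.
  by rewrite -lee_fin EFin_Rintegral.
have Ze : \int[mu]_(x in Omega) (`|u x - phi x| `^ p) <= de.
  by rewrite -lee_fin EFin_Rintegral.
have Jv : \int[mu]_(x in Omega) (F (g x) - f x * u x) <=
    \int[mu]_(x in Omega) (F (grad v x) - f x * v x).
  rewrite -lee_fin EFin_Rintegral// -energy_test_function//.
  by apply: umin; exact: test_function_sobolev0.
pose E2 := fun x => t * Lam * 1 + t * Lam * 2 `^ p * (enorm (g x) `^ p) +
  b * enorm (g x - grad phi x) `^ p + (eta * `|f x| `^ p' + C * `|u x - phi x| `^ p).
have ic := integrable_one (t * Lam * 1).
have ig := integrable_scaleR mO (t * Lam * 2 `^ p) gi.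
have ib := integrable_scaleR mO b iD.
have ie := integrable_scaleR mO eta fi.
have iC := integrable_scaleR mO C iZ.
have i1 := integrable_addR mO ic ig; have i2 := integrable_addR mO i1 ib.
have i3 := integrable_addR mO ie iC.
have iE2 : mu.-integrable Omega (EFin \o E2) by exact: integrable_addR.
have key : \int[mu]_(x in Omega) (F (grad phi x) - f x * phi x) <=
    \int[mu]_(x in Omega) ((F (g x) - f x * u x) + E2 x).
  apply: le_Rintegral => //; first exact: integrable_addR.
  move=> x Ox; rewrite /E2 mulr1.
  have := convex_growth_upper p0 Fconv F0 Flam (g x) (grad phi x) t01.
  rewrite -[enorm (grad phi x - g x)]enormN opprB.
  have := CP (f x) (u x - phi x); rewrite ler_norml => /andP[_].
  rewrite mulrBr /b; set A := enorm _ `^ p; set B := enorm _ `^ p.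
  rewrite mulrDr mulr1 mulrDr mulrDr !mulrA.
  by lra.
have E2E : \int[mu]_(x in Omega) E2 x = t * Lam * V + t * Lam * 2 `^ p * X +
    b * \int[mu]_(x in Omega) (enorm (g x - grad phi x) `^ p) +
    (eta * Y + C * \int[mu]_(x in Omega) (`|u x - phi x| `^ p)).
  rewrite /E2 (RintegralD mO i2 i3) (RintegralD mO i1 ib) (RintegralD mO ic ig).
  by rewrite (RintegralD mO ie iC) !(RintegralZl _ mO).
apply: (le_trans key); rewrite (RintegralD mO iE iE2) E2E.
have bD : b * \int[mu]_(x in Omega) (enorm (g x - grad phi x) `^ p) <= e / 4.
  by rewrite (le_trans _ bde)// ler_wpM2l.
have CZ : C * \int[mu]_(x in Omega) (`|u x - phi x| `^ p) <= e / 4.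
  by rewrite (le_trans _ Cde)// ler_wpM2l// ltW.
move: Jv bD CZ ta etaY; rewrite /a !mulrDr !mulrA; lra.
Qed.

Variable lam : R.
Hypothesis Flow : forall x, lam * enorm x `^ p <= F x.

(** Comparison with the zero function: Young and Poincare absorb the load, and what
    remains is proportional to the volume when the domain is a cylinder. *)
Lemma energy_bound (CP eta C eps : R) phi : 0 <= eta -> eta * CP <= 2^-1 * lam ->
  (forall a b : R, `|a * b| <= eta * `|a| `^ p + C * `|b| `^ p') ->
  test_function Omega phi ->
  (\int[mu]_(x in Omega) (`|phi x| `^ p)%:E <=
   CP%:E * \int[mu]_(x in Omega) (enorm (grad phi x) `^ p)%:E)%E ->
  (forall v, test_function Omega v ->
      \int[mu]_(x in Omega) (F (grad phi x) - f x * phi x) <=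
      \int[mu]_(x in Omega) (F (grad v x) - f x * v x) + eps) ->
  2^-1 * lam * \int[mu]_(x in Omega) (enorm (grad phi x) `^ p) <=
  \int[mu]_(x in Omega) (F 0 + C * `|f x| `^ p') + eps.
Proof.
move=> eta0 etaCP young tphi poinc min_phi.
have [mp ip mg ig] := test_function_pow_integrable p0 oO bO tphi.
have iE := integrable_energy mg ig mp ip.
have iF0 := integrable_one (F 0).
have iCf : mu.-integrable Omega (EFin \o (fun x => C * `|f x| `^ p')).
  exact: integrable_scaleR.
have iR : mu.-integrable Omega (EFin \o (fun x => F 0 + C * `|f x| `^ p')).
  exact: integrable_addR.
have ilg := integrable_scaleR mO lam ig.
have iep := integrable_scaleR mO eta ip.
set G := \int[mu]_(x in Omega) (enorm (grad phi x) `^ p).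
pose P := \int[mu]_(x in Omega) (`|phi x| `^ p).
have PG : P <= CP * G.
  by rewrite -lee_fin EFinM (EFin_Rintegral mO ip) (EFin_Rintegral mO ig).
have E0 : \int[mu]_(x in Omega) (F (grad phi x) - f x * phi x) <=
    \int[mu]_(x in Omega) F 0 + eps.
  apply: (le_trans (min_phi _ (@test_function0 _ _ Omega))).
  rewrite lerD2r le_eqVlt; apply/orP; left; apply/eqP; apply: eq_Rintegral => x _.
  rewrite mulr0 subr0; congr (F _); apply/rowP => i; rewrite !mxE.
  by rewrite /partial derive_cst.
have E1 : lam * G - eta * P <= \int[mu]_(x in Omega) ((F (grad phi x) - f x * phi x) + C * `|f x| `^ p').
  have -> : lam * G = \int[mu]_(x in Omega) (lam * enorm (grad phi x) `^ p).
    by rewrite RintegralZl.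
  have -> : eta * P = \int[mu]_(x in Omega) (eta * `|phi x| `^ p) by rewrite RintegralZl.
  rewrite -RintegralB//.
  apply: le_Rintegral => //; first exact: integrable_subR.
    exact: integrable_addR.
  move=> x _; have := Flow (grad phi x); have := young (phi x) (f x).
  have := ler_norm (phi x * f x); rewrite [f x * _]mulrC; lra.
move: E1; rewrite RintegralD// => E1.
rewrite RintegralD//.
have := ler_wpM2l eta0 PG.
have G0 : 0 <= G by apply: Rintegral_ge0 => x _; exact: powR_ge0.
have := ler_wpM2r G0 etaCP; rewrite mulrA; move: E0 E1; lra.
Qed.

End test_function_energy.

(** * Inequalities on slices of a cylinder *)

Section sliced_inequalities.
Context (R : realType) (r m : nat) (A : set 'rV[R]_r) (B : set 'rV[R]_m).
Hypotheses (mA : measurable A) (mB : measurable B).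
Local Notation mu1 := (lebesgue_rV R r).
Local Notation mu2 := (lebesgue_rV R m).
Local Notation mu := (lebesgue_rV R (r + m)).

Let mC : measurable (cylinder A B). Proof. exact: measurable_cylinder. Qed.

Let patch_section (h : 'rV[R]_(r + m) -> \bar R) x : A x ->
  (\int[mu2]_y (h \_ (cylinder A B)) (row_mx x y) = \int[mu2]_(y in B) h (row_mx x y))%E.
Proof.
move=> Ax; rewrite [RHS]integral_mkcond; apply: eq_integral => y _.
by rewrite patch_cylinder patchE mem_set.
Qed.

Lemma integrable_section (h : 'rV[R]_(r + m) -> \bar R) :
  mu.-integrable (cylinder A B) h ->
  mu1.-integrable A (fun x => \int[mu2]_(y in B) h (row_mx x y))%E.
Proof.
move=> hi; have := integrable_fubini_F (integrable_glue mA mB hi).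
move=> /(integrableS measurableT mA (@subsetT _ _)); apply: eq_integrable => //.
by move=> x /set_mem Ax; rewrite /fubini_F/= patch_section.
Qed.

Lemma fubini_cylinder_le (h : 'rV[R]_(r + m) -> R) (e : R) :
  (mu1 A < +oo)%E -> mu.-integrable (cylinder A B) (EFin \o h) ->
  (forall x, A x -> (\int[mu2]_(y in B) (h (row_mx x y))%:E <= e%:E)%E) ->
  \int[mu]_(x in cylinder A B) h x <= e * fine (mu1 A).
Proof.
move=> Aoo hi he; rewrite -lee_fin EFin_Rintegral// fubini_cylinder//.
rewrite EFinM fineK ?ge0_fin_numE// -integral_cst//.
apply: le_integral => //; first exact: (integrable_section hi).
  apply: (@measurable_bounded_integrable _ _ _ mu1 (cst e)) => //.
  exists `|e|; split=> [|M eM x _ /=]; [exact: num_real|exact: ltW].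
by move=> x /set_mem; exact: he.
Qed.

Lemma tonelli_cylinder_le (h1 h2 : 'rV[R]_(r + m) -> R) (C : R) : 0 <= C ->
  measurable_fun (cylinder A B) h1 -> measurable_fun (cylinder A B) h2 ->
  (forall x, cylinder A B x -> 0 <= h1 x) -> (forall x, cylinder A B x -> 0 <= h2 x) ->
  (forall x, A x -> (\int[mu2]_(y in B) (h1 (row_mx x y))%:E <=
     C%:E * \int[mu2]_(y in B) (h2 (row_mx x y))%:E)%E) ->
  (\int[mu]_(x in cylinder A B) (h1 x)%:E <=
   C%:E * \int[mu]_(x in cylinder A B) (h2 x)%:E)%E.
Proof.
move=> C0 mh1 mh2 h10 h20 h12.
have msec (h : 'rV[R]_(r + m) -> R) : measurable_fun (cylinder A B) h ->
    (forall x, cylinder A B x -> 0 <= h x) ->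
    measurable_fun A (fun x => \int[mu2]_(y in B) (h (row_mx x y))%:E)%E.
  move=> mh h0; have mp : measurable_fun setT ((EFin \o h) \_ (cylinder A B)).
    by apply: ((measurable_restrictT (EFin \o h) mC).1 _); exact/measurable_EFinP.
  have mg := measurableT_comp mp (@measurable_glue_rV R r m).
  have := measurable_fun_fubini_tonelli_F (m2 := mu2) _ mg.
  move=> H; apply: (@eq_measurable_fun _ _ _ _ A
      (fun x => \int[mu2]_y ((EFin \o h) \_ (cylinder A B)) (row_mx x y))%E).
    by move=> x /set_mem Ax; rewrite patch_section.
  by apply: measurable_funTS; apply: H => z; apply: erestrict_ge0 => x /h0; rewrite lee_fin.
have sec0 (h : 'rV[R]_(r + m) -> R) x : (forall x, cylinder A B x -> 0 <= h x) -> A x ->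
    (0 <= \int[mu2]_(y in B) (h (row_mx x y))%:E)%E.
  by move=> h0 Ax; apply: integral_ge0 => y By; rewrite lee_fin h0// cylinder_row_mx.
rewrite !tonelli_cylinder//; try exact/measurable_EFinP.
rewrite -ge0_integralZl//; [|exact: msec|by move=> x; exact: sec0].
apply: ge0_le_integral => //.
- by move=> x; exact: sec0.
- exact: msec.
- by apply: measurable_funeM; exact: msec.
Qed.

End sliced_inequalities.

(** * Pointwise energy inequalities *)

Section pointwise_inequalities.
Context (R : realType) (r m : nat) (p lam Lam K0 : R) (F : 'rV[R]_(r + m) -> R).
Hypotheses (p0 : 0 < p) (lam0 : 0 < lam) (K00 : 0 < K0)
  (Fconv : forall (x y : 'rV[R]_(r + m)) (t : R), 0 <= t <= 1 ->
     F (t *: x + (1 - t) *: y) <= t * F x + (1 - t) * F y)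
  (Glow : forall xi, lam * enorm (lsubmx xi) `^ p <= F xi - F (row_mx 0 (rsubmx xi)))
  (Gup : forall xi, F xi - F (row_mx 0 (rsubmx xi)) <= Lam * enorm (lsubmx xi) `^ p)
  (Fhalf : forall a b : 'rV[R]_m, F (row_mx 0 (2^-1 *: a + 2^-1 *: b)) <=
     2^-1 * F (row_mx 0 a) + 2^-1 * F (row_mx 0 b) - K0 * enorm (a - b) `^ p).

Let Fconv2 (a b : 'rV[R]_m) (t : R) : 0 <= t <= 1 ->
  F (row_mx 0 (t *: a + (1 - t) *: b)) <= t * F (row_mx 0 a) + (1 - t) * F (row_mx 0 b).
Proof.
move=> t01; have := Fconv (row_mx 0 a) (row_mx 0 b) t01.
by rewrite !scale_row_mx add_row_mx !scaler0 addr0.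
Qed.

(** Where the cut-off is constant, averaging gains a fraction of the full
    energy of the difference: uniform convexity of [F''] controls the
    [x'']-part, and the lower bound on [G] controls the [x']-part. *)
Lemma energy_gain_midpoint (xi : 'rV[R]_(r + m)) (b : 'rV[R]_m) :
  Num.min (2^-1 * lam) K0 / 2 `^ p * enorm (xi - row_mx 0 b) `^ p <=
  F xi - F (2^-1 *: xi + 2^-1 *: row_mx 0 b) + F (row_mx 0 b)
  - F (row_mx 0 (2^-1 *: b + 2^-1 *: rsubmx xi)).
Proof.
set c := Num.min _ _; set a := rsubmx xi.
have h01 : (0 : R) <= 2^-1 <= (1 : R).
  by rewrite invr_ge0 ler0n/= invf_le1 ?ltr0n// ler1n.
have hE : 1 - 2^-1 = 2^-1 :> R by lra.
have := Fconv xi (row_mx 0 b) h01; rewrite hE => F1.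
have := Fhalf b a => F2; have := Glow xi; rewrite -/a => G1.
have c1 : c <= 2^-1 * lam by rewrite ge_min lexx.
have c2 : c <= K0 by rewrite ge_min lexx orbT.
have c0 : 0 <= c by rewrite le_min ?mulr_ge0 ?(ltW lam0) ?(ltW K00).
have p20 : 0 < 2 `^ p :> R by rewrite powR_gt0.
apply: (@le_trans _ _ (c * (enorm (lsubmx xi) `^ p + enorm (b - a) `^ p))).
  rewrite -mulrA ler_wpM2l// mulrC ler_pdivrMr// mulrC.
  have := enorm_blocks_powR (xi - row_mx 0 b) (ltW p0).
  rewrite !linearB/= row_mxKl row_mxKr subr0 -/a.
  by rewrite -(enormN (a - b)) opprB.
have L0 : 0 <= enorm (lsubmx xi) `^ p by exact: powR_ge0.
have D0 : 0 <= enorm (b - a) `^ p by exact: powR_ge0.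
have := ler_wpM2r L0 c1; have := ler_wpM2r D0 c2.
move: F1 F2 G1; rewrite mulrDr; set X := enorm _ `^ p; set Y := enorm _ `^ p.
by rewrite -(mulrA 2^-1); lra.
Qed.

(** For every weight [t] the two convex combinations of [b] and of the
    [x'']-part of [xi] exchange their weights, so convexity of [F''] makes the
    [x'']-contributions nonnegative; only the term of [G] at the competitor
    remains. *)
Lemma energy_loss_bound (xi zeta : 'rV[R]_(r + m)) (b : 'rV[R]_m) (t : R) :
  0 <= t <= 1 -> rsubmx zeta = (1 - t) *: rsubmx xi + t *: b ->
  - (Lam * enorm (lsubmx zeta) `^ p) <=
  F xi - F zeta + F (row_mx 0 b) - F (row_mx 0 ((1 - t) *: b + t *: rsubmx xi)).
Proof.
move=> t01 zE; have G1 := Gup zeta; rewrite zE in G1.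
have := Glow xi; set a := rsubmx xi in G1 *; move=> G0.
have L0 : 0 <= lam * enorm (lsubmx xi) `^ p by rewrite mulr_ge0 ?powR_ge0 ?(ltW lam0).
have C1 := Fconv2 b a t01; have C2 := Fconv2 a b t01.
rewrite addrC in C1; rewrite [(1 - t) *: b + _]addrC.
by move: G1 G0 L0 C1 C2; set X := enorm _ `^ p; lra.
Qed.

End pointwise_inequalities.

(** * Geometric iteration and exponential growth *)

(** Each step reads [E i <= q * E i.+1 + e / (c + k)] with [q = k / (c + k) < 1],
    and the errors sum to at most [e / c]. *)
Lemma geometric_decay (R : realFieldType) (c k e : R) (N : nat) (E : nat -> R) :
  0 < c -> 0 <= k ->
  (forall i, (i < N)%N -> c * E i <= k * (E i.+1 - E i) + e) ->
  0 <= e -> E 0%N <= (k / (c + k)) ^+ N * E N + e / c.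
Proof.
move=> c0 k0; elim: N E => [|N ih] E EP e0.
  by rewrite expr0 mul1r lerDl divr_ge0// ltW.
have ck0 : 0 < c + k by rewrite ltr_wpDr.
have /ih/(_ e0) := fun i (iN : (i < N)%N) => EP i.+1 iN.
set q := k / (c + k); have q0 : 0 <= q by rewrite divr_ge0// ltW.
move=> /(ler_wpM2l q0); rewrite mulrDr mulrA -exprS => E1.
have qe : q * (e / c) + e / (c + k) = e / c.
  by rewrite /q; field; rewrite !gt_eqF.
have : E 0%N <= q * E 1%N + e / (c + k).
  have := EP 0%N (ltn0Sn _) => /= h.
  rewrite -(ler_pM2l ck0) mulrDr /q [_ * (e / _)]mulrC divfK ?gt_eqF//.
  by rewrite mulrA [_ * (k / _)]mulrC divfK ?gt_eqF//; lra.
by move: E1; lra.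
Qed.

Lemma powX_le_expR (R : realType) (n : nat) (b : R) : 0 < b ->
  exists2 C : R, 0 < C & forall x, 0 <= x -> x ^+ n <= C * expR (b * x).
Proof.
move=> b0; exists (n`!%:R / b ^+ n) => [|x x0].
  by rewrite divr_gt0 ?exprn_gt0// ltr0n fact_gt0.
have := pow_le_expR n (mulr_ge0 (ltW b0) x0).
by rewrite exprMn mulrAC ler_pdivlMr ?exprn_gt0// mulrC.
Qed.

(** * The hole-filling inequality *)

Lemma ge0_le_Rintegral_subset d (R : realType) (V U : set 'rV[R]_d) (h : 'rV[R]_d -> R) :
  measurable V -> measurable U -> V `<=` U -> (forall x, 0 <= h x) ->
  (lebesgue_rV R d).-integrable U (EFin \o h) ->
  \int[lebesgue_rV R d]_(x in V) h x <= \int[lebesgue_rV R d]_(x in U) h x.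
Proof.
move=> mV mU VU h0 ih; have ihV := integrableS mU mV VU ih.
rewrite -lee_fin (EFin_Rintegral mV ihV) (EFin_Rintegral mU ih).
apply: ge0_subset_integral => //; first by case/integrableP: ih.
by move=> x _; rewrite lee_fin.
Qed.

Section cylinder_comparison.
Local Opaque smooth test_function partial grad cutoff.
Context (R : realType) (r m : nat) (p p' lam Lam K0 : R)
  (A : set 'rV[R]_r) (B : set 'rV[R]_m)
  (F : 'rV[R]_(r + m) -> R) (f : 'rV[R]_m -> R).
Hypotheses (p1 : 1 < p) (pp' : p^-1 + p'^-1 = 1) (lam0 : 0 < lam) (Lam0 : 0 <= Lam) (K00 : 0 < K0)
  (oA : open A) (bA : bounded_set A) (oB : open B) (bB : bounded_set B)
  (Fconv : forall (x y : 'rV[R]_(r + m)) (t : R), 0 <= t <= 1 ->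
     F (t *: x + (1 - t) *: y) <= t * F x + (1 - t) * F y)
  (F0 : forall xi, 0 <= F xi)
  (Flam : forall xi, F xi <= Lam * (enorm xi `^ p + 1))
  (Glow : forall xi, lam * enorm (lsubmx xi) `^ p <= F xi - F (row_mx 0 (rsubmx xi)))
  (Gup : forall xi, F xi - F (row_mx 0 (rsubmx xi)) <= Lam * enorm (lsubmx xi) `^ p)
  (Fhalf : forall a b : 'rV[R]_m, F (row_mx 0 (2^-1 *: a + 2^-1 *: b)) <=
     2^-1 * F (row_mx 0 a) + 2^-1 * F (row_mx 0 b) - K0 * enorm (a - b) `^ p)
  (fL : inLp p' B f).
Local Notation mu1 := (lebesgue_rV R r).
Local Notation mu2 := (lebesgue_rV R m).
Local Notation mu := (lebesgue_rV R (r + m)).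
Local Notation rs := (@rsubmx R 1 r m).
Local Notation ls := (@lsubmx R 1 r m).

Let p0 : 0 < p. Proof. by rewrite (lt_trans _ p1). Qed.

Let p'0 : 0 < p'. Proof. exact: conjugate_exponent_gt0 p1 pp'. Qed.

Let mA : measurable A. Proof. exact: measurable_rV_open. Qed.
Let mB : measurable B. Proof. exact: measurable_rV_open. Qed.
Let oAB : open (cylinder A B). Proof. exact: open_cylinder. Qed.
Let bAB : bounded_set (cylinder A B). Proof. exact: bounded_cylinder. Qed.
Let mAB : measurable (cylinder A B). Proof. exact: measurable_cylinder. Qed.

Lemma inLp_rsubmx : inLp p' (cylinder A B) (f \o rs).
Proof.
have /(inLpP p'0 mB)[mf fi] := fL; apply/(inLpP p'0 mAB).
have mfr : measurable_fun (cylinder A B) (f \o rs) by exact: measurable_fun_rsubmx.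
split => //.
apply: ge0_integrable_lty => //; first exact: measurable_norm_powR.
rewrite (integral_rsubmx mA mB (h := fun y => (`|f y| `^ p')%:E))//.
  apply: lte_mul_pinfty => //; last exact: integrable_lty.
  by rewrite ge0_fin_numE// bounded_lebesgue_lty.
by case/integrableP: fi.
Qed.

Let F2 (y : 'rV[R]_m) : R := F (row_mx 0 y).

Lemma section_convex (x y : 'rV[R]_m) (t : R) : 0 <= t <= 1 ->
  F2 (t *: x + (1 - t) *: y) <= t * F2 x + (1 - t) * F2 y.
Proof.
move=> t01; have := Fconv (row_mx 0 x) (row_mx 0 y) t01.
by rewrite !scale_row_mx add_row_mx !scaler0 addr0.
Qed.

Lemma section_growth (x : 'rV[R]_m) : F2 x <= Lam * (enorm x `^ p + 1).
Proof. by have := Flam (row_mx 0 x); rewrite enorm_row_0mx. Qed.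

Variables (K CP : R).
Hypotheses (K_ge0 : 0 <= K) (KP : forall s (x : 'rV[R]_r) j, `|partial j (cutoff s) x| <= K)
  (CP0 : 0 < CP) (CPP : forall phi, test_function B phi ->
    (\int[mu2]_(x in B) (`|phi x| `^ p)%:E <=
     CP%:E * \int[mu2]_(x in B) (enorm (grad phi x) `^ p)%:E)%E).

Variables (phi : 'rV[R]_(r + m) -> R) (psi : 'rV[R]_m -> R) (eps : R).
Hypotheses (eps0 : 0 <= eps)
  (tphi : test_function (cylinder A B) phi) (tpsi : test_function B psi)
  (min_phi : forall v, test_function (cylinder A B) v ->
      \int[mu]_(x in cylinder A B) (F (grad phi x) - (f \o rs) x * phi x) <=
      \int[mu]_(x in cylinder A B) (F (grad v x) - (f \o rs) x * v x) + eps)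
  (min_psi : forall z, test_function B z ->
      \int[mu2]_(y in B) (F2 (grad psi y) - f y * psi y) <=
      \int[mu2]_(y in B) (F2 (grad z y) - f y * z y) + eps).

Let sphi : smooth phi. Proof. exact: test_function_smooth tphi. Qed.
Let spsi : smooth psi. Proof. exact: test_function_smooth tpsi. Qed.

Let w x : R := phi x - (psi \o rs) x.
Let spsir : smooth (psi \o rs). Proof. exact: smooth_rsubmx. Qed.
Let sw : smooth w. Proof. exact: smoothB. Qed.

Section hole_filling.
Variable s : R.
Hypothesis sA : cube (s + 1) `<=` A.

(** [v = phi - theta w] competes with [phi] on the cylinder and, slice by slice,
    [z x = psi + theta w] competes with [psi]: the two functions are moved
    towards each other by the same amount, at most to their midpoint. *)
Let theta x : R := 2^-1 * (cutoff s \o ls) x.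
Let v x : R := phi x - theta x * w x.

Let scut : smooth (cutoff s \o ls). Proof. by apply: smooth_lsubmx; exact: smooth_cutoff. Qed.
Let stheta : smooth theta. Proof. exact: (smoothM (smooth_cst _) scut). Qed.

Let theta01 x : 0 <= theta x <= 1.
Proof.
have := cutoff_ge0 s (ls x); have := cutoff_le1 s (ls x).
by rewrite /theta/=; move=> ? ?; apply/andP; split; lra.
Qed.

Let Q : set 'rV[R]_r := cube (s + 1).
Let q : set 'rV[R]_r := cube s.

Let mQ : measurable Q. Proof. exact: measurable_cube. Qed.
Let mq : measurable q. Proof. exact: measurable_cube. Qed.

Let theta_out x : ~ Q (ls x) -> theta x = 0.
Proof.
move=> /existsNP[j /negP]; rewrite -ltNge => /ltW xj.
by rewrite /theta/= (cutoff0 xj) mulr0.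
Qed.

Let theta_in x : q (ls x) -> theta x = 2^-1.
Proof.
move=> qx; rewrite /theta/= cutoff1 ?mulr1// => i.
by rewrite (le_trans (qx i))// lerDl invr_ge0.
Qed.

Let grad_theta x : grad theta x = row_mx (2^-1 *: grad (cutoff s) (ls x)) 0.
Proof.
by rewrite /theta gradZ// grad_lsubmx scale_row_mx scaler0.
Qed.

Let twpsi : test_function (cylinder A B) (fun x => theta x * (psi \o rs) x).
Proof.
have [L [cL LB psi0]] := test_function_support tpsi.
pose S := @glue_rV R r m @` (Q `*` L).
have cS : compact S.
  rewrite (_ : S = [set x | Q (ls x) /\ L (rs x)]); last first.
    apply/seteqP; split=> [_ [[x y] [Qx Ly] <-]|x [Qx Lx]].
      by rewrite /= /glue_rV/= row_mxKl row_mxKr.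
    by exists (ls x, rs x) => //; rewrite /glue_rV/= hsubmxK.
  apply: bounded_closed_compact.
    apply: (@sub_bounded_set _ _ _ (cylinder Q L)) => //.
    by apply: bounded_cylinder; [exact: bounded_cube|exact: compact_bounded].
  apply: closedI; apply: preimage_closed.
  - by move=> x _; exact: continuous_lsubmx.
  - by apply: compact_closed; [exact: norm_hausdorff|exact: compact_cube].
  - by move=> x _; exact: continuous_rsubmx.
  - by apply: compact_closed => //; exact: norm_hausdorff.
apply: (test_function_in_compact _ cS).
- exact: smoothM.
- move=> _ [[x y] [Qx Ly] <-]; rewrite /glue_rV/= cylinder_row_mx.
  by split; [exact: sA|exact: LB].
- move=> x Sx; have [Qx|Qx] := pselect (Q (ls x)); last by rewrite theta_out// mul0r.
  rewrite /= psi0 ?mulr0// => Lx; apply: Sx; exists (ls x, rs x) => //.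
  by rewrite /glue_rV/= hsubmxK.
Qed.

Let tthw : test_function (cylinder A B) (fun x => theta x * w x).
Proof.
rewrite (_ : (fun x => _) = fun x => theta x * phi x - theta x * (psi \o rs) x).
  by apply: test_functionB; [exact: (test_functionMl stheta tphi)|exact: twpsi].
by apply/funext => x; rewrite /w mulrBr.
Qed.

Let tv : test_function (cylinder A B) v. Proof. exact: (test_functionB tphi tthw). Qed.

Let a x := rs (grad phi x).
Let b x := grad psi (rs x).
Let l x := ls (grad phi x).

Let grad_w x : grad w x = grad phi x - row_mx 0 (b x).
Proof. by rewrite /w gradB// grad_rsubmx. Qed.

Let grad_v x : grad v x = grad phi x - (theta x *: grad w x + w x *: grad theta x).
Proof.
have st : smooth (fun x => theta x * w x) by exact: smoothM.
by rewrite /v gradB// gradM.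
Qed.

Let block_combination (X : 'rV[R]_(r + m)) (g : 'rV[R]_r) (c : 'rV[R]_m) (t k : R) :
  rs (X - (t *: (X - row_mx 0 c) + k *: row_mx g 0)) = (1 - t) *: rs X + t *: c /\
  ls (X - (t *: (X - row_mx 0 c) + k *: row_mx g 0)) = (1 - t) *: ls X + - (k *: g).
Proof.
rewrite -{1 2 4 5}[X]hsubmxK !opp_row_mx !add_row_mx !scale_row_mx !add_row_mx opp_row_mx.
rewrite add_row_mx row_mxKr row_mxKl !oppr0 !addr0 !scaler0 !addr0; split.
  by rewrite scalerBr opprB scalerBl scale1r [t *: c - _]addrC addrA.
by rewrite opprD addrA scalerBl scale1r.
Qed.

Let rs_grad_v x : rs (grad v x) = (1 - theta x) *: a x + theta x *: b x.
Proof.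
rewrite grad_v grad_w grad_theta.
by have [-> _] := block_combination (grad phi x) (2^-1 *: grad (cutoff s) (ls x))
  (b x) (theta x) (w x).
Qed.

Let ls_grad_v x : ls (grad v x) =
  (1 - theta x) *: l x + - (w x *: (2^-1 *: grad (cutoff s) (ls x))).
Proof.
rewrite grad_v grad_w grad_theta.
by have [_ ->] := block_combination (grad phi x) (2^-1 *: grad (cutoff s) (ls x))
  (b x) (theta x) (w x).
Qed.

Let z x y : R := psi y - theta (row_mx x 0) * (psi y - phi (row_mx x y)).

Let theta_row x y : theta (row_mx x y) = theta (row_mx x 0).
Proof. by rewrite /theta/= !row_mxKl. Qed.

Let tz x : test_function B (z x).
Proof.
apply: (test_functionB tpsi); apply: test_functionMl; first exact: smooth_cst.
by apply: (test_functionB tpsi); exact: test_function_row_mxr tphi.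
Qed.

Let zE x y : z x y = psi y + theta (row_mx x y) * w (row_mx x y).
Proof. by rewrite /z (theta_row x y) /w/= row_mxKr -mulrN opprB. Qed.

Let grad_z x y : grad (z x) y =
  (1 - theta (row_mx x y)) *: b (row_mx x y) + theta (row_mx x y) *: a (row_mx x y).
Proof.
have sp : smooth (fun y => phi (row_mx x y)) by exact: smooth_row_mxr.
have spp := smoothB spsi sp.
rewrite /z (gradB _ spsi (smoothM (smooth_cst _) spp)) gradZ // (gradB _ spsi sp) grad_row_mxr (theta_row x y) /b row_mxKr -/(a _).
by rewrite scalerBr scalerBl scale1r opprB [X in _ + X]addrC addrA.
Qed.

(** The sum of the pointwise excesses [DA] of [phi] over [v] and [DB] of [psi]
    over [z x]: the terms in [f] cancel because [f] depends on [x''] only. *)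
Let D x : R := F (grad phi x) - F (grad v x) + F2 (b x)
  - F2 ((1 - theta x) *: b x + theta x *: a x).

Let DA x : R := (F (grad phi x) - (f \o rs) x * phi x)
  - (F (grad v x) - (f \o rs) x * v x).

Let DB x : R := F2 (b x) - F2 ((1 - theta x) *: b x + theta x *: a x)
  + (f \o rs) x * (theta x * w x).

Let DE x : D x = DA x + DB x.
Proof. by rewrite /D /DA /DB /v; ring. Qed.

Let U : set 'rV[R]_(r + m) := cylinder Q B.
Let U0 : set 'rV[R]_(r + m) := cylinder q B.
Let U1 : set 'rV[R]_(r + m) := cylinder (Q `\` q) B.

Let qQ : q `<=` Q.
Proof. by move=> x qx i; rewrite (le_trans (qx i))// lerDl. Qed.

Let UE : U = U0 `|` U1.
Proof.
apply/seteqP; split=> [x [Qx Bx]|x [[qx Bx]|[[Qx _] Bx]]]; [|by split => //; exact: qQ|by []].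
by have [qx|qx] := pselect (q (ls x)); [left|right].
Qed.

Let mU : measurable U. Proof. exact: measurable_cylinder. Qed.
Let mU0 : measurable U0. Proof. exact: measurable_cylinder. Qed.
Let mU1 : measurable U1. Proof. by apply: measurable_cylinder => //; exact: measurableD. Qed.
Let bU : bounded_set U. Proof. by apply: bounded_cylinder => //; exact: bounded_cube. Qed.

Let UAB : U `<=` cylinder A B. Proof. by move=> x [Qx Bx]; split => //; exact: sA. Qed.
Let U0U : U0 `<=` U. Proof. by rewrite UE; exact: subsetUl. Qed.
Let U1U : U1 `<=` U. Proof. by rewrite UE; exact: subsetUr. Qed.

Let disjU : [disjoint U0 & U1].
Proof. by apply/disj_setPS => x [[qx _] [[_ nqx] _]]. Qed.

Let cF : continuous F. Proof. exact: convex_growth_continuous p0 Fconv F0 Flam. Qed.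

Let cF2 : continuous F2.
Proof.
move=> y; apply: (@continuous_comp _ _ _ (fun y : 'rV[R]_m => row_mx 0 y) F).
  exact: continuous_row_mxr.
exact: cF.
Qed.

Let integrable_F2 (h : 'rV[R]_(r + m) -> 'rV[R]_m) :
  (forall i, smooth (fun x => h x ord0 i)) ->
  mu.-integrable U (EFin \o (fun x => F2 (h x))).
Proof.
move=> sh; apply: continuous_integrable => // x.
apply: (@continuous_comp _ _ _ h F2); last exact: cF2.
by apply: continuous_rV => i; exact: (smooth_continuous (sh i)).
Qed.

Let iDA : mu.-integrable (cylinder A B) (EFin \o DA).
Proof.
have E u : test_function (cylinder A B) u ->
    mu.-integrable (cylinder A B) (EFin \o (fun x => F (grad u x) - (f \o rs) x * u x)).
  move=> tu; have [mu_ ui mg gi] := test_function_pow_integrable p0 oAB bAB tu.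
  exact: (integrable_energy p1 pp' oAB bAB Fconv F0 Flam inLp_rsubmx).
by apply: integrable_subR => //; exact: E.
Qed.

Let iDB : mu.-integrable U (EFin \o DB).
Proof.
apply: integrable_addR => //.
  apply: integrable_subR => //; apply: integrable_F2 => i; rewrite /b /a.
    under eq_fun do rewrite mxE.
    by apply: smooth_rsubmx; exact: smooth_partial.
  under eq_fun do rewrite !mxE.
  apply: smoothD.
    apply: (smoothM (smoothB (smooth_cst _) stheta)).
    by apply: smooth_rsubmx; exact: smooth_partial.
  by apply: (smoothM stheta); exact: smooth_partial.
apply: (@integrableS _ _ _ _ (cylinder A B)) => //.
have [mt ti _ _] := test_function_pow_integrable p0 oAB bAB tthw.
exact: (integrable_load p1 pp' oAB inLp_rsubmx).
Qed.

Let iD : mu.-integrable U (EFin \o D).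
Proof.
rewrite (_ : D = fun x => DA x + DB x); last by apply/funext => x; exact: DE.
by apply: integrable_addR => //; exact: integrableS iDA.
Qed.

Let integral_DA : \int[mu]_(x in U) DA x <= eps.
Proof.
have E u : test_function (cylinder A B) u ->
    mu.-integrable (cylinder A B) (EFin \o (fun x => F (grad u x) - (f \o rs) x * u x)).
  move=> tu; have [mu_ ui mg gi] := test_function_pow_integrable p0 oAB bAB tu.
  exact: (integrable_energy p1 pp' oAB bAB Fconv F0 Flam inLp_rsubmx).
rewrite (_ : \int[mu]_(x in U) DA x = \int[mu]_(x in cylinder A B) DA x); last first.
  rewrite Rintegral_mkcond [RHS]Rintegral_mkcond; apply: eq_Rintegral => x _.
  rewrite !patchE; case: ifPn => [/set_mem/UAB Ux|]; first by rewrite mem_set.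
  rewrite notin_setE => Ux; case: ifPn => // /set_mem [Ax Bx].
  have Qx : ~ Q (ls x) by move=> Qx; apply: Ux.
  have tx := theta_out Qx.
  rewrite /DA /v tx mul0r subr0 (_ : grad v x = grad phi x) ?subrr//.
  by rewrite grad_v tx scale0r add0r grad_theta grad_cutoff0// scaler0 row_mx0 scaler0 subr0.
rewrite /DA RintegralB//; [|exact: E|exact: E].
by rewrite lerBlDl; exact: min_phi.
Qed.

(** Near minimality of [psi] is used on each slice, and integrated over the cube. *)
Let integral_DB : \int[mu]_(x in U) DB x <= eps * fine (mu1 Q).
Proof.
have F2l := section_growth; have F2c := section_convex.
have F20 y : 0 <= F2 y by exact: F0.
have E u : test_function B u ->
    mu2.-integrable B (EFin \o (fun y => F2 (grad u y) - f y * u y)).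
  move=> tu; have [mu_ ui mg gi] := test_function_pow_integrable p0 oB bB tu.
  exact: (integrable_energy p1 pp' oB bB F2c F20 F2l fL).
apply: fubini_cylinder_le => //.
  by apply: bounded_lebesgue_lty => //; exact: bounded_cube.
move=> x Qx.
rewrite (eq_integral (fun y => ((F2 (grad psi y) - f y * psi y) -
    (F2 (grad (z x) y) - f y * z x y))%:E)); last first.
  by move=> y _; rewrite /DB -grad_z /b /= !row_mxKr zE; congr EFin; ring.
rewrite -EFin_Rintegral; last by apply: integrable_subR => //; exact: E.
rewrite lee_fin RintegralB//; [|exact: E|exact: E].
by rewrite lerBlDl; exact: min_psi.
exact: mB. Qed.

Let c : R := Num.min (2^-1 * lam) K0 / 2 `^ p.
Let C2 : R := Lam * 2 `^ p * (1 + (r%:R * K) `^ p).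

Let core x : U0 x -> c * enorm (grad w x) `^ p <= D x.
Proof.
move=> [qx Bx]; have tx := theta_in qx.
have hE : 1 - 2^-1 = 2^-1 :> R by lra.
have vE : grad v x = 2^-1 *: grad phi x + 2^-1 *: row_mx 0 (b x).
  rewrite grad_v grad_w grad_theta grad_cutoff1// scaler0 row_mx0 scaler0 addr0 tx.
  by rewrite scalerBr opprB addrCA addrC -[X in X - _]scale1r -scalerBl hE.
rewrite /D vE tx hE grad_w.
exact: energy_gain_midpoint p0 lam0 K00 Fconv Glow Fhalf (grad phi x) (b x).
Qed.

Let annulus x : - (C2 * (enorm (grad w x) `^ p + `|w x| `^ p)) <= D x.
Proof.
have := energy_loss_bound lam0 Fconv Glow Gup (theta01 x) (rs_grad_v x).
apply: le_trans; rewrite lerN2 /C2 -!mulrA ler_wpM2l// ls_grad_v.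
apply: (le_trans (enormD_powR _ _ (ltW p0))); rewrite ler_wpM2l ?powR_ge0//.
have lw : enorm ((1 - theta x) *: l x) `^ p <= enorm (grad w x) `^ p.
  apply: ge0_ler_powR; rewrite ?nnegrE ?enorm_ge0 ?(ltW p0)//.
  rewrite enormZ; have /andP[t0 t1] := theta01 x.
  apply: (@le_trans _ _ (1 * enorm (l x))).
    by rewrite ler_wpM2r ?enorm_ge0// ger0_norm ?subr_ge0// gerBl.
  rewrite mul1r (_ : l x = ls (grad w x)) ?enorm_lsubmx//.
  by rewrite grad_w linearB/= row_mxKl subr0.
have ww : enorm (- (w x *: (2^-1 *: grad (cutoff s) (ls x)))) `^ p <=
    (r%:R * K) `^ p * `|w x| `^ p.
  rewrite enormN !enormZ -powRM ?mulr_ge0//.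
  apply: ge0_ler_powR; rewrite ?nnegrE ?mulr_ge0 ?enorm_ge0 ?(ltW p0)//.
  rewrite mulrC ler_wpM2r// ger0_norm ?invr_ge0//.
  apply: (@le_trans _ _ (1 * enorm (grad (cutoff s) (ls x)))).
    by rewrite ler_wpM2r ?enorm_ge0// invf_le1// ler1n.
  by rewrite mul1r enorm_le_coord// => i; rewrite mxE.
have W0 : 0 <= `|w x| `^ p by exact: powR_ge0.
have G0 : 0 <= enorm (grad w x) `^ p by exact: powR_ge0.
have k0 : 0 <= (r%:R * K) `^ p by exact: powR_ge0.
rewrite mulrDl mul1r; apply: (le_trans (lerD lw ww)).
rewrite mulrDr; have := mulr_ge0 k0 G0; lra.
Qed.

Let absorb (k E1 W1 E0 e I0 I1 I : R) : E0 <= I0 -> - k * (E1 + W1) <= I1 -> I <= e ->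
  I = I0 + I1 -> k * W1 <= k * (CP * E1) -> E0 <= k * (1 + CP) * E1 + e.
Proof.
have -> : k * (1 + CP) * E1 = k * E1 + k * (CP * E1) by ring.
rewrite mulNr mulrDr; lra.
Qed.

(** Gain on the inner cube against loss on the annulus. On each slice [w] vanishes
    near the boundary of [B], so the Poincare inequality in [x''] absorbs the
    zero order term of the loss into the energy of [w] on the annulus. Moving the
    annulus to the left hand side fills the hole. *)
Lemma hole_filling :
  c * \int[mu]_(x in cylinder (cube s) B) (enorm (grad w x) `^ p) <=
  C2 * (1 + CP) * (\int[mu]_(x in cylinder (cube (s + 1)) B) (enorm (grad w x) `^ p) -
    \int[mu]_(x in cylinder (cube s) B) (enorm (grad w x) `^ p)) +
  eps * (1 + fine (mu1 (cube (s + 1)))).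
Proof.
rewrite -/U0 -/U; set E0 := \int[mu]_(x in U0) _.
pose E1 := \int[mu]_(x in U1) (enorm (grad w x) `^ p).
pose W1 := \int[mu]_(x in U1) (`|w x| `^ p).
have ig : mu.-integrable U (EFin \o (fun x => enorm (grad w x) `^ p)).
  exact: grad_powR_integrable.
have iw : mu.-integrable U (EFin \o (fun x => `|w x| `^ p)).
  by apply: continuous_powR_integrable; [exact: mU|exact: bU|exact: ltW|exact: smooth_continuous].
have igS V : measurable V -> V `<=` U ->
    mu.-integrable V (EFin \o (fun x => enorm (grad w x) `^ p)).
  by move=> mV VU; exact: integrableS ig.
have iwS V : measurable V -> V `<=` U -> mu.-integrable V (EFin \o (fun x => `|w x| `^ p)).
  by move=> mV VU; exact: integrableS iw.
have iDS V : measurable V -> V `<=` U -> mu.-integrable V (EFin \o D).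
  by move=> mV VU; exact: integrableS iD.
have -> : \int[mu]_(x in U) (enorm (grad w x) `^ p) - E0 = E1.
  rewrite UE Rintegral_setU//; last by rewrite -UE.
  by rewrite addrAC subrr add0r.
have WE : W1 <= CP * E1.
  rewrite -lee_fin EFinM (EFin_Rintegral mU1 (iwS _ mU1 U1U)) (EFin_Rintegral mU1 (igS _ mU1 U1U)).
  apply: (@le_trans _ _ (CP%:E * \int[mu]_(x in U1) (enorm (rs (grad w x)) `^ p)%:E)%E).
    apply: tonelli_cylinder_le => //.
    - exact: measurableD.
    - exact: ltW.
    - by apply/measurable_EFinP; case/integrableP: (iwS _ mU1 U1U).
    - apply: measurable_funTS; apply: measurable_enorm_powR.
      exact: (measurableT_comp (@measurable_rsubmx R r m) (measurable_grad sw)).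
    - by move=> x _; exact: powR_ge0.
    move=> x [Qx _].
    have twx : test_function B (fun y => w (row_mx x y)).
      rewrite (_ : (fun y => _) = fun y => phi (row_mx x y) - psi y).
        by apply: (fun h => test_functionB h tpsi); exact: test_function_row_mxr tphi.
      by apply/funext => y; rewrite /w/= row_mxKr.
    apply: (le_trans (CPP twx)); apply: lee_wpmul2l; first by rewrite lee_fin ltW.
    rewrite le_eqVlt; apply/orP; left; apply/eqP; apply: eq_integral => y _; congr (_ `^ p)%:E.
    by rewrite grad_row_mxr.
  apply: lee_wpmul2l; first by rewrite lee_fin ltW.
  apply: ge0_le_integral => //.
  - by move=> x _; rewrite lee_fin powR_ge0.
  - apply/measurable_EFinP; apply: measurable_funTS; apply: measurable_enorm_powR.
    exact: (measurableT_comp (@measurable_rsubmx R r m) (measurable_grad sw)).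
  - by case/integrableP: (igS _ mU1 U1U).
  - move=> x _; rewrite lee_fin; apply: ge0_ler_powR; rewrite ?nnegrE ?enorm_ge0 ?(ltW p0)//.
    exact: enorm_rsubmx.
have c0E : c * E0 <= \int[mu]_(x in U0) D x.
  rewrite -RintegralZl//; last exact: igS.
  apply: le_Rintegral => //; [|exact: iDS].
  by apply: integrable_scaleR => //; exact: igS.
have isum : mu.-integrable U1 (EFin \o (fun x => enorm (grad w x) `^ p + `|w x| `^ p)).
  by apply: integrable_addR => //; [exact: igS|exact: iwS].
have c1E : - C2 * (E1 + W1) <= \int[mu]_(x in U1) D x.
  rewrite -RintegralD//; [|exact: igS|exact: iwS].
  rewrite -RintegralZl//; apply: le_Rintegral => //; [|exact: iDS|].
    exact: integrable_scaleR.
  by move=> x _; rewrite mulNr; exact: annulus.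
have Dsum : \int[mu]_(x in U) D x <= eps * (1 + fine (mu1 Q)).
  have -> : \int[mu]_(x in U) D x = \int[mu]_(x in U) (DA x + DB x).
    by apply: eq_Rintegral => x _; exact: DE.
  rewrite RintegralD//; last exact: integrableS iDA.
  by rewrite mulrDr mulr1; apply: lerD; [exact: integral_DA|exact: integral_DB].
have DU : \int[mu]_(x in U) D x = \int[mu]_(x in U0) D x + \int[mu]_(x in U1) D x.
  by rewrite UE Rintegral_setU// -UE.
have C20 : 0 <= C2.
  by rewrite /C2 !mulr_ge0// ?powR_ge0// addr_ge0// powR_ge0.
exact: absorb c0E c1E Dsum DU (ler_wpM2l C20 WE).
Qed.

End hole_filling.

(** * Energy of the difference on a cylinder *)

Section total_energy.
Variables (eta C : R).
Hypotheses (Flow : forall xi, lam * enorm xi `^ p <= F xi)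
  (eta0 : 0 <= eta) (etaCP : eta * CP <= 2^-1 * lam) (C0 : 0 <= C)
  (young : forall a b : R, `|a * b| <= eta * `|a| `^ p + C * `|b| `^ p').

Let a := fine (mu1 A).
Let T := \int[mu2]_(y in B) (F 0 + C * `|f y| `^ p').

Lemma fine_integral_rsubmx (h : 'rV[R]_m -> R) : mu2.-integrable B (EFin \o h) ->
  (forall y, 0 <= h y) ->
  \int[mu]_(x in cylinder A B) h (rs x) = a * \int[mu2]_(y in B) h y.
Proof.
move=> hi h0; rewrite /Rintegral (integral_rsubmx mA mB (h := fun y => (h y)%:E)).
- rewrite fineM//; last exact: (integrable_fin_num mB hi).
  by rewrite ge0_fin_numE//; exact: bounded_lebesgue_lty.
- by case/integrableP: hi.
- by move=> y _; rewrite lee_fin.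
Qed.

Let ipsi : mu2.-integrable B (EFin \o (fun y => enorm (grad psi y) `^ p)).
Proof. by have [] := test_function_pow_integrable p0 oB bB tpsi. Qed.

Let iphi : mu.-integrable (cylinder A B) (EFin \o (fun x => enorm (grad phi x) `^ p)).
Proof. by have [] := test_function_pow_integrable p0 oAB bAB tphi. Qed.

Let iw : mu.-integrable (cylinder A B) (EFin \o (fun x => enorm (grad w x) `^ p)).
Proof. exact: grad_powR_integrable. Qed.

Let iT : mu2.-integrable B (EFin \o (fun y => F 0 + C * `|f y| `^ p')).
Proof.
have /(inLpP p'0 mB)[mf fi] := fL; apply: integrable_addR => //.
  by apply: continuous_integrable => // x; exact: cst_continuous.
exact: integrable_scaleR.
Qed.

Let T_phi : 2^-1 * lam * \int[mu]_(x in cylinder A B) (enorm (grad phi x) `^ p) <= a * T + eps.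
Proof.
have fr := inLp_rsubmx.
rewrite /T -(fine_integral_rsubmx iT); last first.
  by move=> y; rewrite addr_ge0 ?mulr_ge0 ?powR_ge0.
apply: (energy_bound p1 pp' oAB bAB Fconv F0 Flam fr Flow eta0 etaCP young tphi) => //.
have [mp ip mg ig] := test_function_pow_integrable p0 oAB bAB tphi.
have mr : measurable_fun setT (fun x => enorm (rs (grad phi x)) `^ p).
  apply: measurable_enorm_powR.
  exact: (measurableT_comp (@measurable_rsubmx R r m) (measurable_grad sphi)).
apply: (@le_trans _ _ (CP%:E * \int[mu]_(x in cylinder A B) (enorm (rs (grad phi x)) `^ p)%:E)%E).
  apply: tonelli_cylinder_le => //.
  - exact: ltW.
  - exact: measurable_norm_powR.
  - exact: measurable_funTS.
  - by move=> x _; exact: powR_ge0.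
  move=> x Ax.
  have tx : test_function B (fun y => phi (row_mx x y)) by exact: test_function_row_mxr tphi.
  apply: (le_trans (CPP tx)).
  apply: lee_wpmul2l; first by rewrite lee_fin ltW.
  rewrite le_eqVlt; apply/orP; left; apply/eqP; apply: eq_integral => y _; congr (_ `^ p)%:E.
  by rewrite grad_row_mxr.
apply: lee_wpmul2l; first by rewrite lee_fin ltW.
apply: ge0_le_integral => //.
- by move=> x _; rewrite lee_fin powR_ge0.
- by apply/measurable_EFinP; exact: measurable_funTS.
- by case/integrableP: ig.
- move=> x _; rewrite lee_fin; apply: ge0_ler_powR; rewrite ?nnegrE ?enorm_ge0 ?(ltW p0)//.
  exact: enorm_rsubmx.
Qed.

Let T_psi : 2^-1 * lam * \int[mu2]_(y in B) (enorm (grad psi y) `^ p) <= T + eps.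
Proof.
have Flow2 y : lam * enorm y `^ p <= F (row_mx 0 y).
  by have := Flow (row_mx 0 y); rewrite enorm_row_0mx.
have := energy_bound p1 pp' oB bB section_convex (fun y => F0 _)
  section_growth fL Flow2 eta0 etaCP young tpsi (CPP tpsi) min_psi.
by rewrite /F2 row_mx0.
Qed.

(** Both energies are at most proportional to the volume of [A], by the comparison
    with zero on the cylinder and on [B]. *)
Lemma difference_energy_bound :
  \int[mu]_(x in cylinder A B) (enorm (grad w x) `^ p) <=
  2 `^ p * (2 / lam) * (2 * a * T + (1 + a) * eps).
Proof.
have a0 : 0 <= a by apply: fine_ge0.
have ir : mu.-integrable (cylinder A B) (EFin \o (fun x => enorm (grad psi (rs x)) `^ p)).
  have -> : (fun x => enorm (grad psi (rs x)) `^ p) = (fun x => enorm (grad (psi \o rs) x) `^ p).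
    by apply/funext => x; rewrite grad_rsubmx enorm_row_0mx.
  exact: grad_powR_integrable.
have p20 : 0 <= 2 `^ p :> R by exact: powR_ge0.
have JE : \int[mu]_(x in cylinder A B) (enorm (grad psi (rs x)) `^ p) =
    a * \int[mu2]_(y in B) (enorm (grad psi y) `^ p).
  apply: (fine_integral_rsubmx (h := fun y => enorm (grad psi y) `^ p) ipsi) => y.
  exact: powR_ge0.
apply: (@le_trans _ _ (2 `^ p * (\int[mu]_(x in cylinder A B) (enorm (grad phi x) `^ p) +
    \int[mu]_(x in cylinder A B) (enorm (grad psi (rs x)) `^ p)))).
  have iS := integrable_addR mAB iphi ir.
  have <- := RintegralD mAB iphi ir; have <- := RintegralZl (2 `^ p) mAB iS.
  apply: (le_Rintegral mAB iw (integrable_scaleR mAB _ iS)) => x _.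
  rewrite (_ : grad w x = grad phi x + - grad (psi \o rs) x); last exact: gradB.
  apply: (le_trans (enormD_powR _ _ (ltW p0))).
  by rewrite enormN grad_rsubmx ?enorm_row_0mx.
rewrite JE -mulrA ler_wpM2l//.
have l2 : 0 < 2 / lam by rewrite divr_gt0.
have lK (x y : R) : 2^-1 * lam * x <= y -> x <= 2 / lam * y.
  move=> /(ler_wpM2l (ltW l2)); rewrite !mulrA.
  by rewrite (_ : 2 / lam / 2 * lam = 1) ?mul1r//; field; rewrite gt_eqF.
have h1 := lK _ _ T_phi; have h2 := ler_wpM2l a0 (lK _ _ T_psi).
apply: (le_trans (lerD h1 h2)).
rewrite le_eqVlt; apply/orP; left; apply/eqP; by ring.
Qed.

Let c := Num.min (2^-1 * lam) K0 / 2 `^ p.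
Let k := Lam * 2 `^ p * (1 + (r%:R * K) `^ p) * (1 + CP).

(** When no step of the iteration fits ([N = 0]) the bound is mere inclusion, which
    covers the values of the length for which the cylinder is still short. *)
Lemma local_energy_decay (D : set 'rV[R]_r) (s : R) (N : nat) : measurable D -> D `<=` A ->
  0 <= s -> D `<=` cube s -> N = 0%N \/ cube (s + N%:R) `<=` A ->
  \int[mu]_(x in cylinder D B) (enorm (grad w x) `^ p) <=
  (k / (c + k)) ^+ N * \int[mu]_(x in cylinder A B) (enorm (grad w x) `^ p) + eps * (1 + a) / c.
Proof.
move=> mD DA s0 Ds hN.
have a0 : 0 <= a by apply: fine_ge0.
have w0 x : 0 <= enorm (grad w x) `^ p by exact: powR_ge0.
have c0 : 0 < c by rewrite divr_gt0 ?powR_gt0// lt_min K00 mulr_gt0.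
have k0 : 0 <= k.
  by rewrite /k !mulr_ge0 ?powR_ge0// ?addr_ge0 ?powR_ge0// ltW.
have cylS (V : set 'rV[R]_r) : measurable V -> V `<=` A ->
    \int[mu]_(x in cylinder V B) (enorm (grad w x) `^ p) <=
    \int[mu]_(x in cylinder A B) (enorm (grad w x) `^ p).
  move=> mV VA; apply: ge0_le_Rintegral_subset => //; first exact: measurable_cylinder.
  by move=> x [Vx Bx]; split => //; exact: VA.
have e0 : 0 <= eps * (1 + a) by rewrite mulr_ge0// addr_ge0.
case: hN => [N0|NA].
  by rewrite N0 expr0 mul1r (le_trans (cylS D mD DA))// lerDl divr_ge0// ltW.
pose E i := \int[mu]_(x in cylinder (cube (s + i%:R)) B) (enorm (grad w x) `^ p).
have cubeA i : (i <= N)%N -> cube (s + i%:R) `<=` A.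
  by move=> iN; apply: subset_trans NA => x xi j; rewrite (le_trans (xi j))// lerD2l ler_nat.
have EP i : (i < N)%N -> c * E i <= k * (E i.+1 - E i) + eps * (1 + a).
  move=> iN; have si : 0 <= s + i%:R by rewrite addr_ge0.
  have sA : cube (s + i%:R + 1) `<=` A by rewrite -addrA natr1; exact: cubeA.
  have := hole_filling sA.
  rewrite -/c -/k -addrA natr1 -/(E i) -/(E i.+1) => /le_trans; apply.
  rewrite lerD2l ler_wpM2l// lerD2l fine_le//.
  - by rewrite lebesgue_cube// addr_ge0.
  - by rewrite ge0_fin_numE//; exact: bounded_lebesgue_lty.
  - by apply: le_measure; rewrite ?inE//; [exact: measurable_cube|exact: cubeA].
have mDB : measurable (cylinder D B) by exact: measurable_cylinder.
have mQ : measurable (cylinder (cube (s + 0%:R) : set 'rV[R]_r) B).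
  by apply: measurable_cylinder; [exact: measurable_cube|exact: mB].
have DQ : cylinder D B `<=` cylinder (cube (s + 0%:R)) B.
  by move=> x [Dx Bx]; split; [rewrite addr0; exact: Ds|exact: Bx].
have QA : cylinder (cube (s + 0%:R)) B `<=` cylinder A B.
  by move=> x [Qx Bx]; split; [exact: (cubeA 0%N)|exact: Bx].
have DE0 := ge0_le_Rintegral_subset mDB mQ DQ w0 (integrableS mAB mQ QA iw).
apply: (le_trans DE0); apply: (le_trans (geometric_decay c0 k0 EP e0)); rewrite lerD2r.
apply: ler_wpM2l; first by rewrite exprn_ge0// divr_ge0// addr_ge0// ltW.
by apply: cylS; [exact: measurable_cube|exact: NA].
Qed.

End total_energy.

End cylinder_comparison.

(** * Back to weak gradients *)

Section weak_gradient_difference.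
Local Opaque smooth test_function partial grad.
Context (R : realType) (r m : nat) (p : R) (A D : set 'rV[R]_r) (B : set 'rV[R]_m).
Hypotheses (p0 : 0 < p) (oA : open A) (oD : open D) (oB : open B) (bD : bounded_set D) (DA : D `<=` A).
Local Notation mu1 := (lebesgue_rV R r).
Local Notation mu2 := (lebesgue_rV R m).
Local Notation mu := (lebesgue_rV R (r + m)).
Local Notation rs := (@rsubmx R 1 r m).

Let mA : measurable A. Proof. exact: measurable_rV_open. Qed.
Let mD : measurable D. Proof. exact: measurable_rV_open. Qed.
Let mB : measurable B. Proof. exact: measurable_rV_open. Qed.
Let mAB : measurable (cylinder A B). Proof. exact: measurable_cylinder. Qed.
Let mDB : measurable (cylinder D B). Proof. exact: measurable_cylinder. Qed.
Let DAB : cylinder D B `<=` cylinder A B. Proof. by move=> x [Dx Bx]; split => //; exact: DA. Qed.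

Let integral_rsubmx_le (h : 'rV[R]_m -> R) (e : R) : measurable_fun B h -> (forall y, 0 <= h y) ->
  (\int[mu2]_(y in B) (h y)%:E <= e%:E)%E ->
  (\int[mu]_(x in cylinder D B) (h (rs x))%:E <= (fine (mu1 D) * e)%:E)%E.
Proof.
move=> mh h0 he; have Doo : (mu1 D < +oo)%E by exact: bounded_lebesgue_lty.
have -> : (\int[mu]_(x in cylinder D B) (h (rs x))%:E = mu1 D * \int[mu2]_(y in B) (h y)%:E)%E.
  apply: (integral_rsubmx mD mB (h := fun y => (h y)%:E)); first exact/measurable_EFinP.
  by move=> y _; rewrite lee_fin.
by rewrite EFinM fineK ?ge0_fin_numE//; apply: lee_wpmul2l.
Qed.

(** On the smaller cylinder the difference of the two weak gradients is a weak
    gradient of the difference, hence the chosen one almost everywhere; it is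
    compared with the gradient of [phi - psi]. *)
Lemma wgrad_difference_bound (u : 'rV[R]_(r + m) -> R) (v : 'rV[R]_m -> R)
    (phi : 'rV[R]_(r + m) -> R) (psi : 'rV[R]_m -> R) (e : R) :
  weak_gradient (cylinder A B) u (wgrad (cylinder A B) u) ->
  weak_gradient B v (wgrad B v) -> smooth phi -> smooth psi ->
  (\int[mu]_(x in cylinder A B)
    (enorm (wgrad (cylinder A B) u x - grad phi x) `^ p)%:E <= e%:E)%E ->
  (\int[mu2]_(y in B) (enorm (wgrad B v y - grad psi y) `^ p)%:E <= e%:E)%E ->
  mu.-integrable (cylinder D B)
    (EFin \o (fun x => enorm (grad (fun x => phi x - (psi \o rs) x) x) `^ p)) ->
  (\int[mu]_(x in cylinder D B)
     (enorm (wgrad (cylinder D B) (fun x => u x - v (rs x)) x) `^ p)%:E <=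
   (2 `^ p * (e + 2 `^ p * (\int[mu]_(x in cylinder D B)
      (enorm (grad (fun x => phi x - (psi \o rs) x) x) `^ p) + fine (mu1 D) * e)))%:E)%E.
Proof.
move=> wu wv sphi spsi ue ve iw.
pose w := fun x => phi x - (psi \o rs) x; rewrite -/w in iw *.
pose g x := wgrad (cylinder A B) u x - row_mx 0 (wgrad B v (rs x)).
have wg : weak_gradient (cylinder D B) (fun x => u x - v (rs x)) g.
  apply: weak_gradientB => //; first exact: weak_gradientS mAB mDB DAB wu.
  exact: weak_gradient_rsubmx.
pose X x := enorm (wgrad (cylinder A B) u x - grad phi x) `^ p.
pose Z y := enorm (wgrad B v y - grad psi y) `^ p.
have mX : measurable_fun (cylinder A B) X.
  apply: measurable_enorm_powR.
  exact: measurable_wgrad mAB (weak_gradientB mAB wu (weak_gradient_smooth mAB sphi)).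
have mZ : measurable_fun B Z.
  apply: measurable_enorm_powR.
  exact: measurable_wgrad mB (weak_gradientB mB wv (weak_gradient_smooth mB spsi)).
have X0 x : 0 <= X x by exact: powR_ge0.
have Z0 y : 0 <= Z y by exact: powR_ge0.
have iX : mu.-integrable (cylinder A B) (EFin \o X).
  by apply: ge0_integrable_lty => //; exact: le_lt_trans ue (ltry _).
have iZ : mu2.-integrable B (EFin \o Z).
  by apply: ge0_integrable_lty => //; exact: le_lt_trans ve (ltry _).
have iXD := integrableS mAB mDB DAB iX.
have mZr : measurable_fun (cylinder D B) (Z \o rs) by exact: measurable_fun_rsubmx.
have Zr_le := integral_rsubmx_le mZ Z0 ve.
have iZr : mu.-integrable (cylinder D B) (EFin \o (Z \o rs)).
  apply: ge0_integrable_lty => //; first by move=> x _; exact: Z0.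
  exact: le_lt_trans Zr_le (ltry _).
pose Y x := enorm (grad w x) `^ p.
have iYZ := integrable_addR mDB iw iZr.
have iS := integrable_scaleR mDB (2 `^ p) iYZ.
have iS2 := integrable_scaleR mDB (2 `^ p) (integrable_addR mDB iXD iS).
apply: (@le_trans _ _ (\int[mu]_(x in cylinder D B)
    (2 `^ p * (X x + 2 `^ p * (Y x + Z (rs x))))%:E)%E).
  apply: (@le_trans _ _ (\int[mu]_(x in cylinder D B) (enorm (g x) `^ p)%:E)%E).
    rewrite le_eqVlt; apply/orP; left; apply/eqP; apply: ae_eq_integral => //.
    - apply/measurable_EFinP; apply: measurable_enorm_powR.
      exact: measurable_wgrad mDB (wgradP wg).
    - by apply/measurable_EFinP; apply: measurable_enorm_powR; exact: measurable_wgrad mDB wg.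
    - by apply: filterS (wgrad_eq (open_cylinder oD oB) wg) => x xg Ox /=; rewrite xg.
  apply: ge0_le_integral => //.
  - by move=> x _; rewrite lee_fin powR_ge0.
  - by apply/measurable_EFinP; apply: measurable_enorm_powR; exact: measurable_wgrad mDB wg.
  - by case/integrableP: iS2.
  move=> x _; rewrite lee_fin.
  have -> : g x = (wgrad (cylinder A B) u x - grad phi x) +
      (grad w x + - row_mx 0 (wgrad B v (rs x) - grad psi (rs x))).
    have sr : smooth (psi \o rs) by exact: smooth_rsubmx.
    have -> : grad w x = grad phi x - grad (psi \o rs) x by exact: gradB.
    have -> (a b : 'rV[R]_m) : row_mx 0 (a - b) = row_mx 0 a - row_mx 0 b :> 'rV[R]_(r + m).
      by rewrite opp_row_mx add_row_mx subr0.
    by rewrite grad_rsubmx opprB !subrKA.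
  have p20 : 0 <= 2 `^ p :> R by exact: powR_ge0.
  apply: (le_trans (enormD_powR _ _ (ltW p0))); rewrite ler_wpM2l// lerD2l.
  apply: (le_trans (enormD_powR _ _ (ltW p0))); rewrite ler_wpM2l// lerD2l.
  by rewrite enormN enorm_row_0mx.
rewrite -(EFin_Rintegral mDB iS2) lee_fin.
have -> := RintegralZl (2 `^ p) mDB (integrable_addR mDB iXD iS).
have -> := RintegralD mDB iXD iS.
have -> := RintegralZl (2 `^ p) mDB iYZ.
have -> := RintegralD mDB iw iZr.
have p20 : 0 <= 2 `^ p :> R by exact: powR_ge0.
apply: ler_wpM2l => //; apply: lerD.
  rewrite -lee_fin (EFin_Rintegral mDB iXD); apply: le_trans ue.
  apply: ge0_subset_integral => //; first by case/integrableP: iX.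
  by move=> x _; rewrite lee_fin; exact: X0.
apply: ler_wpM2l => //; rewrite lerD2l -lee_fin (EFin_Rintegral mDB iZr); exact: Zr_le.
Qed.

End weak_gradient_difference.

(** * Dilations and the final rate *)

Section dilation.
Context (R : realType) (d : nat).
Implicit Types (U : set 'rV[R]_d) (l : R).

Lemma dilateE l U : 0 < l -> dilate l U = (fun x => l^-1 *: x) @^-1` U.
Proof.
move=> l0; apply/seteqP; split=> [_ [x Ux <-]|x Ux].
  by rewrite /= scalerA mulVf ?gt_eqF// scale1r.
by exists (l^-1 *: x) => //; rewrite scalerA divff ?gt_eqF// scale1r.
Qed.

Lemma open_dilate l U : 0 < l -> open U -> open (dilate l U).
Proof. by move=> l0 oU; rewrite dilateE//; apply: open_comp => // x _; exact: scaler_continuous. Qed.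

Lemma dilate_sub_cube l M U : 0 < l -> U `<=` cube M -> dilate l U `<=` cube (M * l).
Proof.
by move=> l0 UM _ [x Ux <-] i; rewrite mxE normrM (gtr0_norm l0) mulrC ler_wpM2r// ?(ltW l0)//; exact: UM.
Qed.

Lemma cube_sub_dilate l e U : 0 < l -> cube e `<=` U -> cube (e * l) `<=` dilate l U.
Proof.
move=> l0 eU x xe; rewrite dilateE//; apply: eU => i.
by rewrite mxE normrM gtr0_norm ?invr_gt0// mulrC ler_pdivrMr.
Qed.

Lemma dilateS l l' U : starshaped0 U -> 0 < l -> l <= l' -> dilate l U `<=` dilate l' U.
Proof.
move=> sU l0 ll' _ [x Ux <-]; have l'0 := lt_le_trans l0 ll'.
exists ((l / l') *: x); last by rewrite scalerA mulrC divfK// gt_eqF.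
by apply: sU => //; rewrite divr_ge0 ?(ltW l0) ?(ltW l'0)//= ler_pdivrMr// mul1r.
Qed.

End dilation.

(** About [e * l - s] steps of the iteration fit in a cylinder of length [l], and
    its polynomial volume is absorbed by halving the rate. *)
Lemma decay_rate (R : realType) (q e s C1 C2 : R) (n : nat) :
  0 < q < 1 -> 0 < e -> 0 <= C1 -> 0 <= C2 ->
  exists W b : R, [/\ 0 <= W, 0 < b & forall l, 0 <= l ->
    q ^+ Num.truncn (e * l - s) * (C1 + C2 * l ^+ n) <= W * expR (- (b * l))].
Proof.
move=> q01 e0 C10 C20; have /andP[q0 q1] := q01.
have lnq : ln q < 0 by exact: ln_lt0.
pose b := - (e * ln q) / 2; have b0 : 0 < b by rewrite divr_gt0// oppr_gt0 pmulr_rlt0.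
have [C C0 CP] := powX_le_expR n b0.
exists (expR (- ((s + 1) * ln q)) * (C1 + C2 * C)), b.
split=> // [|l l0]; first by rewrite mulr_ge0 ?expR_ge0// addr_ge0 ?mulr_ge0 ?(ltW C0).
set N := Num.truncn _.
have Ngt : e * l - s - 1 <= N%:R.
  by rewrite lerBlDr natr1 ltW// truncnS_gt.
have qN : q ^+ N <= expR (- ((s + 1) * ln q)) * expR (- (2 * b * l)).
  rewrite -{1}(lnK (q0 : q \is Num.pos)) -expRM_natl -expRD ler_expR.
  have := ler_wnM2r (ltW lnq) Ngt; rewrite /b; lra.
have E1 : 1 <= expR (b * l) by rewrite -expR0 ler_expR mulr_ge0// ltW.
have poly : C1 + C2 * l ^+ n <= (C1 + C2 * C) * expR (b * l).
  rewrite mulrDl; apply: lerD; first by rewrite ler_peMr.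
  by rewrite -mulrA ler_wpM2l// CP.
have C120 : 0 <= C1 + C2 * l ^+ n by rewrite addr_ge0 ?mulr_ge0 ?exprn_ge0.
apply: (@le_trans _ _ (expR (- ((s + 1) * ln q)) * expR (- (2 * b * l)) *
    ((C1 + C2 * C) * expR (b * l)))).
  by apply: ler_pM => //; rewrite exprn_ge0// ltW.
rewrite -!mulrA ler_wpM2l ?expR_ge0// mulrCA ler_wpM2l//.
  by rewrite addr_ge0 ?mulr_ge0 ?(ltW C0).
by rewrite -expRD ler_expR; lra.
Qed.

Theorem theorem5p2 (R : realType) (r m : nat) (p p' lam Lam beta : R)
  (omega1 : set 'rV[R]_r) (omega2 : set 'rV[R]_m)
  (F : 'rV[R]_(r + m) -> R) (f : 'rV[R]_m -> R)
  (hr : (0 < r)%N) (hm : (0 < m)%N)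
  (hp : 1 < p) (hpp' : p^-1 + p'^-1 = 1)
  (omega1_open : open omega1) (omega1_bounded : bounded_set omega1)
  (omega1_0 : omega1 0) (omega1_star : starshaped0 omega1)
  (gauge_lipschitz : exists L : R, forall x y,
     `|gauge omega1 x - gauge omega1 y| <= L * enorm (x - y))
  (omega2_open : open omega2) (omega2_bounded : bounded_set omega2)
  (F_convex : convex_function [set: 'rV[R]_(r + m)] F)
  (hlam : 0 < lam) (hLam : lam <= Lam)
  (F_growth : forall xi,
     lam * enorm xi `^ p <= F xi <= Lam * (enorm xi `^ p + 1))
  (G_growth : forall xi,
     lam * enorm (lsubmx xi) `^ p <= F xi - F (row_mx 0 (rsubmx xi))
       <= Lam * enorm (lsubmx xi) `^ p)
  (hbeta : 0 < beta)
  (F2_convex : forall (xi zeta : 'rV[R]_m) (theta mu : R),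
     0 <= theta <= 1 -> 0 <= mu <= 1 -> theta + mu = 1 ->
     F (row_mx 0 (theta *: xi + mu *: zeta)) <=
       theta * F (row_mx 0 xi) + mu * F (row_mx 0 zeta)
       - beta * theta * mu * (theta `^ (p - 1) + mu `^ (p - 1))
         * enorm (xi - zeta) `^ p)
  (hf : inLp p' omega2 f)
  (u : R -> 'rV[R]_(r + m) -> R) (u_inf : 'rV[R]_m -> R)
  (hu : forall l, 0 < l ->
     minimizer p (cylinder (dilate l omega1) omega2) F (f \o rsubmx) (u l))
  (hu_inf : minimizer p omega2 (fun xi => F (row_mx 0 xi)) f u_inf)
  (l0 : R) (hl0 : 0 < l0) :
  exists C alpha : R, 0 < alpha /\
    forall l, l0 <= l ->
      let Omega := cylinder (dilate l0 omega1) omega2 in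
      (Lp_norm p Omega
         (fun x => enorm (wgrad Omega (fun y => u l y - u_inf (rsubmx y))%R x))
       <= (C * expR (- (alpha * l)))%:E)%E.
Proof.
have p0 : 0 < p by rewrite (lt_trans _ hp).
have p'1 : 1 < p'.
  have p'0 := conjugate_exponent_gt0 hp hpp'; rewrite -invf_lt1// -(ltrD2l p^-1) hpp' ltrDr.
  by rewrite invr_gt0.
have Lam0 : 0 < Lam by exact: lt_le_trans hLam.
(* uniform strict convexity of [F''] at midpoints *)
pose K0 : R := beta * 2^-1 * 2^-1 * (2^-1 `^ (p - 1) + 2^-1 `^ (p - 1)).
have K00 : 0 < K0.
  by rewrite /K0 !mulr_gt0 ?invr_gt0// addr_gt0// powR_gt0 ?invr_gt0.
have Fconv (x y : 'rV[R]_(r + m)) (t : R) : 0 <= t <= 1 ->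
    F (t *: x + (1 - t) *: y) <= t * F x + (1 - t) * F y.
  by move=> /andP[t0 t1]; have := F_convex (Itv01 t0 t1) x y; rewrite !inE/=; apply.
have F0 xi : 0 <= F xi.
  by have /andP[+ _] := F_growth xi; apply: le_trans; rewrite mulr_ge0 ?powR_ge0// ltW.
have Flow xi : lam * enorm xi `^ p <= F xi by have /andP[] := F_growth xi.
have Flam xi : F xi <= Lam * (enorm xi `^ p + 1) by have /andP[] := F_growth xi.
have Glow xi : lam * enorm (lsubmx xi) `^ p <= F xi - F (row_mx 0 (rsubmx xi)).
  by have /andP[] := G_growth xi.
have Gup xi : F xi - F (row_mx 0 (rsubmx xi)) <= Lam * enorm (lsubmx xi) `^ p.
  by have /andP[] := G_growth xi.
have Fhalf (a b : 'rV[R]_m) : F (row_mx 0 (2^-1 *: a + 2^-1 *: b)) <=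
     2^-1 * F (row_mx 0 a) + 2^-1 * F (row_mx 0 b) - K0 * enorm (a - b) `^ p.
  have h01 : (0 : R) <= 2^-1 <= (1 : R).
    by rewrite invr_ge0 ler0n/= invf_le1 ?ltr0n// ler1n.
  by apply: F2_convex => //; rewrite -div1r -splitr.
have [M M0 omega1M] := bounded_sub_cube omega1_bounded.
have [e e0 omega1e] : exists2 e : R, 0 < e & cube e `<=` omega1.
  have /rV_nbhsP[e e0 eP] : nbhs (0 : 'rV[R]_r) omega1 by exact: open_nbhs_nbhs.
  exists (e / 2) => [|x xe]; first by rewrite divr_gt0.
  apply: eP => i; rewrite mxE sub0r normrN (le_lt_trans (xe i))//.
  by rewrite ltr_pdivrMr// ltr_pMr// ltr1n.
have [K /ltW K_ge0 KP] := partial_cutoff_bound R.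
have mB := measurable_rV_open omega2_open.
have [CP CP0 CPP] := poincare hm mB omega2_bounded hp.
pose eta : R := 2^-1 * lam / CP.
have eta0 : 0 < eta by rewrite divr_gt0// mulr_gt0// invr_gt0.
have etaCP : eta * CP <= 2^-1 * lam by rewrite divfK// gt_eqF.
have [Cy /ltW Cy0 young] : exists2 C : R, 0 < C &
    forall a b : R, `|a * b| <= eta * `|a| `^ p + C * `|b| `^ p'.
  by apply: young_small => //; rewrite addrC.
pose T := \int[lebesgue_rV R m]_(y in omega2) (F 0 + Cy * `|f y| `^ p').
have T0 : 0 <= T.
  by apply: Rintegral_ge0 => y _; rewrite addr_ge0// mulr_ge0// powR_ge0.
pose c := Num.min (2^-1 * lam) K0 / 2 `^ p.
pose k := Lam * 2 `^ p * (1 + (r%:R * K) `^ p) * (1 + CP).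
have p20 : 0 < 2 `^ p :> R by rewrite powR_gt0.
have c0 : 0 < c by rewrite divr_gt0// lt_min K00 mulr_gt0// invr_gt0.
have k0 : 0 < k.
  rewrite /k; apply: mulr_gt0; last by rewrite addr_gt0.
  by rewrite !mulr_gt0// ltr_wpDr// powR_ge0.
pose q := k / (c + k).
have q01 : 0 < q < 1.
  by rewrite divr_gt0 ?addr_gt0//= ltr_pdivrMr ?addr_gt0// mul1r ltrDr.
have /andP[q0 q1] := q01.
pose s0 := M * l0.
have s00 : 0 <= s0 by rewrite mulr_ge0 ?(ltW M0) ?(ltW hl0).
pose D := dilate l0 omega1.
have oD : open D by exact: open_dilate.
have mD := measurable_rV_open oD.
have bounded_dilate l : 0 < l -> bounded_set (dilate l omega1).
  by move=> l_gt0; apply: (sub_bounded_set (dilate_sub_cube l_gt0 omega1M)); exact: bounded_cube.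
pose vD := fine (lebesgue_rV R r D).
have vD0 : 0 <= vD by exact: fine_ge0.
pose C1 : R := 2 `^ p * (1 + 2 `^ p * (2 `^ p * (2 / lam) + c^-1 + vD)).
pose C2 : R := 2 `^ p * (2 `^ p * (2 `^ p * (2 / lam) * (2 * T * (M *+ 2) ^+ r))).
have l20 : 0 <= 2 / lam by rewrite divr_ge0// ltW.
have C10 : 0 <= C1.
  rewrite /C1 mulr_ge0 ?(ltW p20)// addr_ge0// mulr_ge0 ?(ltW p20)// addr_ge0//.
  by rewrite addr_ge0 ?invr_ge0 ?(ltW c0)// mulr_ge0// ltW.
have C20 : 0 <= C2.
  have M2 : 0 <= (M *+ 2) ^+ r by rewrite exprn_ge0// mulrn_wge0// ltW.
  by do 2![apply: mulr_ge0; first exact: ltW]; apply: mulr_ge0; [apply: mulr_ge0; [exact: ltW|]|rewrite !mulr_ge0].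
have [W [b [W0 b0 WP]]] := decay_rate s0 r q01 e0 C10 C20.
exists (W `^ p^-1), (b / p); split; first by rewrite divr_gt0.
move=> l l0l; cbv zeta.
have l_gt0 : 0 < l by exact: lt_le_trans l0l.
apply: (Lp_norm_le p0); first by rewrite mulr_ge0 ?powR_ge0// expR_ge0.
have -> : (W `^ p^-1 * expR (- (b / p * l))) `^ p = W * expR (- (b * l)).
  rewrite powRM ?powR_ge0 ?expR_ge0// -powRrM mulVf ?gt_eqF// powRr1//; congr (_ * _).
  rewrite /powR gt_eqF ?expR_gt0// expRK; congr expR.
  by rewrite mulrN; congr (- _); field; rewrite gt_eqF.
under eq_integral do rewrite ger0_norm ?enorm_ge0//.
pose A := dilate l omega1.
have oA : open A by exact: open_dilate.
have bA : bounded_set A by exact: bounded_dilate.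
have mA := measurable_rV_open oA.
have DA : D `<=` A by exact: dilateS.
pose a := fine (lebesgue_rV R r A).
have a0 : 0 <= a by exact: fine_ge0.
have aM : a <= (M *+ 2) ^+ r * l ^+ r.
  rewrite -exprMn mulrnAl.
  rewrite (_ : _ ^+ r = fine (lebesgue_rV R r (cube (M * l)))); last first.
    by rewrite lebesgue_cube// mulr_ge0 ?(ltW M0) ?(ltW l_gt0).
  rewrite /a fine_le//.
  - by rewrite ge0_fin_numE//; exact: bounded_lebesgue_lty.
  - by rewrite lebesgue_cube// mulr_ge0 ?(ltW M0) ?(ltW l_gt0).
  - apply: le_measure; rewrite ?inE//; first exact: measurable_cube.
    exact: dilate_sub_cube.
(* the cubes of half-side [s0, s0 + 1, ..., s0 + N] stay inside the cross section *)
pose N := Num.truncn (e * l - s0).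
have hN : N = 0%N \/ cube (s0 + N%:R) `<=` A.
  have [h|h] := leP 0 (e * l - s0); last first.
    by left; apply/Num.Theory.truncn0Pn; rewrite -ltNge (lt_trans h).
  right; apply: (subset_trans _ (cube_sub_dilate l_gt0 omega1e)) => x xs i.
  apply: (le_trans (xs i)); rewrite addrC -lerBrDr.
  by rewrite Num.Theory.truncn_le.
have qN0 : 0 < q ^+ N by rewrite exprn_gt0.
have qN1 : q ^+ N <= 1 by rewrite exprn_ile1 ?(ltW q0) ?(ltW q1).
(* the error of the near minimizers is chosen so that its contribution over the
   whole cylinder is of the order of the decay factor *)
pose eps := q ^+ N / (1 + a).
have a10 : 0 < 1 + a by rewrite ltr_wpDr.
have eps0 : 0 < eps by rewrite divr_gt0.
have epsa : eps * (1 + a) = q ^+ N by rewrite divfK// gt_eqF.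
have epsq : eps <= q ^+ N by rewrite ler_pdivrMr// ler_peMr ?(ltW qN0)// lerDl.
have F2c := section_convex Fconv; have F2l := section_growth Flam.
have fr := inLp_rsubmx hp hpp' oA bA omega2_open hf.
have [phi [tphi _ ephi min_phi]] := near_minimizer hp hpp' (open_cylinder oA omega2_open)
  (bounded_cylinder bA omega2_bounded) Fconv F0 Flam fr (hu l l_gt0) eps0.
have [psi [tpsi _ epsi min_psi]] := near_minimizer hp hpp' omega2_open omega2_bounded
  F2c (fun=> F0 _) F2l hf hu_inf eps0.
have sphi := test_function_smooth tphi; have spsi := test_function_smooth tpsi.
have sw : smooth (fun x => phi x - (psi \o rsubmx) x).
  by apply: (smoothB sphi); exact: smooth_rsubmx.
have H := difference_energy_bound hp hpp' hlam oA bA omega2_open omega2_bounded Fconv F0 Flam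
  hf CP0 CPP tphi tpsi min_phi min_psi Flow (ltW eta0) etaCP Cy0 young.
have I := local_energy_decay hp hpp' hlam (ltW Lam0) K00 oA bA omega2_open omega2_bounded
  Fconv F0 Flam Glow Gup Fhalf hf K_ge0 (KP r) CP0 CPP (ltW eps0) tphi tpsi min_phi min_psi
  mD DA s00 (dilate_sub_cube hl0 omega1M) hN.
have iw := @grad_powR_integrable _ _ (cylinder D omega2)
  (measurable_cylinder mD mB) (bounded_cylinder (bounded_dilate l0 hl0) omega2_bounded) _ p p0 sw.
have [[[_ wu _] _] _] := hu l l_gt0; have [[[_ wv _] _] _] := hu_inf.
have G := wgrad_difference_bound p0 oA oD omega2_open (bounded_dilate l0 hl0) DA wu wv
  sphi spsi ephi epsi iw.
apply: (le_trans G); rewrite lee_fin; apply: (le_trans _ (WP l (ltW l_gt0))).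
clear G WP; move: I H; rewrite -/c -/k -/q -/a -/T -/vD -/A -/D epsa.
set E := \int[_]_(x in cylinder D _) _; set EA := \int[_]_(x in cylinder A _) _ => I H.
pose P1 := 2 `^ p * (2 / lam); have P10 : 0 <= P1 by rewrite mulr_ge0// ltW.
pose EB := P1 * (2 * ((M *+ 2) ^+ r * l ^+ r) * T + 1).
have EAB : EA <= EB.
  by apply: (le_trans H); rewrite ler_wpM2l// [_ * eps]mulrC epsa lerD// ler_wpM2r// ler_wpM2l.
have ED : E + vD * eps <= q ^+ N * (EB + c^-1 + vD).
  have := ler_wpM2l (ltW qN0) EAB; have := ler_wpM2l vD0 epsq; move: I; lra.
have -> : q ^+ N * (C1 + C2 * l ^+ r) =
    2 `^ p * (q ^+ N + 2 `^ p * (q ^+ N * (EB + c^-1 + vD))).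
  by rewrite /C1 /C2 /EB /P1; ring.
by rewrite ler_wpM2l ?(ltW p20)// lerD// ler_wpM2l ?(ltW p20).
Qed.
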